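(* Let $f\colon\mathbb{F}\to\mathbb{H}$ be a relatively algebraically closed homomorphism from an algebraically closed field $\mathbb{F}$ to a hyperfield $\mathbb{H}$. Then for every ideal $I\subseteq\mathbb{F}[X_1,\dots,X_n]$, $$f(V(I)) = V(f_*(I)).$$ Moreover, for every Laurent ideal $J\subseteq\mathbb{F}[X_1^{\pm},\dots,X_n^{\pm}]$, $$f(V^\times(J)) = V^\times(f_*(J)).$$
   Context: **Hyperfields.** A hyperoperation on a set $H$ is a map $\boxplus$ from $H\times H$ to the non-empty subsets of $H$; for subsets, $A\boxplus B=\bigcup_{a\in A,b\in B}a\boxplus b$, singletons are identified with their elements, and longer hypersums are obtained by iteration. A hyperfield is a tuple $(\mathbb{H},\boxplus,\odot,0_{\mathbb H},1_{\mathbb H})$ such that: $\boxplus$ is an associative and commutative hyperoperation; $0_{\mathbb H}\boxplus a=a$; each $a$ has a unique $-a$ with $0_{\mathbb H}\in a\boxplus(-a)$; $a\in b\boxplus c$ iff $c\in a\boxplus(-b)$; $\mathbb{H}^\times:=\mathbb{H}\setminus\{0_{\mathbb H}\}$ is an abelian group under the single-valued operation $\odot$ with identity $1_{\mathbb H}$; $a\odot(b\boxplus c)=(a\odot b)\boxplus(a\odot c)$; and $0_{\mathbb H}\odot a=0_{\mathbb H}$. Every field is a hyperfield with $a\boxplus b=\{a+b\}$. **Homomorphisms.** A hyperfield homomorphism $f\colon\mathbb{H}_1\to\mathbb{H}_2$ is a map with $f(a\boxplus_1 b)\subseteq f(a)\boxplus_2 f(b)$, $f(a\odot_1 b)=f(a)\odot_2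 f(b)$, $f(0)=0$, $f(1)=1$. It is applied coordinatewise to tuples. **(Laurent) polynomials.** $\mathbb{H}[X_1,\dots,X_n]$ is the set of formal expressions $p=\boxplus_{\mathbf{d}\in D}c_{\mathbf d}\odot \mathbf{X}^{\mathbf d}$ with $D\subset\mathbb{Z}_{\ge0}^n$ finite and $c_{\mathbf d}\in\mathbb{H}^\times$; Laurent polynomials $\mathbb{H}[X_1^\pm,\dots,X_n^\pm]$ are the same with $D\subset\mathbb{Z}^n$ finite. Evaluation at $\mathbf a\in\mathbb{H}^n$ (resp. $\mathbf a\in(\mathbb{H}^\times)^n$ for Laurent polynomials) gives a subset $p(\mathbf a)=\boxplus_{\mathbf d\in D}c_{\mathbf d}\odot\mathbf a^{\mathbf d}\subseteq\mathbb{H}$ (equal to $\{0_{\mathbb H}\}$ if $D=\emptyset$). For $p$ a polynomial $V(p)=\{\mathbf a\in\mathbb{H}^n\mid 0_{\mathbb H}\in p(\mathbf a)\}$, and for $p$ a Laurent polynomial $V^\times(p)=\{\mathbf a\in(\mathbb{H}^\times)^n\mid 0_{\mathbb H}\in p(\mathbf a)\}$. For a set $S$ of (Laurent) polynomials, $V(S)=\bigcap_{p\in S}V(p)$, resp. $V^\times(S)=\bigcap_{p\in S}V^\times(p)$. The push-forward of $p$ along $f$ is $f_*(p)=\boxplus_{\mathbf d\in D}f(c_{\mathbf d})\odot\mathbf X^{\mathbf d}$, and $f_*(I)=\{f_*(p)\mid p\in I\}$. **RAC.** A surjective hyperfield homomorphism $f\colon\mathbb{H}_1\to\mathbb{H}_2$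 is relatively algebraically closed if for every univariate polynomial $p\in\mathbb{H}_1[X]$ and every root $\beta\in V(f_*(p))$ there exists $\alpha\in f^{-1}(\beta)$ with $\alpha\in V(p)$. *)

(* Defs.v *)
From HB Require Import structures.
From mathcomp Require Import all_boot all_order all_algebra finmap.
From mathcomp Require Import boolp classical_sets.
From mathcomp Require Import freeg mpoly.

Set Implicit Arguments.
Unset Strict Implicit.
Unset Printing Implicit Defensive.

Import GRing.Theory.
Local Open Scope ring_scope.
Local Open Scope classical_set_scope.

Definition setwise (T : Type) (op : T -> T -> set T) (A B : set T) : set T :=
  \bigcup_(a in A) \bigcup_(b in B) op a b.

(* Nothing is required of [hinv h0]; [hinv] is only used on nonzero elements. *)
HB.mixin Record Choice_isHyperfield H of Choice H := {
  hadd : H -> H -> set H;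
  hmul : H -> H -> H;
  h0 : H;
  h1 : H;
  hopp : H -> H;
  hinv : H -> H;
  hadd_neq0 : forall a b, hadd a b !=set0;
  haddA : forall a b c,
    setwise hadd (hadd a b) [set c] = setwise hadd [set a] (hadd b c);
  haddC : forall a b, hadd a b = hadd b a;
  hadd0 : forall a, hadd h0 a = [set a];
  haddN : forall a b, hadd a b h0 <-> b = hopp a;
  hadd_rev : forall a b c, hadd b c a <-> hadd a (hopp b) c;
  h1_neq0 : h1 != h0;
  hmul_neq0 : forall a b, a != h0 -> b != h0 -> hmul a b != h0;
  hmulA : forall a b c, a != h0 -> b != h0 -> c != h0 ->
    hmul a (hmul b c) = hmul (hmul a b) c;
  hmulC : forall a b, a != h0 -> b != h0 -> hmul a b = hmul b a;
  hmul1 : forall a, a != h0 -> hmul h1 a = a;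
  hinv_neq0 : forall a, a != h0 -> hinv a != h0;
  hmulV : forall a, a != h0 -> hmul (hinv a) a = h1;
  hmulD : forall a b c, hmul a @` hadd b c = hadd (hmul a b) (hmul a c);
  hmul0 : forall a, hmul h0 a = h0
}.

#[short(type="hyperfieldType")]
HB.structure Definition Hyperfield := { H of Choice_isHyperfield H & Choice H }.

Definition hyperfield_of (F : fieldType) : Type := F.

Section HyperfieldOf.
Variable F : fieldType.

HB.instance Definition _ := Choice.on (hyperfield_of F).

Let add (a b : F) : set F := [set a + b].

Let addS (A B : set F) : setwise add A B = [set a + b | a in A & b in B].
Proof.
apply/seteqP; split=> [x [a Aa [b Bb ->]]|x [a Aa [b Bb <-]]].
  by exists a => //; exists b.
by exists a => //; exists b.
Qed.

Let add_neq0 a b : add a b !=set0.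
Proof. by exists (a + b). Qed.

Let addA a b c : setwise add (add a b) [set c] = setwise add [set a] (add b c).
Proof.
rewrite !addS /add; apply/seteqP; split=> x.
  by case=> _ -> [_ -> <-]; exists a => //; exists (b + c) => //; rewrite addrA.
by case=> _ -> [_ -> <-]; exists (a + b) => //; exists c => //; rewrite addrA.
Qed.

Let addC a b : add a b = add b a.
Proof. by rewrite /add addrC. Qed.

Let add0 a : add 0 a = [set a].
Proof. by rewrite /add add0r. Qed.

Let addN a b : add a b 0 <-> b = - a.
Proof.
split=> [/esym/eqP|->]; last by rewrite /add /= subrr.
by rewrite addrC addr_eq0 => /eqP.
Qed.

Let add_rev a b c : add b c a <-> add a (- b) c.
Proof. by rewrite /add /=; split=> ->; [rewrite addrC addKr|rewrite addrC subrK]. Qed.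

Let mulD a b c : ( *%R a) @` add b c = add (a * b) (a * c).
Proof. by rewrite /add image_set1 mulrDr. Qed.

HB.instance Definition _ := Choice_isHyperfield.Build (hyperfield_of F)
  add_neq0 addA addC add0 addN add_rev (oner_neq0 F)
  (fun a b a0 b0 => mulf_neq0 a0 b0)
  (fun a b c _ _ _ => mulrA a b c) (fun a b _ _ => mulrC a b)
  (fun a _ => mul1r a) (fun a a0 => invr_neq0 a0) (fun a a0 => mulVf a0)
  mulD (@mul0r F).

End HyperfieldOf.

Record hyperfield_hom (H1 H2 : hyperfieldType) (f : H1 -> H2) : Prop := {
  hom_add : forall a b, f @` hadd a b `<=` hadd (f a) (f b);
  hom_mul : forall a b, f (hmul a b) = hmul (f a) (f b);
  hom_0 : f h0 = h0;
  hom_1 : f h1 = h1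
}.

(* Formal expressions over a hyperfield with exponents in M: the index set D of
   an expression is the (finite) support. *)
Notation hexpr M H := {fsfun M -> H%type with (@h0 H)}.
Definition hpoly (n : nat) (H : hyperfieldType) := hexpr 'X_{1..n} H.
Definition hlaurent (n : nat) (H : hyperfieldType) :=
  hexpr {ffun 'I_n -> int} H.

Section Evaluation.
Variable H : hyperfieldType.

Fixpoint hsum (s : seq H) : set H :=
  if s is a :: s' then setwise hadd [set a] (hsum s') else [set h0].

Definition hexp (a : H) (k : nat) : H := iter k (hmul a) h1.

Definition hexpz (a : H) (k : int) : H :=
  match k with Posz m => hexp a m | Negz m => hexp (hinv a) m.+1 end.

Definition hmonom n (a : 'I_n -> H) (d : 'X_{1..n}) : H :=
  \big[hmul/h1]_(i < n) hexp (a i) (d i).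

Definition hlmonom n (a : 'I_n -> H) (d : {ffun 'I_n -> int}) : H :=
  \big[hmul/h1]_(i < n) hexpz (a i) (d i).

(* The value does not depend on the order in which [finsupp p] is enumerated. *)
Definition heval (M : choiceType) (mon : M -> H) (p : hexpr M H) : set H :=
  hsum [seq hmul (p d) (mon d) | d <- finsupp p].

Definition V n (p : hpoly n H) : set ('I_n -> H) :=
  [set a | heval (hmonom a) p h0].

Definition Vx n (p : hlaurent n H) : set ('I_n -> H) :=
  [set a | (forall i, a i != h0) /\ heval (hlmonom a) p h0].

Definition VS n (S : set (hpoly n H)) : set ('I_n -> H) := \bigcap_(p in S) V p.

Definition VxS n (S : set (hlaurent n H)) : set ('I_n -> H) :=
  [set a | forall i, a i != h0] `&` \bigcap_(p in S) Vx p.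

End Evaluation.

Definition pushforward (H1 H2 : hyperfieldType) (f : H1 -> H2)
    (M : choiceType) (p : hexpr M H1) : hexpr M H2 :=
  [fsfun d in finsupp p => f (p d)].

Definition relatively_algebraically_closed
    (H1 H2 : hyperfieldType) (f : H1 -> H2) : Prop :=
  [/\ hyperfield_hom f,
      forall y, exists x, f x = y &
      forall (p : hpoly 1 H1) (b : H2),
        V (pushforward f p : hpoly 1 H2) (fun=> b) ->
        exists2 a, f a = b & V p (fun=> a)].

(* Same underlying type as {mpoly R[n]}, with exponents in Z^n instead of N^n
   (the monomials of monalg cannot be used: they have no nontrivial inverses). *)
Definition laurent (n : nat) (R : comNzRingType) : Type :=
  {freeg {ffun 'I_n -> int} / R}.

Section LaurentRing.
Variables (n : nat) (R : comNzRingType).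
Local Notation E := {ffun 'I_n -> int}.
Local Notation L := (laurent n R).

HB.instance Definition _ := Choice.on L.
HB.instance Definition _ := GRing.Lmodule.on L.

Definition laurent_one : L := << 0 : E >>.
Definition laurent_mul (p q : L) : L :=
  \sum_(d <- dom p) \sum_(e <- dom q) << coeff d p * coeff e q *g d + e >>.

Let mk (c : R) (d : E) : L := << c *g d >>.

Let mkD d c c' : mk (c + c') d = mk c d + mk c' d.
Proof. by rewrite /mk freegUD. Qed.

Let mk0 d : mk 0 d = 0.
Proof. exact: freegU0. Qed.

Let sum_dom (g : R -> E -> L) (p : L) (s : seq E) :
  (forall d, g 0 d = 0) -> uniq s -> {subset dom p <= s} ->
  \sum_(d <- dom p) g (coeff d p) d = \sum_(d <- s) g (coeff d p) d.
Proof.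
move=> g0 us sub.
rewrite (bigID (mem (dom p)) predT _ (r := s)) /= [X in _ + X]big1 => [|d nd].
  rewrite addr0 -[RHS]big_filter; apply: perm_big.
  apply: uniq_perm; rewrite ?uniq_dom ?filter_uniq // => d.
  by rewrite mem_filter; case: (boolP (d \in dom p)) => //= /sub ->.
by rewrite coeff_outdom.
Qed.

Let lin (g : R -> E -> L) (gD : forall d, {morph g^~ d : a b / a + b}) (p q : L) :
  \sum_(d <- dom (p + q)) g (coeff d (p + q)) d =
  \sum_(d <- dom p) g (coeff d p) d + \sum_(d <- dom q) g (coeff d q) d.
Proof.
have g0 d : g 0 d = 0 by apply: (addrI (g 0 d)); rewrite -gD !addr0.
pose s := undup (dom p ++ dom q).
rewrite !(@sum_dom g _ s) ?undup_uniq //.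
- by rewrite -big_split /=; apply: eq_bigr => d _; rewrite -gD coeffD.
- by move=> d dq; rewrite mem_undup mem_cat dq orbT.
- by move=> d dp; rewrite mem_undup mem_cat dp.
by move=> d /domD_subset; rewrite mem_undup.
Qed.

Let mulDl : left_distributive laurent_mul +%R.
Proof.
move=> p q r; rewrite /laurent_mul.
apply: (lin (g := fun c d => \sum_(e <- dom r) mk (c * coeff e r) (d + e))).
move=> d a b /=; rewrite -big_split /=; apply: eq_bigr => e _.
by rewrite mulrDl mkD.
Qed.

Let mulC : commutative laurent_mul.
Proof.
move=> p q; rewrite /laurent_mul exchange_big /=.
by apply: eq_bigr => d _; apply: eq_bigr => e _; rewrite mulrC addrC.
Qed.

Let mulDr : right_distributive laurent_mul +%R.
Proof. by move=> p q r; rewrite mulC mulDl !(mulC _ p). Qed.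

Let mul0 p : laurent_mul p 0 = 0.
Proof. by apply: (addrI (laurent_mul p 0)); rewrite -mulDr !addr0. Qed.

Let mulU a d b e : laurent_mul (mk a d) (mk b e) = mk (a * b) (d + e).
Proof.
case: (eqVneq a 0) => [->|a0]; first by rewrite mul0r !mk0 mulC mul0.
case: (eqVneq b 0) => [->|b0]; first by rewrite mulr0 !mk0 mul0.
by rewrite /laurent_mul /mk !domU // !big_seq1 !coeffU !eqxx !mulr1.
Qed.

Let mulA : associative laurent_mul.
Proof.
move=> p q r; elim/freeg_ind_dom0: p => [|a d p _ _ IHp].
  by rewrite !(mulC 0) !mul0 mulC mul0.
rewrite 3!mulDl IHp; congr (_ + _); clear p IHp.
elim/freeg_ind_dom0: q => [|b e q _ _ IHq].
  by rewrite (mulC 0) !mul0 mulC mul0.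
rewrite mulDl !mulDr mulDl IHq; congr (_ + _); clear q IHq.
elim/freeg_ind_dom0: r => [|c h r _ _ IHr]; first by rewrite !mul0.
rewrite !mulDr IHr; congr (_ + _); clear r IHr.
by rewrite -!/(mk _ _) !mulU mulrA addrA.
Qed.

Let mul1 : left_id laurent_one laurent_mul.
Proof.
elim/freeg_ind_dom0 => [|a d p _ _ IHp]; first by rewrite mul0.
by rewrite mulDr IHp -/(mk _ _) mulU mul1r add0r.
Qed.

Let one_neq0 : laurent_one != 0.
Proof. by rewrite freegU_eq0 oner_neq0. Qed.

HB.instance Definition _ := GRing.Zmodule_isComNzRing.Build L
  mulA mulC mul1 mulDl one_neq0.

End LaurentRing.

(* Unlike [idealr_closed] of ring_quotient, the unit ideal is allowed. *)
Definition ideal (R : comNzRingType) (I : set R) : Prop :=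
  [/\ I 0, forall x y, I x -> I y -> I (x + y) & forall r x, I x -> I (r * x)].

Definition poly_hexpr n (F : fieldType) (p : {mpoly F[n]}) :
    hpoly n (hyperfield_of F) :=
  [fsfun d in [fset d | d in msupp p]%fset => p@_d].

Definition laurent_hexpr n (F : fieldType) (p : laurent n F) :
    hlaurent n (hyperfield_of F) :=
  [fsfun d in [fset d | d in dom p]%fset => coeff d p].

(* Main.v *)
From HB Require Import structures.
Require Import Defs.
From mathcomp Require Import all_boot all_order all_algebra finmap.
From mathcomp Require Import closed_field.
From mathcomp Require Import boolp classical_sets.
From mathcomp Require Import generic_quotient ring_quotient fraction.
From mathcomp Require Import freeg mpoly.
From mathcomp Require Import ring zify.

Set Implicit Arguments.
Unset Strict Implicit.
Unset Printing Implicit Defensive.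

Import GRing.Theory.
Local Open Scope ring_scope.
Local Open Scope classical_set_scope.

(** Let [U] be the fibre of [f] over [1]. For univariate polynomials, lifting
    the root [1] means that a relation [\sum c_i * u_i = 0] with all [u_i] in
    [U] can be replaced by a relation [\sum c_i * w ^+ i = 0] with a single [w]
    in [U] ([fibre_root_lifting]). This has two consequences.

    Kronecker's substitution turns a polynomial in several variables into a
    univariate one with the same coefficients; hence the zeros of a single
    polynomial lift ([hypersurface_lifting]).

    For quadratic polynomials it says that [U] looks like a ball from every
    point outside [U]. This forces [U] to be either [1 + m] or the unit group
    of [O], for some valuation ring [O] of [F] with maximal ideal [m]
    ([root_lifting_shape]).

    Let [b] be a zero of the push-forward of an ideal. After rescaling by a
    preimage of [b], every element of the ideal has a zero in [U^n], and a
    common zero in [U^n] is wanted ([common_zero]). A prime ideal that contains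
    the given one, but no polynomial without zeros in [U^n], provides a point
    over its residue field, and Chevalley's theorem a valuation of an
    algebraically closed extension [M] for which this point satisfies the
    conditions that define [U^n] ([valued_extension]).

    Finally the point is moved from [M] down to [F], because algebraically
    closed valued fields are existentially closed ([descent]). The coordinates
    are brought down one after the other. The essential case is that of a point
    algebraic over [N(t)], where [N] is algebraically closed and [t] is
    transcendental ([specialize]): [t] is replaced by an element of [N] which
    preserves the comparisons between the values of finitely many polynomials
    in [t] ([approximate_transcendental]). The coordinates are simultaneous
    eigenvalues of commuting matrices over [N(t)]; whether such eigenvalues are
    small is visible in the coefficients of the determinant of a generic linear
    combination of these matrices, so it survives the replacement.

    A Laurent ideal has the same zeros with nonzero coordinates as the ideal of
    the polynomials that it contains, which settles the second statement. *)

(** * Prime ideals and residue fields *)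
Definition prime_ideal (R : comNzRingType) (P : set R) : Prop :=
  [/\ ideal P, ~ P 1 & forall x y, P (x * y) -> P x \/ P y].

(** An ideal maximal among those that contain [I] and avoid [S] is prime: if it
    contains neither [x] nor [y], then modulo it a multiple of [x] and a
    multiple of [y] lie in [S], and so does the product of these. *)
Lemma prime_ideal_avoiding (R : comNzRingType) (I S : set R) :
  ideal I -> S 1 -> (forall x y, S x -> S y -> S (x * y)) ->
  (forall x, I x -> ~ S x) ->
  exists P : set R, [/\ prime_ideal P, I `<=` P & forall x, P x -> ~ S x].
Proof.
move=> [I0 ID IM] S1 SM IS.
pose good Q := ideal (I `|` Q) /\ forall x, (I `|` Q) x -> ~ S x.
have [F Fgood Ftot|A [[[P0 PD PM] PS] Amax]] := @Zorn_bigcup R good.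
  split; last first.
    by move=> x [/IS//|[Q FQ Qx]]; apply: (Fgood _ FQ).2; right.
  split; first by left.
    move=> x y [Ix|[Q FQ Qx]] [Iy|[Q' FQ' Qy]]; first by left; apply: ID.
    - have [[_ D _] _] := Fgood _ FQ'.
      by case: (D x y (or_introl Ix) (or_intror Qy)); [left|right; exists Q'].
    - have [[_ D _] _] := Fgood _ FQ.
      by case: (D x y (or_intror Qx) (or_introl Iy)); [left|right; exists Q].
    wlog QQ' : x y Q Q' FQ FQ' Qx Qy / Q `<=` Q'.
      move=> W; case: (Ftot _ _ FQ FQ') => sub; first exact: (W x y Q Q').
      by rewrite addrC; apply: (W y x Q' Q).
    have [[_ D _] _] := Fgood _ FQ'.
    have := D x y (or_intror (QQ' _ Qx)) (or_intror Qy).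
    by case; [left|right; exists Q'].
  move=> r x [Ix|[Q FQ Qx]]; first by left; apply: IM.
  have [[_ _ M] _] := Fgood _ FQ.
  by case: (M r x (or_intror Qx)); [left|right; exists Q].
pose P := I `|` A; exists P; split=> //; last by left.
have adj x : ~ P x -> exists p r, P p /\ S (p + r * x).
  move=> nPx; apply: contrapT => no.
  apply: (Amax [set p + r * x | p in P & r in setT]).
    split=> [y Ay|sub].
      by exists y; [right|exists 0 => //; rewrite mul0r addr0].
    apply: nPx; right; apply: sub; exists 0 => //; exists 1 => //.
    by rewrite mul1r add0r.
  have IU : I `|` [set p + r * x | p in P & r in setT] =
            [set p + r * x | p in P & r in setT].
    apply/seteqP; split=> y; last by right.
    case=> // Iy; exists y; first by left.
    by exists 0 => //; rewrite mul0r addr0.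
  rewrite /good IU; split; last first.
    by move=> _ [p Pp [r _ <-]] Sp; apply: no; exists p, r.
  split.
  - by exists 0 => //; exists 0 => //; rewrite mul0r addr0.
  - move=> _ _ [p Pp [r _ <-]] [p' Pp' [r' _ <-]].
    exists (p + p'); first exact: PD.
    by exists (r + r') => //; ring.
  - move=> c _ [p Pp [r _ <-]]; exists (c * p); first exact: PM.
    by exists (c * r) => //; ring.
split; first by split.
  by move=> /PS; apply.
move=> x y Pxy; apply: contrapT => /not_orP[/adj[p [r [Pp Sx]]] /adj[q [s [Pq Sy]]]].
apply: (PS _ _ (SM _ _ Sx Sy)).
have -> : (p + r * x) * (q + s * y) =
          (q + s * y) * p + (r * x * q + r * s * (x * y)) by ring.
by apply: (PD); [exact: PM|apply: (PD); exact: PM].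
Qed.

(** The partial inverse that comes with an integral domain is chosen
    classically. *)
Lemma idomain_of_no_zero_divisors (R : comNzRingType) :
  (forall x y : R, x * y = 0 -> (x == 0) || (y == 0)) ->
  exists (D : idomainType) (f : {rmorphism R -> D}), injective f.
Proof.
move=> nozd.
pose unit : pred R := fun x => `[< exists y, y * x = 1 >].
pose inv (x : R) : R :=
  if pselect (exists y : R, y * x = 1) is left e then projT1 (cid e) else x.
have mulVr : {in unit, left_inverse 1 inv *%R}.
  by move=> x /asboolP e; rewrite /inv; case: pselect => // e'; case: cid.
have unitPl x y : y * x = 1 -> unit x by move=> e; apply/asboolP; exists y.
have inv_out : {in [predC unit], inv =1 id}.
  by move=> x /asboolP; rewrite /inv; case: pselect.
pose m1 := GRing.ComNzRing_hasMulInverse.Build R mulVr unitPl inv_out.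
pose U : comUnitRingType := HB.pack R m1.
pose m2 := GRing.ComUnitRing_isIntegral.Build U nozd.
pose D : idomainType := HB.pack U m2.
by exists D, (idfun : {rmorphism R -> R}).
Qed.

Lemma prime_ideal_residue_field (R : comNzRingType) (P : set R) :
  prime_ideal P ->
  exists (K : fieldType) (phi : {rmorphism R -> K}), forall x, phi x = 0 <-> P x.
Proof.
case=> [[P0 PD PM] P1 Pprime].
pose S : {pred R} := fun x => `[< P x >].
have PS x : (x \in S) = `[< P x >] by [].
have Szmod : zmod_closed S.
  split=> [|x y]; rewrite !PS; first exact/asboolP.
  move=> /asboolP Px /asboolP Py; apply/asboolP; apply: PD => //.
  by rewrite -mulN1r; apply: PM.
have Sproper : 1 \notin S /\ forall a, {in S, forall u, a * u \in S}.
  split; first by rewrite PS; apply/asboolP.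
  by move=> a x; rewrite !PS => /asboolP Px; apply/asboolP/PM.
have Sprime : prime_idealr_closed S.
  move=> x y; rewrite !PS => /asboolP/Pprime[] Pz; apply/orP.
    by left; apply/asboolP.
  by right; apply/asboolP.
pose m1 := GRing.isZmodClosed.Build R S Szmod.
pose m2 := isProperIdeal.Build R S Sproper.
pose m3 := isPrimeIdealrClosed.Build R S Sprime.
pose I : prime_idealr R := HB.pack (S : R -> bool) m1 m2 m3.
have [D [f finj]] := idomain_of_no_zero_divisors (@Quotient.rquot_IdomainAxiom R I).
pose p : {rmorphism R -> {ideal_quot I}} := (\pi_{ideal_quot I})%qT.
pose phi : {rmorphism R -> {fraction D}} := (@tofrac D) \o (f \o p).
exists {fraction D}, phi => x.
have -> : phi x = @tofrac D (f (p x)) by [].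
have px0 : (p x == 0) = (x \in S).
  have := Quotient.idealrBE I x 0; rewrite subr0 => ->.
  by rewrite -[0 in LHS](rmorph0 p).
split=> [/eqP|Px].
  rewrite tofrac_eq0 -(rmorph0 f) (inj_eq finj) px0; exact: asboolW.
apply/eqP; rewrite tofrac_eq0 -(rmorph0 f) (inj_eq finj) px0; exact: asboolT.
Qed.

(** * Algebraic closures *)
Lemma field_ext_root (K : fieldType) (p : {poly K}) : size p != 1%N ->
  exists (L : fieldType) (g : {rmorphism K -> L}) (z : L),
    root (map_poly g p) z.
Proof.
move=> sp.
have [|||| P [Ppr IP _]] := @prime_ideal_avoiding _ [set q : {poly K} | p %| q] [set 1].
- split=> [|x y|r x] /=; [exact: dvdp0|exact: dvdp_add|exact: dvdp_mull].
- by [].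
- by move=> _ _ -> ->; rewrite mulr1.
- by move=> x /= px x1; move: px; rewrite x1 dvdp1; apply/negP.
have [L [phi phi0]] := prime_ideal_residue_field Ppr.
pose g : {rmorphism K -> L} := phi \o polyC.
exists L, g, (phi 'X); rewrite rootE horner_coef size_map_poly.
suff -> : \sum_(i < size p) (map_poly g p)`_i * phi 'X ^+ i = phi p.
  by apply/eqP/phi0/IP => /=.
rewrite -[p in RHS]coefK poly_def rmorph_sum; apply: eq_bigr => i _.
by rewrite coef_map /= -mul_polyC rmorphM rmorphXn.
Qed.

Lemma splitting_field_exists (K : fieldType) (p : {poly K}) : p != 0 ->
  exists (L : fieldType) (g : {rmorphism K -> L}) (c : L) (rs : seq L),
    c != 0 /\ map_poly g p = c *: \prod_(r <- rs) ('X - r%:P).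
Proof.
have [n] := ubnP (size p); elim: n K p => // n IH K p spn p0.
have [/size_poly1P[c c0 ->]|sp] := boolP (size p == 1)%N.
  exists K, idfun, c, [::]; split=> //.
  by rewrite map_polyC /= big_nil -mul_polyC mulr1.
have [L [g [z pz]]] := field_ext_root sp.
have [q Dp] := factor_theorem _ _ pz.
have [q0|q0] := eqVneq (map_poly g p) 0.
  by move: p0; rewrite -(map_poly_eq0 g) q0 eqxx.
have qn0 : q != 0 by apply: contra_neq q0; rewrite Dp => ->; rewrite mul0r.
have sq : (size q < n)%N.
  move: spn; rewrite -(size_map_poly g) Dp size_Mmonic ?monicXsubC //.
  by rewrite size_XsubC addn2.
have [M [h [c [rs [c0 Dq]]]]] := IH _ q sq qn0.
exists M, (h \o g), c, (h z :: rs); split=> //.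
rewrite map_poly_comp Dp rmorphM /= Dq big_cons rmorphB /= map_polyX map_polyC.
by rewrite mulrC scalerAr.
Qed.

(** Infinite products of fields serve to split infinitely many polynomials at
    once. *)
Definition product_ring (I : Type) (i0 : I) (L : I -> fieldType) : Type := forall i, L i.

Section ProductRing.
Variables (I : Type) (i0 : I) (L : I -> fieldType).
Local Notation A := (product_ring i0 L).
HB.instance Definition _ := gen_eqMixin A.
HB.instance Definition _ := gen_choiceMixin A.

Let add (x y : A) : A := fun i => x i + y i.
Let opp (x : A) : A := fun i => - x i.
Let mul (x y : A) : A := fun i => x i * y i.
Let zero : A := fun i => 0.
Let one : A := fun i => 1.

Let addA : associative add.
Proof. by move=> x y z; apply: functional_extensionality_dep => i; rewrite /add addrA. Qed.
Let addC : commutative add.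
Proof. by move=> x y; apply: functional_extensionality_dep => i; rewrite /add addrC. Qed.
Let add0 : left_id zero add.
Proof. by move=> x; apply: functional_extensionality_dep => i; rewrite /add add0r. Qed.
Let addN : left_inverse zero opp add.
Proof. by move=> x; apply: functional_extensionality_dep => i; rewrite /add addNr. Qed.
HB.instance Definition _ := GRing.isZmodule.Build A addA addC add0 addN.

Let mulA : associative mul.
Proof. by move=> x y z; apply: functional_extensionality_dep => i; rewrite /mul mulrA. Qed.
Let mulC : commutative mul.
Proof. by move=> x y; apply: functional_extensionality_dep => i; rewrite /mul mulrC. Qed.
Let mul1 : left_id one mul.
Proof. by move=> x; apply: functional_extensionality_dep => i; rewrite /mul mul1r. Qed.
Let mulD : left_distributive mul add.
Proof. by move=> x y z; apply: functional_extensionality_dep => i; rewrite /mul /add mulrDl. Qed.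
Let one_neq0 : one != zero.
Proof. by apply/eqP => /(congr1 (fun x : A => x i0)) /eqP; rewrite oner_eq0. Qed.
HB.instance Definition _ := GRing.Zmodule_isComNzRing.Build A mulA mulC mul1 mulD one_neq0.

Definition component i (x : A) : L i := x i.
Let component_zmod i : zmod_morphism (component i). Proof. by []. Qed.
Let component_monoid i : monoid_morphism (component i). Proof. by []. Qed.
HB.instance Definition _ i :=
  GRing.isZmodMorphism.Build A (L i) (component i) (component_zmod i).
HB.instance Definition _ i :=
  GRing.isMonoidMorphism.Build A (L i) (component i) (component_monoid i).

Section Diagonal.
Variables (K : fieldType) (g : forall i, {rmorphism K -> L i}).
Definition diagonal (c : K) : A := fun i => g i c.
Let diagonal_zmod : zmod_morphism diagonal.
Proof. by move=> x y; apply: functional_extensionality_dep => i; rewrite /diagonal rmorphB. Qed.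
Let diagonal_monoid : monoid_morphism diagonal.
Proof.
split=> [|x y]; apply: functional_extensionality_dep => i;
  by rewrite /diagonal ?rmorph1 ?rmorphM.
Qed.
HB.instance Definition _ := GRing.isZmodMorphism.Build K A diagonal diagonal_zmod.
HB.instance Definition _ := GRing.isMonoidMorphism.Build K A diagonal diagonal_monoid.
End Diagonal.
End ProductRing.

(** For each [q] take a field that splits [q], and divide the product of these
    fields by a prime ideal that contains the families vanishing at all
    multiples of some polynomial. A polynomial [p] splits in the components
    indexed by its multiples, hence in the quotient. *)
Lemma all_polys_split (K : fieldType) :
  exists (L : fieldType) (g : {rmorphism K -> L}),
    forall p : {poly K}, p \is monic ->
      exists rs : seq L, map_poly g p = \prod_(r <- rs) ('X - r%:P).
Proof.
have ex (q : {poly K}) : exists Lg : {L : fieldType & {rmorphism K -> L}},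
    q != 0 -> forall p, p \is monic -> p %| q ->
    exists rs : seq (tag Lg), map_poly (tagged Lg) p = \prod_(r <- rs) ('X - r%:P).
  have [->|q0] := eqVneq q 0.
    by exists (existT (fun L : fieldType => {rmorphism K -> L}) K
                 (idfun : {rmorphism K -> K})).
  have [L [g [c [rs [c0 Dq]]]]] := splitting_field_exists q0.
  exists (existT (fun L : fieldType => {rmorphism K -> L}) L g) => _ p pm /=.
  rewrite -(dvdp_map g) /= Dq dvdpZr //.
  move/dvdp_prod_XsubC=> [m e]; exists (mask m rs); apply/eqP.
  by rewrite -eqp_monic ?monic_map // ?monic_prod_XsubC.
have [Lg LgP] := choice ex.
pose L (q : {poly K}) := tag (Lg q).
pose A : comNzRingType := product_ring (0 : {poly K}) L.
pose J : set A := [set x | exists2 p : {poly K}, p != 0 &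
  forall q : {poly K}, q != 0 -> p %| q -> x q = 0].
have [||||P [Ppr JP _]] := @prime_ideal_avoiding A J [set 1].
- split=> [|x y [p p0 xp] [p' p'0 yp]|r x [p p0 xp]].
  + by exists 1; rewrite ?oner_eq0.
  + exists (p * p'); rewrite ?mulf_neq0 // => q q0 d.
    rewrite /GRing.add /= xp ?yp ?addr0 //.
      by apply: dvdp_trans d; rewrite dvdp_mull.
    by apply: dvdp_trans d; rewrite dvdp_mulr.
  + by exists p => // q q0 d; rewrite /GRing.mul /= xp ?mulr0.
- by [].
- by move=> _ _ -> ->; rewrite mulr1.
- move=> x [p p0 xp] x1; have /eqP := xp p p0 (dvdpp _).
  by rewrite x1 oner_eq0.
have [M [phi phi0]] := prime_ideal_residue_field Ppr.
pose g : {rmorphism K -> A} := diagonal 0 (fun q : {poly K} => tagged (Lg q)).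
exists M, (phi \o g) => p pm.
have p0 := monic_neq0 pm.
have exrs q : exists rs : seq (L q), q != 0 -> p %| q ->
    map_poly (tagged (Lg q)) p = \prod_(r <- rs) ('X - r%:P).
  have [q0|q0] := eqVneq q 0; first by exists [::].
  have [d|d] := boolP (p %| q); last by exists [::].
  by have [rs Drs] := LgP q q0 p pm d; exists rs.
have /(_ _)/cid-/all_tag[rs rsP] := exrs.
pose r (j : nat) : A := fun q => (rs q)`_j.
pose n := (size p).-1.
exists [seq phi (r j) | j <- iota 0 n].
pose D : {poly A} := map_poly g p - \prod_(j <- iota 0 n) ('X - (r j)%:P).
have D0 i : phi D`_i = 0.
  apply/phi0/JP; exists p => // q q0 d.
  rewrite -[D`_i q]/(component (i0 := (0 : {poly K})) q D`_i) -coef_map.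
  suff -> : map_poly (component (i0 := (0 : {poly K})) (L := L) q) D = 0 by rewrite coef0.
  rewrite rmorphB /= -map_poly_comp rmorph_prod /= (rsP q q0 d).
  have sz : size (rs q) = n.
    have := congr1 (fun u : {poly _} => size u) (rsP q q0 d).
    by rewrite size_map_poly size_prod_XsubC /n => ->.
  apply/eqP; rewrite subr_eq0; apply/eqP.
  under [RHS]eq_bigr do rewrite rmorphB /= map_polyX map_polyC.
  by rewrite (big_nth 0) sz /index_iota subn0.
apply/eqP; rewrite -subr_eq0; apply/eqP.
rewrite map_poly_comp big_map.
have -> : \prod_(j <- iota 0 n) ('X - (phi (r j))%:P) =
   map_poly phi (\prod_(j <- iota 0 n) ('X - (r j)%:P)).
  by rewrite rmorph_prod /=; apply: eq_bigr => j _; rewrite rmorphB /= map_polyX map_polyC.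
by rewrite -rmorphB; apply/polyP => i; rewrite coef_map coef0; exact: D0.
Qed.

Section SubfieldOf.
Variables (M : fieldType) (D : divringClosed M).
Definition subfield_of : Type := {x | x \in D}.
HB.instance Definition _ := [isSub of subfield_of for @sval _ _].
HB.instance Definition _ := [Choice of subfield_of by <:].
HB.instance Definition _ := [SubChoice_isSubIntegralDomain of subfield_of by <:].
HB.instance Definition _ := [SubIntegralDomain_isSubField of subfield_of by <:].
End SubfieldOf.

(** Subfields enter as sets; this is the type of their elements. *)
Lemma subfield_type (M : fieldType) (E : set M) :
  E 1 -> (forall x y, E x -> E y -> E (x - y)) ->
  (forall x y, E x -> E y -> E (x / y)) ->
  exists (K : fieldType) (j : {rmorphism K -> M}), forall x, E x <-> exists z, j z = x.
Proof.
move=> E1 EB Ediv.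
pose S : {pred M} := fun x => `[< E x >].
have PS x : (x \in S) = `[< E x >] by [].
have Scl : divring_closed S.
  split=> [|x y|x y]; rewrite !PS; first exact/asboolP.
    by move=> /asboolP Ex /asboolP Ey; apply/asboolP/EB.
  by move=> /asboolP Ex /asboolP Ey; apply/asboolP/Ediv.
pose m := GRing.isDivringClosed.Build M S Scl.
pose D : divringClosed M := HB.pack (S : M -> bool) m.
exists (subfield_of D), (val : {rmorphism subfield_of D -> M}) => x.
split=> [Ex|[z <-]].
  have Dx : x \in D by exact: asboolT.
  by exists (exist _ x Dx : subfield_of D).
by have := valP z; rewrite PS => /asboolP.
Qed.

Lemma closed_field_of (N0 : fieldType) : GRing.closed_field_axiom N0 ->
  exists (N : closedFieldType) (h : {rmorphism N -> N0}), bijective h.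
Proof.
case: N0 => T c cl.
pose F := GRing.Field.Pack c.
pose m := Field_isAlgClosed.Build F cl.
pose N : closedFieldType := HB.pack T F m.
exists N, (@idfun F : {rmorphism N -> F}); exact: inv_bij.
Qed.

(** A root of a polynomial with coefficients algebraic over [E] lies a priori in
    an extension of [L]; but it is algebraic over [E], and the polynomials over
    [E] have all their roots in [L] already. *)
Lemma relative_closure (E L : fieldType) (j : {rmorphism E -> L}) :
  (forall p : {poly E}, p \is monic ->
     exists rs : seq L, map_poly j p = \prod_(r <- rs) ('X - r%:P)) ->
  exists (N : closedFieldType) (i : {rmorphism N -> L}),
    forall x, algebraicOver j x <-> exists z, i z = x.
Proof.
move=> split_j.
have [||| N0 [i iP]] := @subfield_type L (algebraicOver j).
- by rewrite -(rmorph1 j); apply: algebraic_id.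
- by move=> x y; apply: algebraic_sub.
- by move=> x y; apply: algebraic_div.
suff cl : GRing.closed_field_axiom N0.
  have [N [h [h' _ hK]]] := closed_field_of cl.
  exists N, (i \o h) => x; split=> [/iP[z <-]|[z <-]].
    by exists (h' z); rewrite /= hK.
  by apply/iP; exists (h z).
move=> n P n0.
pose p : {poly N0} := 'X^n - \poly_(k < n) P k.
have sz : (size (\poly_(k < n) P k) < size ('X^n : {poly N0}))%N.
  by rewrite size_polyXn ltnS size_poly.
have pm : p \is monic by rewrite monicE lead_coefDl ?lead_coefXn // size_polyN.
have sp : size p != 1%N.
  by rewrite size_polyDl ?size_polyN // size_polyXn; case: n n0 {P p sz pm}.
have [L' [g [z pz]]] : exists (L' : fieldType) (g : {rmorphism L -> L'}) (z : L'),
    root (map_poly g (map_poly i p)) z.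
  by apply: field_ext_root; rewrite size_map_poly.
have [q qm qz] : integralOver (g \o j) z.
  apply: integral_root_monic pz _; first by rewrite !monic_map.
  apply/integral_poly => k; rewrite !coef_map /=; apply: integral_rmorph.
  by apply/integral_algebraic/iP; exists p`_k.
have [rs Dq] := split_j _ qm.
have : z \in map g rs.
  rewrite -root_prod_XsubC; move: qz; rewrite map_poly_comp Dq rmorph_prod /= big_map.
  by under eq_bigr do rewrite rmorphB /= map_polyX map_polyC.
case/mapP => r rr Dz.
have [w Dw] : exists w, i w = r.
  apply/iP/integral_algebraic; exists q => //.
  by rewrite Dq root_prod_XsubC.
exists w; move: pz; rewrite Dz fmorph_root -Dw fmorph_root.
rewrite rootE !hornerE horner_poly subr_eq0 => /eqP ->.
by apply: eq_bigr.
Qed.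

Lemma rmorph_factor (K L M : fieldType) (f : {rmorphism K -> M}) (i : {rmorphism L -> M}) :
  (forall x, exists z, i z = f x) -> exists k : {rmorphism K -> L}, forall x, i (k x) = f x.
Proof.
move=> /choice[h hP].
have hD : zmod_morphism h.
  by move=> x y; apply: (fmorph_inj i); rewrite rmorphB !hP rmorphB.
have hM : monoid_morphism h.
  by split=> [|x y]; apply: (fmorph_inj i); rewrite ?rmorphM !hP ?rmorphM ?rmorph1.
pose m1 := GRing.isZmodMorphism.Build K L h hD.
pose m2 := GRing.isMonoidMorphism.Build K L h hM.
by pose k : {rmorphism K -> L} := HB.pack h m1 m2; exists k.
Qed.

Lemma algebraic_closure_exists (K : fieldType) :
  exists (N : closedFieldType) (i : {rmorphism K -> N}), True.
Proof.
have [L [g splitg]] := all_polys_split K.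
have [N [i iP]] := relative_closure splitg.
have [x|h _] := @rmorph_factor K N L g i; last by exists N, h.
by apply/iP/algebraic_id.
Qed.

(** * Valuation rings *)
Record valuation_ring (K : fieldType) (W : set K) : Prop := ValuationRing {
  val_ring1 : W 1;
  val_ringB : forall x y, W x -> W y -> W (x - y);
  val_ringM : forall x y, W x -> W y -> W (x * y);
  val_ringV : forall x, W x \/ W x^-1
}.

(** Divisibility in a valuation ring plays the role of the order between absolute
    values. *)
Definition vle (K : fieldType) (W : set K) (x y : K) : Prop :=
  exists2 w, W w & x = w * y.
Definition vlt (K : fieldType) (W : set K) (x y : K) : Prop := ~ vle W y x.

(** The strict and the large inequality are treated at once: [vcmp W true] is
    the former and [vcmp W false] the latter, so that negation amounts to
    flipping the boolean and exchanging the arguments. *)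
Definition vcmp (K : fieldType) (W : set K) (b : bool) (x y : K) : Prop :=
  if b then vlt W x y else vle W x y.

Section ValuationRing.
Variables (K : fieldType) (W : set K).
Hypothesis vW : valuation_ring W.
Local Notation "x <=v y" := (vle W x y) (at level 70, no associativity).
Local Notation "x <v y" := (vlt W x y) (at level 70, no associativity).
Implicit Types x y z : K.

Lemma val_ring0 : W 0.
Proof. by rewrite -(subrr 1); apply: val_ringB => //; apply: val_ring1. Qed.

Lemma val_ringN x : W x -> W (- x).
Proof. by move=> Wx; rewrite -sub0r; apply: val_ringB => //; apply: val_ring0. Qed.

Lemma val_ringD x y : W x -> W y -> W (x + y).
Proof.
by move=> Wx Wy; rewrite -(opprK y); apply: val_ringB => //; apply: val_ringN.
Qed.

Lemma vle_refl x : x <=v x.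
Proof. by exists 1; rewrite ?mul1r //; apply: val_ring1. Qed.

Lemma vle_trans y x z : x <=v y -> y <=v z -> x <=v z.
Proof.
by move=> [a Wa ->] [b Wb ->]; exists (a * b); rewrite ?mulrA //; apply: val_ringM.
Qed.

Lemma vle0 x : 0 <=v x.
Proof. by exists 0; rewrite ?mul0r //; apply: val_ring0. Qed.

Lemma vle_eq0 x : x <=v 0 -> x = 0.
Proof. by case=> w _ ->; rewrite mulr0. Qed.

Lemma vle_total x y : x <=v y \/ y <=v x.
Proof.
have [->|y0] := eqVneq y 0; first by right; apply: vle0.
have [->|x0] := eqVneq x 0; first by left; apply: vle0.
case: (val_ringV vW (x / y)) => Wxy; [left|right].
  by exists (x / y) => //; rewrite divfK.
by exists (y / x); rewrite ?divfK // -invf_div.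
Qed.

Lemma vltW x y : x <v y -> x <=v y.
Proof. by case: (vle_total x y). Qed.

Lemma vltP x y : x <v y \/ y <=v x.
Proof. by have [?|?] := pselect (y <=v x); [right|left]. Qed.

Lemma vlt_irr x : ~ x <v x.
Proof. by apply; apply: vle_refl. Qed.

Lemma vlt_le_trans y x z : x <v y -> y <=v z -> x <v z.
Proof. by move=> xy yz zx; apply: xy; apply: vle_trans zx. Qed.

Lemma vle_lt_trans y x z : x <=v y -> y <v z -> x <v z.
Proof. by move=> xy yz zx; apply: yz; apply: vle_trans xy. Qed.

Lemma vlt_neq0 x y : x <v y -> y != 0.
Proof. by move=> xy; apply/eqP => y0; apply: xy; rewrite y0; apply: vle0. Qed.

Lemma vle1 x : x <=v 1 <-> W x.
Proof. by split=> [[w Ww ->]|Wx]; [rewrite mulr1|exists x; rewrite ?mulr1]. Qed.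

Lemma vleM x x' y y' : x <=v y -> x' <=v y' -> x * x' <=v y * y'.
Proof.
move=> [a Wa ->] [b Wb ->]; exists (a * b); first exact: val_ringM.
by rewrite mulrACA.
Qed.

Lemma vleMl z x y : x <=v y -> z * x <=v z * y.
Proof. by apply: vleM; apply: vle_refl. Qed.

Lemma vleMl_iff z x y : z != 0 -> z * x <=v z * y <-> x <=v y.
Proof.
move=> z0; split; last exact: vleMl.
by case=> w Ww e; exists w => //; apply: (mulfI z0); rewrite e mulrCA.
Qed.

Lemma vltMl_iff z x y : z != 0 -> z * x <v z * y <-> x <v y.
Proof. by move=> z0; split=> h /(vleMl_iff y x z0). Qed.

Lemma vleD x y z : x <=v z -> y <=v z -> x + y <=v z.
Proof.
move=> [a Wa ->] [b Wb ->]; exists (a + b); first exact: val_ringD.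
by rewrite mulrDl.
Qed.

Lemma vleN x y : x <=v y -> - x <=v y.
Proof. by case=> a Wa ->; exists (- a); rewrite ?mulNr //; apply: val_ringN. Qed.

Lemma vltN x y : x <v y -> - x <v y.
Proof. by move=> xy /vleN; rewrite -mulN1r => /(vleMl (-1)); rewrite !mulN1r !opprK. Qed.

Lemma vltD x y z : x <v z -> y <v z -> x + y <v z.
Proof.
move=> xz yz; case: (vle_total x y) => xy.
  by apply: vle_lt_trans yz; apply: vleD => //; apply: vle_refl.
by apply: vle_lt_trans xz; apply: vleD => //; apply: vle_refl.
Qed.

Lemma vleN_iff x y : x <=v - y <-> x <=v y.
Proof.
by split=> -[w Ww ->]; exists (- w); rewrite ?mulNr ?mulrN ?opprK //; apply: val_ringN.
Qed.

Lemma vle_addl x y : x <v y -> y <=v x + y.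
Proof.
move=> xy; have [h|//] := vltP (x + y) y.
by have := vltD h (vltN xy); rewrite addrAC subrr add0r => /vlt_irr.
Qed.

Lemma vleX x y n : x <=v y -> x ^+ n <=v y ^+ n.
Proof.
move=> xy; elim: n => [|n IH]; first exact: vle_refl.
by rewrite !exprS; apply: vleM.
Qed.

Lemma vltX x y n : (0 < n)%N -> x <v y -> x ^+ n <v y ^+ n.
Proof.
case: n => // n _ xy; elim: n => [|n IH]; first by rewrite !expr1.
have y0 := vlt_neq0 xy.
rewrite ![_ ^+ n.+2]exprS; apply: (@vle_lt_trans (y * x ^+ n.+1)).
  by apply: vleM; [apply: vltW|apply: vle_refl].
exact/vltMl_iff.
Qed.

Lemma vcmp_flip b x y : ~ vcmp W b x y <-> vcmp W (~~ b) y x.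
Proof. by case: b => /=; split=> //; rewrite /vlt; first exact: contrapT; tauto. Qed.

Lemma vcmpW b x y : vcmp W b x y -> x <=v y.
Proof. by case: b => // /vltW. Qed.

Lemma vcmp_vle_trans b x y z : vcmp W b x y -> y <=v z -> vcmp W b x z.
Proof. by case: b => /=; [apply: vlt_le_trans|apply: vle_trans]. Qed.

Lemma vle_vcmp_trans b x y z : x <=v y -> vcmp W b y z -> vcmp W b x z.
Proof. by case: b => /=; [apply: vle_lt_trans|apply: vle_trans]. Qed.

Lemma vcmpMl b z x y : z != 0 -> vcmp W b (z * x) (z * y) <-> vcmp W b x y.
Proof. by case: b => /= z0; [apply: vltMl_iff|apply: vleMl_iff]. Qed.

Lemma vcmpD b x y z : vcmp W b x z -> vcmp W b y z -> vcmp W b (x + y) z.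
Proof. by case: b => /=; [apply: vltD|apply: vleD]. Qed.

Lemma vcmp0 b x : x != 0 -> vcmp W b 0 x.
Proof. by case: b => /= x0; [move=> /vle_eq0 e; rewrite e eqxx in x0|apply: vle0]. Qed.

Lemma vcmpN b x y : vcmp W b x y -> vcmp W b (- x) y.
Proof. by case: b => /=; [apply: vltN|apply: vleN]. Qed.

Lemma vcmp_sum b (I : Type) (r : seq I) (P : pred I) (F : I -> K) z : z != 0 ->
  (forall i, P i -> vcmp W b (F i) z) -> vcmp W b (\sum_(i <- r | P i) F i) z.
Proof.
move=> z0 h; apply: (big_ind (fun x => vcmp W b x z)) => //; first exact: vcmp0.
by move=> x y; apply: vcmpD.
Qed.

(** The last element of maximal absolute value: its product with [X - x] for a
    small [x] has a coefficient where nothing cancels. *)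
Lemma vle_last_max (F : nat -> K) n :
  exists k, (k <= n)%N /\ forall i, (i <= n)%N ->
    F i <=v F k /\ ((k < i)%N -> F i <v F k).
Proof.
elim: n => [|n [k [kn kP]]].
  by exists 0%N; split=> // i; rewrite leqn0 => /eqP ->; split=> //; apply: vle_refl.
case: (vltP (F n.+1) (F k)) => h.
  exists k; split=> [|i]; first exact: leq_trans (leqnSn _).
  rewrite leq_eqVlt => /predU1P[->|]; last exact: kP.
  by split=> [|_ //]; apply: vltW.
exists n.+1; split=> // i; rewrite leq_eqVlt => /predU1P[->|ni].
  by rewrite ltnn; split=> //; apply: vle_refl.
split=> [|ni']; last by have := ltn_trans ni ni'; rewrite ltnn.
by apply: vle_trans h; case: (kP i ni).
Qed.

Lemma vle_max_seq (s : seq K) : s != [::] -> exists2 m, m \in s & forall x, x \in s -> x <=v m.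
Proof.
elim: s => // x [|y s] IH _.
  by exists x => [|z]; rewrite inE // => /eqP ->; apply: vle_refl.
have [//|m ms mP] := IH.
case: (vle_total x m) => h.
  by exists m => [|z]; [rewrite inE ms orbT|rewrite inE => /predU1P[->//|/mP]].
exists x => [|z]; first by rewrite inE eqxx.
by rewrite inE => /predU1P[->|/mP/vle_trans]; [apply: vle_refl|apply].
Qed.

End ValuationRing.

Section ClosedValued.
Variables (K : closedFieldType) (W : set K).
Hypothesis vW : valuation_ring W.
Local Notation "x <=v y" := (vle W x y) (at level 70, no associativity).
Local Notation "x <v y" := (vlt W x y) (at level 70, no associativity).

(** If [z] is a root of [X * \prod (X - r) - 1], with [r] ranging over the
    integral elements of [rs], then all factors are units at [z]. *)
Lemma generic_unit_seq (rs : seq K) : exists2 z, W z &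
  1 <=v z /\ forall r, r \in rs -> 1 <=v z - r /\ r <=v z - r.
Proof.
pose s := 0 :: [seq r <- rs | `[< W r >]].
have Ws r : r \in s -> W r.
  rewrite inE => /predU1P[->|]; first exact: val_ring0.
  by rewrite mem_filter => /andP[/asboolP].
pose p := \prod_(r <- s) ('X - r%:P).
have [z] : exists z, root (p - 1) z.
  apply/closed_rootP; rewrite size_polyDl ?size_prod_XsubC //.
  by rewrite size_polyN size_poly1.
rewrite rootE hornerD hornerN -[1]/(1%:P) hornerC subr_eq0 /p horner_prod => /eqP Dz.
have Dz' : \prod_(r <- s) (z - r) = 1.
  by rewrite -[RHS]Dz; apply: eq_bigr => r _; rewrite hornerXsubC.
have prod_ge1 (t : seq K) : (forall r, r \in t -> 1 <=v z - r) -> 1 <=v \prod_(r <- t) (z - r).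
  elim: t => [|r t IH] h; first by rewrite big_nil; apply: vle_refl.
  rewrite big_cons -[X in X <=v _](mulr1 1); apply: vleM => //.
    by apply: h; rewrite inE eqxx.
  by apply: IH => r' r't; apply: h; rewrite inE r't orbT.
have Wz : W z.
  apply/vle1 => //; apply: contrapT => z1.
  have lt1 r : r \in s -> 1 <=v z - r.
    move=> /Ws/vle1 r1; rewrite addrC; apply: vle_trans (vltW vW z1) _ => //.
    by apply: vle_addl => //; apply: vltN => //; apply: vle_lt_trans z1.
  suff : 1 <v \prod_(r <- s) (z - r) by rewrite Dz'; apply: vlt_irr.
  rewrite big_cons subr0; apply: (vlt_le_trans vW z1).
  rewrite -[X in X <=v _]mulr1; apply: vleMl => //; apply: prod_ge1 => r rs'.
  by apply: lt1; rewrite inE rs' orbT.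
have ge1 r : r \in s -> 1 <=v z - r.
  move=> rs'; exists (\prod_(r <- rem r s) (z - r)); last first.
    by rewrite mulrC -[LHS]Dz' (big_rem r rs').
  have : {subset rem r s <= s} by move=> x; apply: mem_rem.
  elim: (rem r s) => [|x t IH] sub; first by rewrite big_nil; apply: val_ring1.
  rewrite big_cons; apply: val_ringM => //; last first.
    by apply: IH => y yt; apply: sub; rewrite inE yt orbT.
  by apply: val_ringB => //; apply: Ws; apply: sub; rewrite inE eqxx.
exists z => //; split=> [|r rrs]; first by rewrite -(subr0 z); apply: ge1; rewrite inE eqxx.
have [Wr|nWr] := pselect (W r).
  have z1 : 1 <=v z - r.
    by apply: ge1; rewrite inE mem_filter rrs andbT; apply/orP; right; apply/asboolP.
  by split=> //; apply: vle_trans z1 => //; apply/vle1.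
have r1 : 1 <v r by move=> /vle1.
have rz : r <=v z - r.
  apply/(vleN_iff vW); rewrite opprB addrC; apply: vle_addl => //.
  by apply: vltN => //; apply: vle_lt_trans r1 => //; apply/vle1.
by split=> //; apply: vle_trans rz => //; apply: vltW.
Qed.

(** Evaluation at a unit outside the residue classes of the roots of a
    polynomial computes its Gauss norm. *)
Lemma generic_unit (ps : seq {poly K}) :
  exists2 z, W z & 1 <=v z /\ forall p, p \in ps -> forall i, p`_i <=v p.[z].
Proof.
have split_poly (p : {poly K}) : exists rs : seq K, p = lead_coef p *: \prod_(r <- rs) ('X - r%:P).
  by case: (closed_field_poly_normal p) => rs Dp; exists rs.
have [rs rsP] := choice split_poly.
have [z Wz [z1 zP]] := generic_unit_seq (flatten [seq rs p | p <- ps]).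
exists z => //; split=> // p pps.
have {}zP r : r \in rs p -> 1 <=v z - r /\ r <=v z - r.
  by move=> rr; apply: zP; apply/flattenP; exists (rs p) => //; apply: map_f.
rewrite (rsP p) => i; rewrite coefZ hornerZ; apply: vleMl => //.
elim: (rs p) zP i => [|r t IH] zP i.
  by rewrite big_nil hornerE coef1; case: eqP => _; [apply: vle_refl|apply: vle0].
have [zr1 zrr] := zP r (mem_head _ _).
have {}IH j := IH (fun r' rt => zP r' (@mem_behead _ (r :: t) r' rt)) j.
rewrite big_cons hornerM hornerXsubC [in X in X <=v _]mulrBl coefB.
rewrite coefXM coefCM; apply: vleD => //; last first.
  by apply: vleN => //; apply: vleM.
case: eqP => _; first exact: vle0.
by rewrite -[X in X <=v _]mul1r; apply: vleM.
Qed.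

(** This is the part of the Newton polygon that matters here: in a product of
    factors [X - r] with no small [r], the constant coefficient dominates. *)
Lemma small_root b (p : {poly K}) k : (0 < k)%N -> p`_k != 0 ->
  vcmp W b p`_0 p`_k -> exists2 x, root p x & vcmp W b x 1.
Proof.
move=> k0 pk h; apply: contrapT => no.
have p0 : p != 0 by apply: contra_neq pk => ->; rewrite coef0.
have [rs Dp] := closed_field_poly_normal p.
have lc0 : lead_coef p != 0 by rewrite lead_coef_eq0.
have {}no r : r \in rs -> vcmp W (~~ b) 1 r.
  move=> rr; apply/vcmp_flip => hr; apply: no; exists r => //.
  by rewrite Dp rootZ // root_prod_XsubC.
suff : vcmp W (~~ b) p`_k p`_0 by apply/vcmp_flip.
rewrite Dp !coefZ; apply/vcmpMl => //.
suff [_] : (\prod_(r <- rs) ('X - r%:P))`_0 != 0 /\ forall i, (0 < i)%N ->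
    vcmp W (~~ b) (\prod_(r <- rs) ('X - r%:P))`_i (\prod_(r <- rs) ('X - r%:P))`_0.
  by apply.
elim: rs no {Dp} => [|r t IH] no.
  rewrite big_nil coef1 eqxx oner_neq0; split=> // -[//|i] _; rewrite coef1 /=.
  by apply: vcmp0 => //; apply: oner_neq0.
have [g0 gP] := IH (fun r' rt => no r' (@mem_behead _ (r :: t) r' rt)).
have r1 := no r (mem_head _ _).
have r0 : r != 0.
  apply/eqP => r0; move: r1; rewrite r0; case: (b) => /=.
    by move=> /vle_eq0/eqP; rewrite oner_eq0.
  by move=> nle; apply: nle; apply: vle0.
rewrite big_cons; set g := \prod_(_ <- t) _ in g0 gP *.
have e0 : (('X - r%:P) * g)`_0 = - r * g`_0.
  by rewrite mulrBl coefB coefXM coefCM /= sub0r mulNr.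
split; first by rewrite e0 mulf_neq0 // oppr_eq0.
move=> [//|i] _; rewrite e0 mulrBl coefB coefXM coefCM /= mulNr.
have vcmpNr x y : vcmp W (~~ b) x y -> vcmp W (~~ b) x (- y).
  by case: (~~ b) => /= hxy; [move=> /(vleN vW); rewrite opprK|apply/vleN_iff].
apply: vcmpNr; apply: vcmpD => //; last first.
  by apply: vcmpN => //; apply/vcmpMl => //; apply: gP.
apply: (@vle_vcmp_trans _ _ vW _ _ g`_0).
  by case: i => [|i]; [apply: vle_refl|apply: (vcmpW vW); apply: gP].
by rewrite -[X in vcmp _ _ X]mulr1 [r * _]mulrC; apply/vcmpMl.
Qed.

End ClosedValued.

(** Conversely, write the polynomial as [g * (X - x)] and look at the
    coefficient after the last dominant one of [g]. *)
Lemma small_root_coef (K : fieldType) (W : set K) b (p : {poly K}) x :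
  valuation_ring W -> p != 0 -> root p x -> vcmp W b x 1 ->
  exists k, [/\ (0 < k)%N, p`_k != 0 & vcmp W b p`_0 p`_k].
Proof.
move=> vW p0 /factor_theorem[g Dg] x1.
have g0 : g != 0 by apply: contra_neq p0; rewrite Dg => ->; rewrite mul0r.
have [k [kn kP]] := vle_last_max vW (fun i => g`_i) (size g).
have gk i : vle W g`_i g`_k.
  have [h|h] := leqP i (size g); first by case: (kP i h).
  by rewrite nth_default ?(ltnW h) //; apply: vle0.
have gk0 : g`_k != 0.
  apply/eqP => gk0; have := gk (size g).-1; rewrite -lead_coefE gk0.
  by move=> /vle_eq0/eqP; rewrite lead_coef_eq0; apply/negP.
have gk' : vlt W g`_k.+1 g`_k.
  have [h|h] := leqP k.+1 (size g); first by case: (kP k.+1 h) => _; apply.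
  by rewrite nth_default ?(ltnW h) //; apply: (@vcmp0 _ _ vW true).
have pk : vle W g`_k p`_k.+1.
  rewrite Dg mulrBr coefB coefMX coefMC /= addrC; apply: vle_addl => //.
  apply: vltN => //; apply: vle_lt_trans gk' => //.
  by rewrite -[X in vle _ _ X]mulr1; apply: vleMl => //; apply: (vcmpW vW x1).
exists k.+1; split=> //.
  by apply/eqP => e; move: pk; rewrite e => /vle_eq0/eqP; apply/negP.
apply: vcmp_vle_trans pk => //.
rewrite Dg mulrBr coefB coefMX coefMC /= sub0r; apply: vcmpN => //.
apply: (@vle_vcmp_trans _ _ vW _ _ (g`_k * x)).
  by rewrite ![_ * x]mulrC; apply: vleMl.
by rewrite -[X in vcmp _ _ _ X]mulr1; apply/vcmpMl.
Qed.

Lemma valuation_ring_preimage (K L : fieldType) (f : {rmorphism K -> L}) (W : set L) :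
  valuation_ring W -> valuation_ring (f @^-1` W).
Proof.
case=> W1 WB WM WV; split=> [|x y|x y|x] /=; rewrite ?rmorph1 ?rmorphB ?rmorphM ?fmorphV //.
- exact: WB.
- exact: WM.
Qed.

Lemma vle_preimage (K L : fieldType) (f : {rmorphism K -> L}) (W : set L) x y :
  valuation_ring W -> vle W (f x) (f y) <-> vle (f @^-1` W) x y.
Proof.
move=> vW; split=> [[w Ww e]|[w Ww ->]]; last by exists (f w); rewrite ?rmorphM.
have [y0|y0] := eqVneq y 0.
  have -> : x = 0 by apply: (fmorph_inj f); rewrite e y0 rmorph0 mulr0.
  by apply: vle0; apply: valuation_ring_preimage.
exists (x / y); last by rewrite divfK.
by rewrite /= fmorph_div e mulfK // fmorph_eq0.
Qed.

Lemma vcmp_preimage (K L : fieldType) (f : {rmorphism K -> L}) (W : set L) b x y :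
  valuation_ring W -> vcmp W b (f x) (f y) <-> vcmp (f @^-1` W) b x y.
Proof.
by move=> vW; have := vle_preimage f x y vW; have := vle_preimage f y x vW;
  case: b; rewrite /= /vlt; tauto.
Qed.

Section Chevalley.
Variable K : fieldType.

Inductive ideal_span (A W : set K) : K -> Prop :=
| ideal_span0 : ideal_span A W 0
| ideal_spanD a w y : A a -> W w -> ideal_span A W y -> ideal_span A W (a * w + y).

Definition subring (W : set K) : Prop :=
  [/\ W 1, forall x y, W x -> W y -> W (x - y) & forall x y, W x -> W y -> W (x * y)].

Lemma ideal_span_add A W x y : ideal_span A W x -> ideal_span A W y -> ideal_span A W (x + y).
Proof.
elim=> [|a w z Aa Ww _ IH] hy; first by rewrite add0r.
by rewrite -addrA; apply: ideal_spanD => //; apply: IH.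
Qed.

Lemma ideal_span_mul A W x y : subring W -> W x -> ideal_span A W y -> ideal_span A W (x * y).
Proof.
move=> [_ _ WM] Wx; elim=> [|a w z Aa Ww _ IH]; first by rewrite mulr0; left.
by rewrite mulrDr mulrCA; apply: ideal_spanD => //; apply: (WM).
Qed.

Lemma ideal_span_sub A W W' x : W `<=` W' -> ideal_span A W x -> ideal_span A W' x.
Proof. by move=> s; elim=> [|a w y Aa /s Ww _]; [left|right]. Qed.

Definition adjoin (W : set K) (x : K) : set K :=
  [set p.[x] | p in [set p : {poly K} | forall i, W p`_i]].

Lemma adjoin_subring W x : subring W -> subring (adjoin W x).
Proof.
move=> [W1 WB WM]; have W0 : W 0 by rewrite -(subrr 1); apply: (WB).
have WD y z : W y -> W z -> W (y + z).
  by move=> Wy Wz; rewrite -(opprK z); apply: (WB) => //; rewrite -sub0r; apply: (WB).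
split.
- exists 1; rewrite ?hornerE // => i /=; rewrite coef1.
  by case: eqP.
- move=> _ _ [p Wp <-] [q Wq <-]; exists (p - q); rewrite ?hornerE // => i /=.
  by rewrite coefB; apply: (WB).
- move=> _ _ [p Wp <-] [q Wq <-]; exists (p * q); rewrite ?hornerE // => i /=.
  by rewrite coefM; apply: big_ind => // j _; apply: (WM).
Qed.

Lemma ideal_span_adjoin A W x y : subring W -> ideal_span A (adjoin W x) y ->
  exists2 p : {poly K}, (forall i, ideal_span A W p`_i) & p.[x] = y.
Proof.
move=> Wr; elim=> [|a w z Aa [p Wp <-] _ [q Aq <-]].
  by exists 0; rewrite ?hornerE // => i; rewrite coef0; left.
exists (a *: p + q); last by rewrite !hornerE.
move=> i; rewrite coefD coefZ; apply: ideal_span_add => //.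
by rewrite -[_ * _]addr0; right => //; left.
Qed.

(** The reduction step of the classical argument: the top term of a relation in
    [x] is cancelled against a relation in the inverse of [x]. *)
Lemma no_inverse_relations A W x (p q : {poly K}) : subring W -> A `<=` W -> x != 0 ->
  ~ ideal_span A W 1 ->
  (forall i, ideal_span A W p`_i) -> p.[x] = 1 ->
  (forall i, ideal_span A W q`_i) -> q.[x^-1] = 1 -> False.
Proof.
move=> Wr AW x0 no1.
have [n] := ubnP (size p + size q); elim: n x x0 p q => // n IH x x0 p q.
wlog le_qp : x x0 p q / (size q <= size p)%N.
  move=> W' spq Ap px Aq qx; case/orP: (leq_total (size q) (size p)) => h.
    exact: (W' x x0 p q).
  by apply: (W' x^-1 _ q p); rewrite ?invr_eq0 ?invrK // addnC.
move=> spq Ap px Aq qx.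
have p0 : p != 0.
  by apply: contra_eq_neq px => ->; rewrite horner0 eq_sym oner_neq0.
have q1 : (1 < size q)%N.
  rewrite ltnNge; apply/negP => /size1_polyC Dq; apply: no1.
  by rewrite -qx Dq hornerC; apply: Aq.
pose m := (size p).-1.
have sp : size p = m.+1 by rewrite /m prednK // size_poly_gt0.
have m0 : (0 < m)%N by move: (leq_trans q1 le_qp); rewrite sp.
have Wspan y : ideal_span A W y -> W y.
  case: Wr => [W1 WB WM]; have W0 : W 0 by rewrite -(subrr 1); apply: (WB).
  elim=> // a w z /AW Wa Ww _ Wz.
  rewrite -(opprK z); apply: (WB); first exact: WM.
  by rewrite -sub0r; apply: (WB).
pose low := \poly_(i < m) p`_i.
pose rev := \poly_(i < m) q`_(m - i).
have plow : p.[x] = low.[x] + p`_m * x ^+ m.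
  by rewrite (horner_coef_wide x (leqnn (size p))) sp big_ord_recr /= horner_poly.
have qrev : x ^+ m * (1 - q`_0) = rev.[x].
  have sq : (size q <= m.+1)%N by rewrite -sp.
  rewrite -[X in X - _]qx (horner_coef_wide _ sq) big_ord_recl /= expr0 mulr1.
  rewrite addrAC subrr add0r horner_poly (reindex_inj rev_ord_inj) mulr_sumr /=.
  apply: eq_bigr => i _; have im : (m - i = (m - i.+1).+1)%N by rewrite subnSK.
  rewrite /bump /= add1n im mulrCA; congr (_ * _).
  rewrite -im -{1}(subnK (ltnW (ltn_ord i))) exprD mulrAC exprVn divff ?mul1r //.
  by rewrite expf_neq0.
pose p' := (q`_0)%:P + (1 - q`_0) *: low + p`_m *: rev.
have Dp' : p'.[x] = 1.
  have -> : p'.[x] = q`_0 + (1 - q`_0) * low.[x] + p`_m * rev.[x].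
    by rewrite /p' !hornerD !hornerZ hornerC.
  rewrite -qrev; transitivity (q`_0 + (1 - q`_0) * p.[x]); last by rewrite px; ring.
  by rewrite plow; ring.
have Ap' i : ideal_span A W p'`_i.
  have sp0 : ideal_span A W 0 by left.
  have mulA y z : ideal_span A W y -> ideal_span A W z -> ideal_span A W (y * z).
    by move=> /Wspan; apply: ideal_span_mul.
  rewrite !coefD coefC !coefZ !coef_poly; apply: ideal_span_add.
    apply: ideal_span_add; first by case: eqP.
    case: ifP => _; last by rewrite mulr0.
    apply: ideal_span_mul => //; case: (Wr) => W1 WB _.
    by apply: (WB) => //; apply: Wspan.
  by case: ifP => _; [apply: mulA|rewrite mulr0].
apply: (IH x x0 p' q) => //.
have sp' : (size p' <= m)%N.
  rewrite (leq_trans (size_polyD _ _)) // geq_max; apply/andP; split.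
    rewrite (leq_trans (size_polyD _ _)) // geq_max; apply/andP; split.
      by rewrite (leq_trans (size_polyC_leq1 _)).
    by rewrite (leq_trans (size_scale_leq _ _)) ?size_poly.
  by rewrite (leq_trans (size_scale_leq _ _)) ?size_poly.
by move: spq; rewrite sp addSn ltnS => /(leq_ltn_trans _); apply; rewrite leq_add2r.
Qed.

(** Chevalley's extension theorem: a maximal subring in which the ideal
    generated by [A] stays proper is a valuation ring, as adjoining neither [x]
    nor [x^-1] to it can make this ideal the unit ideal. *)
Lemma dominating_valuation_ring (R A : set K) : subring R -> A `<=` R ->
  ~ ideal_span A R 1 ->
  exists W, [/\ valuation_ring W, R `<=` W & forall a, A a -> vlt W a 1].
Proof.
move=> Rr AR no1.
pose good Q := subring (R `|` Q) /\ ~ ideal_span A (R `|` Q) 1.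
have [F Fgood Ftot|B [[Wr Wno1] Bmax]] := @Zorn_bigcup K good.
  have [[Q0 FQ0]|noF] := pselect (exists Q, F Q); last first.
    suff -> : \bigcup_(X in F) X = set0.
      rewrite /good setU0; exact: (conj Rr no1).
    by apply/seteqP; split=> [x [Q FQ _]|x []]; case: noF; exists Q.
  have Fle Q Q' : F Q -> F Q' -> exists Q'', [/\ F Q'', Q `<=` Q'' & Q' `<=` Q''].
    move=> FQ FQ'; case: (Ftot _ _ FQ FQ') => sub.
      by exists Q'; split=> //; apply: subset_refl.
    by exists Q; split=> //; apply: subset_refl.
  have Fone x : (R `|` \bigcup_(X in F) X) x -> exists2 Q, F Q & (R `|` Q) x.
    by case=> [Rx|[Q FQ Qx]]; [exists Q0 => //; left|exists Q => //; right].
  have Ftwo x y : (R `|` \bigcup_(X in F) X) x -> (R `|` \bigcup_(X in F) X) y ->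
      exists2 Q, F Q & (R `|` Q) x /\ (R `|` Q) y.
    move=> /Fone[Q FQ Qx] /Fone[Q' FQ' Qy].
    have [Q'' [FQ'' sub sub']] := Fle Q Q' FQ FQ'.
    exists Q'' => //; split; [exact: (setUS sub)|exact: (setUS sub')].
  have lift Q x : F Q -> (R `|` Q) x -> (R `|` \bigcup_(X in F) X) x.
    by move=> FQ [Rx|Qx]; [left|right; exists Q].
  split; first split.
  - by left; case: Rr.
  - move=> x y Ux /(Ftwo _ _ Ux)[Q FQ [Qx Qy]]; apply: (lift Q) => //.
    by have [[_ QB _] _] := Fgood _ FQ; apply: QB.
  - move=> x y Ux /(Ftwo _ _ Ux)[Q FQ [Qx Qy]]; apply: (lift Q) => //.
    by have [[_ _ QM] _] := Fgood _ FQ; apply: QM.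
  suff span1 y : ideal_span A (R `|` \bigcup_(X in F) X) y ->
      exists2 Q, F Q & ideal_span A (R `|` Q) y.
    by move=> /span1[Q FQ]; apply: (Fgood _ FQ).2.
  elim=> [|a w z Aa /Fone[Q FQ Qw] _ [Q' FQ' Qz]]; first by exists Q0 => //; left.
  have [Q'' [FQ'' sub sub']] := Fle Q Q' FQ FQ'.
  exists Q'' => //; right=> //; first exact: (setUS sub).
  exact: ideal_span_sub (setUS sub') Qz.
pose W := R `|` B.
have AW : A `<=` W by move=> a /AR; left.
have [W1 W0] : W 1 /\ W 0.
  by case: Wr => W1 WB _; split=> //; rewrite -(subrr 1); apply: (WB).
have adjoinP x : ~ W x -> ideal_span A (adjoin W x) 1.
  move=> nWx; apply: contrapT => no; apply: (Bmax (adjoin W x)).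
    have WW : W `<=` adjoin W x.
      move=> y Wy; exists y%:P; rewrite ?hornerC // => i /=.
      by rewrite coefC; case: ifP.
    split=> [y By|sub]; first by apply: WW; right.
    apply: nWx; right; apply: sub; exists 'X; rewrite ?hornerX // => i /=.
    by rewrite coefX; case: eqP.
  have e : R `|` adjoin W x = adjoin W x.
    apply/seteqP; split=> y; last by right.
    case=> // Ry; exists y%:P; rewrite ?hornerC // => i /=.
    by rewrite coefC; case: ifP => _; [left|].
  by rewrite /good e; split=> //; apply: adjoin_subring.
have vW : valuation_ring W.
  case: (Wr) => _ WB WM; split=> // x; apply: contrapT => /not_orP[nx nx'].
  have x0 : x != 0.
    by apply/eqP => x0; apply: nx; rewrite x0.
  have [p Ap px] := ideal_span_adjoin Wr (adjoinP _ nx).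
  have [q Aq qx] := ideal_span_adjoin Wr (adjoinP _ nx').
  exact: (no_inverse_relations Wr AW x0 Wno1 Ap px Aq qx).
exists W; split=> // [|a Aa [w Ww e]]; first by left.
apply: Wno1; rewrite -/W e mulrC -[_ * _]addr0.
by right=> //; left.
Qed.

End Chevalley.

(** * Approximation of a transcendental element *)
Lemma vle_min_seq (K : fieldType) (W : set K) (T : eqType) (F : T -> K) (s : seq T) :
  valuation_ring W -> s != [::] ->
  exists2 m, m \in s & forall x, x \in s -> vle W (F m) (F x).
Proof.
move=> vW; elim: s => // x [|y s] IH _.
  by exists x => [|z]; rewrite inE // => /eqP ->; apply: vle_refl.
have [//|m ms mP] := IH.
case: (vle_total vW (F x) (F m)) => h.
  exists x => [|z]; first by rewrite inE eqxx.
  by rewrite inE => /predU1P[->|/mP/(vle_trans vW h)//]; apply: vle_refl.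
by exists m => [|z]; [rewrite inE ms orbT|rewrite inE => /predU1P[->//|/mP]].
Qed.

Section Approximation.
Variables (N : closedFieldType) (M : fieldType) (f : {rmorphism N -> M}) (W : set M).
Hypothesis vW : valuation_ring W.
Hypothesis nontrivial : (exists2 u, u != 0 & vlt W (f u) 1) \/ W = setT.
Local Notation "x <=v y" := (vle W x y) (at level 70, no associativity).
Local Notation "x <v y" := (vlt W x y) (at level 70, no associativity).

(** The value group of [N] is divisible, hence dense if it is not trivial; so it
    has elements between any two of the finitely many values at hand, as well as
    beyond them. *)
Lemma same_cut (x : M) (s : seq N) : x != 0 -> exists2 c, c != 0 & forall d, d \in s ->
  (x <v f d <-> f c <v f d) /\ (f d <v x <-> f d <v f c).
Proof.
move=> x0.
have [[c [cx xc]]|no] := pselect (exists c, f c <=v x /\ x <=v f c).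
  exists c.
    by apply: contra_neq x0 => c0; apply: (@vle_eq0 _ W); move: xc; rewrite c0 rmorph0.
  move=> d _; split; split=> h.
  - exact: vle_lt_trans cx h.
  - exact: vle_lt_trans xc h.
  - exact: vlt_le_trans h xc.
  - exact: vlt_le_trans h cx.
have cmp d : f d <v x \/ x <v f d.
  case: (vltP W (f d) x) => [|h1]; first by left.
  case: (vltP W x (f d)) => [|h2]; first by right.
  by case: no; exists d.
have [u u0 u1] : exists2 u, u != 0 & f u <v 1.
  case: nontrivial => // WT; case: no; exists 1; rewrite rmorph1 WT.
  by split; [exists (x^-1)|exists x] => //; rewrite ?mulr1 ?mulVf.
suff [c c0 [lo up]] : exists2 c, c != 0 &
    (forall d, d \in s -> f d <v x -> f d <v f c) /\
    (forall d, d \in s -> x <v f d -> f c <v f d).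
  exists c => // d ds; split; split=> h.
  - exact: up.
  - case: (cmp d) => // /(lo d ds) h'.
    by have := vle_lt_trans vW (vltW vW h) h' => /(vlt_irr vW).
  - exact: lo.
  - case: (cmp d) => // /(up d ds) h'.
    by have := vle_lt_trans vW (vltW vW h) h' => /(vlt_irr vW).
pose L := [seq d <- s | `[< f d <v x >] && (d != 0)].
pose U := [seq d <- s | `[< x <v f d >]].
have LP d : d \in s -> f d <v x -> d != 0 -> d \in L.
  by move=> ds h d0; rewrite mem_filter ds d0 !andbT; apply/asboolP.
have UP d : d \in s -> x <v f d -> d \in U.
  by move=> ds h; rewrite mem_filter ds andbT; apply/asboolP.
have fu0 : f u != 0 by rewrite fmorph_eq0.
have low c l : c != 0 -> (forall d, d \in L -> f d <=v f l) -> f l <v f c ->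
    forall d, d \in s -> f d <v x -> f d <v f c.
  move=> c0 lP lc d ds dx; have [->|d0] := eqVneq d 0.
    by rewrite rmorph0; apply: (@vcmp0 _ _ vW true); rewrite fmorph_eq0.
  by apply: vle_lt_trans lc => //; apply/lP/LP.
have high c l : (forall d, d \in U -> f l <=v f d) -> f c <v f l ->
    forall d, d \in s -> x <v f d -> f c <v f d.
  by move=> lP lc d ds dx; apply: (vlt_le_trans vW lc); apply/lP/UP.
have uu y : y != 0 -> f u * y <v y.
  by move=> y0; rewrite mulrC -[X in _ <v X]mulr1; apply/vltMl_iff.
have [L0|L0] := eqVneq L [::]; have [U0|U0] := eqVneq U [::].
- exists 1; first exact: oner_neq0.
  split=> d ds h; last by have := UP d ds h; rewrite U0.
  have [->|d0] := eqVneq d 0; last by have := LP d ds h d0; rewrite L0.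
  by rewrite rmorph0 rmorph1; apply: (@vcmp0 _ _ vW true); apply: oner_neq0.
- have [m mU mP] := vle_min_seq f vW U0.
  have m0 : m != 0.
    rewrite -(fmorph_eq0 f); apply: (@vlt_neq0 _ _ vW x).
    by move: mU; rewrite mem_filter => /andP[/asboolP].
  exists (u * m); first by rewrite mulf_neq0.
  have h : f (u * m) <v f m by rewrite rmorphM; apply: uu; rewrite fmorph_eq0.
  split; last exact: high mP h.
  apply: (low _ (u * (u * m))); rewrite ?mulf_neq0 // ?L0 //.
  by rewrite rmorphM; apply: uu; rewrite fmorph_eq0 mulf_neq0.
- have [m mL mP'] := vle_max_seq vW (s := map f L) (ltac:(by case: (L) L0)).
  case/mapP: mL mP' => {}l lL -> mP.
  have l0 : l != 0 by move: lL; rewrite mem_filter => /andP[/andP[]].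
  have c0 : u^-1 * l != 0 by rewrite mulf_neq0 ?invr_eq0.
  exists (u^-1 * l) => //; split; last by move=> d ds h; have := UP d ds h; rewrite U0.
  apply: (low _ l) => // [d dL|]; first by apply: mP; apply: map_f.
  by rewrite -[X in f X <v _](mulVKf u0) rmorphM; apply: uu; rewrite fmorph_eq0.
have [m mL mP'] := vle_max_seq vW (s := map f L) (ltac:(by case: (L) L0)).
case/mapP: mL mP' => {}l lL -> lP.
have [m' mU mP] := vle_min_seq f vW U0.
have l0 : l != 0 by move: lL; rewrite mem_filter => /andP[/andP[]].
have lx : f l <v x by move: lL; rewrite mem_filter => /andP[/andP[/asboolP]].
have xm : x <v f m' by move: mU; rewrite mem_filter => /andP[/asboolP].
have lm : f l <v f m' by apply: vle_lt_trans xm => //; apply: vltW.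
have m0 : m' != 0 by rewrite -(fmorph_eq0 f); apply: (vlt_neq0 vW lm).
have [c cP] := @solve_monicpoly N 2 (nth 0 [:: l * m'])  isT.
have {}cP : f c * f c = f l * f m'.
  rewrite -!rmorphM -expr2 cP !big_ord_recl big_ord0 /= expr0 mulr1 mul0r !addr0.
  by [].
have c0 : c != 0.
  apply/eqP => c0; move/eqP: cP; rewrite c0 rmorph0 mulr0 eq_sym mulf_eq0 !fmorph_eq0.
  by rewrite (negPf l0) (negPf m0).
exists c => //; split.
  apply: (low _ l) => // [d dL|]; first by apply: lP; apply: map_f.
  move=> cl; have : f l * f l <v f l * f m' by apply/vltMl_iff; rewrite ?fmorph_eq0.
  by rewrite -cP; apply; apply: vleM.
apply: (high _ m') => // cm.
have : f l * f m' <v f m' * f m' by rewrite mulrC; apply/vltMl_iff; rewrite ?fmorph_eq0.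
by rewrite -cP; apply; apply: vleM.
Qed.

Definition veq (x y : M) : Prop := x <=v y /\ y <=v x.

Lemma veqM x x' y y' : veq x y -> veq x' y' -> veq (x * x') (y * y').
Proof. by move=> [? ?] [? ?]; split; apply: vleM. Qed.

Lemma veq_vle x x' y y' : veq x y -> veq x' y' -> x <=v x' <-> y <=v y'.
Proof.
move=> [xy yx] [xy' yx']; split=> h.
  by apply: (vle_trans vW yx); apply: (vle_trans vW h).
by apply: (vle_trans vW xy); apply: (vle_trans vW h).
Qed.

(** If in none of the factors [x + e] the two terms cancel, then each factor has
    the size of the larger term, and the product that of a monomial in [x]. *)
Lemma dominant_monomial (x : M) (c : N) (d : seq N) (P : pred N) :
  (forall e, e \in d -> x <=v x + f e /\ f e <=v x + f e) ->
  (forall e, e \in d -> P e <-> x <v f e) ->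
  veq (f c * \prod_(e <- d) (x + f e))
      (f (c * \prod_(e <- d | P e) e) * x ^+ count (predC P) d).
Proof.
move=> hd hP; elim: d hd hP => [|e d IH] hd hP.
  by rewrite !big_nil mulr1 expr0 !mulr1; split; apply: vle_refl.
have {}IH := IH (fun e' h => hd e' (@mem_behead _ (e :: d) e' h))
                (fun e' h => hP e' (@mem_behead _ (e :: d) e' h)).
have [xe ee] := hd e (mem_head _ _); have Pe := hP e (mem_head _ _).
rewrite !big_cons /=; case: ifP => Pe'.
  rewrite add0n mulrCA [c * _]mulrCA rmorphM -mulrA; apply: veqM => //; split=> //.
  apply: vleD => //; last exact: vle_refl.
  by apply/vltW => //; apply/Pe.
rewrite add1n exprS mulrCA [f _ * (x * _)]mulrCA; apply: veqM => //; split=> //.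
apply: vleD => //; first exact: vle_refl.
by case: (vltP W x (f e)) => // /Pe; rewrite Pe'.
Qed.

Lemma vleX_iff x y n : (0 < n)%N -> x ^+ n <=v y ^+ n <-> x <=v y.
Proof.
move=> n0; split=> [h|]; last exact: vleX.
by case: (vltP W y x) => // /(vltX vW n0); case.
Qed.

(** The comparison of two monomials in [x] is a comparison of [x] with a root of
    the quotient of their coefficients. *)
Lemma compare_monomials (c c' d d' : N) (k k' : nat) (x y : M) :
  x != 0 -> y != 0 -> c != 0 -> c' != 0 ->
  ((k' < k)%N -> d ^+ (k - k') = c' / c) -> ((k < k')%N -> d' ^+ (k' - k) = c / c') ->
  (f d <v x <-> f d <v y) -> (x <v f d' <-> y <v f d') ->
  f c * x ^+ k <=v f c' * x ^+ k' <-> f c * y ^+ k <=v f c' * y ^+ k'.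
Proof.
move=> x0 y0 c0 c'0 dP d'P hd hd'.
have fc0 : f c != 0 by rewrite fmorph_eq0.
have fc'0 : f c' != 0 by rewrite fmorph_eq0.
have less z : z != 0 -> (k' < k)%N ->
    f c * z ^+ k <=v f c' * z ^+ k' <-> ~ f d <v z.
  move=> z0 kk; have kk0 : (0 < k - k')%N by rewrite subn_gt0.
  have -> : c' = c * d ^+ (k - k') by rewrite dP // mulrCA mulfV // mulr1.
  rewrite -{1}(subnK (ltnW kk)) exprD mulrA rmorphM -!mulrA vleMl_iff //.
  rewrite ![_ * z ^+ k']mulrC vleMl_iff ?expf_neq0 // rmorphXn vleX_iff //.
  by rewrite /vlt; split; [tauto|exact: contrapT].
have more z : z != 0 -> (k < k')%N ->
    f c * z ^+ k <=v f c' * z ^+ k' <-> ~ z <v f d'.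
  move=> z0 kk; have kk0 : (0 < k' - k)%N by rewrite subn_gt0.
  have -> : c = c' * d' ^+ (k' - k) by rewrite d'P // mulrCA mulfV // mulr1.
  rewrite -{2}(subnK (ltnW kk)) exprD mulrA rmorphM -!mulrA vleMl_iff //.
  rewrite ![_ * z ^+ k]mulrC vleMl_iff ?expf_neq0 // rmorphXn vleX_iff //.
  by rewrite /vlt; split; [tauto|exact: contrapT].
case: (ltngtP k k') => kk.
- by rewrite !more //; tauto.
- by rewrite !less //; tauto.
- by rewrite kk ![_ * _ ^+ k']mulrC !vleMl_iff ?expf_neq0.
Qed.

Lemma nth_root_exists (c : N) n : (0 < n)%N -> exists d, d ^+ n = c.
Proof.
move=> n0; have [d dP] := @solve_monicpoly N n (nth 0 [:: c]) n0.
exists d; rewrite dP; case: n n0 {dP} => // n _.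
rewrite big_ord_recl /= expr0 mulr1 big1 ?addr0 // => i _.
by rewrite nth_nil mul0r.
Qed.

Variable t : M.
Hypothesis t_transcendental : forall p : {poly N}, p != 0 -> (map_poly f p).[t] != 0.

(** Seen from the root [r0] closest to [t], every polynomial of [s] has the size
    of a monomial in [t - r0], so the comparisons between them depend only on
    the position of [t - r0] among finitely many values of [N]. *)
Lemma approximate_transcendental (s : seq {poly N}) : exists a : N, forall p, p \in s ->
  (p != 0 -> p.[a] != 0) /\ forall q, q \in s ->
    ((map_poly f p).[t] <=v (map_poly f q).[t] <-> f p.[a] <=v f q.[a]).
Proof.
have split_poly (p : {poly N}) :
    exists r : seq N, p = lead_coef p *: \prod_(c <- r) ('X - c%:P).
  by case: (closed_field_poly_normal p) => r Dp; exists r.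
have {split_poly} [rs rsP] := choice split_poly.
pose roots := 0 :: flatten [seq rs p | p <- s].
have mem_roots p r : p \in s -> r \in rs p -> r \in roots.
  move=> ps rr; rewrite inE; apply/orP; right.
  by apply/flattenP; exists (rs p) => //; apply: map_f.
have [r0 _ r0min] := vle_min_seq (fun r => t - f r) vW (isT : roots != [::]).
pose x := t - f r0.
have x0 : x != 0.
  have := t_transcendental (p := 'X - r0%:P); rewrite polyXsubC_eq0 => /(_ isT).
  by rewrite map_polyXsubC hornerXsubC.
pose d p := [seq r0 - r | r <- rs p].
have dx p e : p \in s -> e \in d p -> x <=v x + f e /\ f e <=v x + f e.
  move=> ps /mapP[r rr ->].
  have -> : x + f (r0 - r) = t - f r by rewrite /x; ring.
  have h := r0min _ (mem_roots _ _ ps rr); split=> //.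
  have -> : f (r0 - r) = (t - f r) + - x by rewrite /x; ring.
  by apply: vleD => //; [apply: vle_refl|apply: vleN].
pose P e := `[< x <v f e >].
pose c p := lead_coef p * \prod_(e <- d p | P e) e.
pose k p := count (predC P) (d p).
have exdelta (pq : {poly N} * {poly N}) : exists y,
    (k pq.2 < k pq.1)%N -> y ^+ (k pq.1 - k pq.2) = c pq.2 / c pq.1.
  case: ltnP => [h|_]; last by exists 0.
  have [|y yP] := @nth_root_exists (c pq.2 / c pq.1) (k pq.1 - k pq.2).
    by rewrite subn_gt0.
  by exists y.
have [delta deltaP] := choice exdelta.
pose cuts := flatten [seq d p | p <- s] ++ [seq delta (p, q) | p <- s, q <- s].
have [b0 b00 b0P] := same_cut cuts x0.
(* a generic unit factor keeps [b] from cancelling any [e] of the same size *)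
have [z Wz [z1 zP]] := generic_unit_seq (valuation_ring_preimage f vW)
  [seq - (e / b0) | e <- flatten [seq d p | p <- s]].
have z0 : z != 0.
  by apply/eqP => z0; move: z1; rewrite z0 => /vle_eq0/eqP; rewrite oner_eq0.
pose b := b0 * z.
have b_neq0 : b != 0 by rewrite mulf_neq0.
have bb0 : veq (f b0) (f b).
  rewrite rmorphM; split; last first.
    by exists (f z) => //; rewrite mulrC.
  rewrite -[X in X <=v _]mulr1; apply: vleMl => //; rewrite -(rmorph1 f).
  by apply/vle_preimage.
have {}b0P e : e \in cuts -> (x <v f e <-> f b <v f e) /\ (f e <v x <-> f e <v f b).
  move=> /b0P[h1 h2]; have [bb1 bb2] := bb0; split.
    apply: (iff_trans h1); split=> h; first exact: vle_lt_trans bb2 h.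
    exact: vle_lt_trans bb1 h.
  apply: (iff_trans h2); split=> h; first exact: vlt_le_trans h bb1.
  exact: vlt_le_trans h bb2.
have mem_cuts p e : p \in s -> e \in d p -> e \in flatten [seq d p | p <- s].
  by move=> ps ed; apply/flattenP; exists (d p) => //; apply: map_f.
have db p e : p \in s -> e \in d p -> f b <=v f b + f e /\ f e <=v f b + f e.
  move=> ps ed.
  have [] := zP (- (e / b0)); first by apply: (map_f (fun e => - (e / b0))); apply: mem_cuts ed.
  move=> /(vle_preimage f _ _ vW) h1 /(vle_preimage f _ _ vW) h2.
  have De : f b + f e = f b0 * f (z - - (e / b0)).
    by rewrite -rmorphD -rmorphM opprK mulrDr mulrCA divff // mulr1.
  rewrite De; split.
    apply: (@vle_trans _ _ vW (f b0)); first by case: bb0.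
    by rewrite -[X in X <=v _]mulr1; apply: vleMl => //; rewrite -(rmorph1 f).
  have {1}-> : f e = f b0 * (- f (- (e / b0))).
    by rewrite -rmorphN -rmorphM opprK mulrCA divff // mulr1.
  by apply: vleMl => //; apply: vleN.
exists (r0 + b).
have eval p : (map_poly f p).[t] = f (lead_coef p) * \prod_(e <- d p) (x + f e).
  rewrite {1}(rsP p) map_polyZ hornerZ rmorph_prod horner_prod big_map /=.
  congr (_ * _); apply: eq_bigr => r _.
  by rewrite map_polyXsubC hornerXsubC /x; ring.
have evalb p : f p.[r0 + b] = f (lead_coef p) * \prod_(e <- d p) (f b + f e).
  rewrite {1}(rsP p) hornerZ horner_prod rmorphM rmorph_prod big_map /=.
  congr (_ * _); apply: eq_bigr => r _.
  by rewrite hornerXsubC -rmorphD addrA [b + _]addrC.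
have Px p : p \in s -> veq (map_poly f p).[t] (f (c p) * x ^+ k p).
  move=> ps; rewrite eval; apply: dominant_monomial => e ed; first exact: dx ed.
  by split=> [/asboolP//|?]; apply/asboolP.
have Pb p : p \in s -> veq (f p.[r0 + b]) (f (c p) * f b ^+ k p).
  move=> ps; rewrite evalb; apply: dominant_monomial => e ed; first exact: db ed.
  have [h _] : (x <v f e <-> f b <v f e) /\ (f e <v x <-> f e <v f b).
    by apply: b0P; rewrite mem_cat (mem_cuts _ _ ps ed).
  by split=> [/asboolP/h//|/h ?]; apply/asboolP.
have fb0 : f b != 0 by rewrite fmorph_eq0.
have c0 p : p \in s -> p != 0 -> c p != 0.
  move=> ps p0; rewrite mulf_neq0 ?lead_coef_eq0 //.
  rewrite prodf_seq_neq0; apply/allP => e ed; apply/implyP => /asboolP h.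
  by rewrite -(fmorph_eq0 f); apply: (vlt_neq0 vW h).
have nonzero p : p \in s -> p != 0 -> p.[r0 + b] != 0.
  move=> ps p0; apply/eqP => e; have [_] := Pb p ps.
  rewrite e rmorph0 => /vle_eq0/eqP; rewrite mulf_eq0 expf_eq0 (negPf fb0) andbF orbF.
  by rewrite fmorph_eq0 (negPf (c0 p ps p0)).
move=> p ps; split; first exact: nonzero.
move=> q qs.
have [->|p0] := eqVneq p 0.
  by rewrite map_poly0 !horner0 rmorph0; split=> _; apply: vle0.
have [->|q0] := eqVneq q 0.
  rewrite map_poly0 !horner0 rmorph0; split=> /vle_eq0/eqP.
    by rewrite (negPf (t_transcendental p0)).
  by rewrite fmorph_eq0 (negPf (nonzero p ps p0)).
apply: (iff_trans (veq_vle (Px p ps) (Px q qs))).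
apply: iff_trans (iff_sym (veq_vle (Pb p ps) (Pb q qs))).
have mem_delta p' q' : p' \in s -> q' \in s -> delta (p', q') \in cuts.
  by move=> h h'; rewrite mem_cat; apply/orP; right; apply/allpairsP; exists (p', q').
apply: (@compare_monomials _ _ (delta (p, q)) (delta (q, p))); rewrite ?c0 //.
- exact: (deltaP (p, q)).
- exact: (deltaP (q, p)).
- by have [] := b0P _ (mem_delta p q ps qs).
- by have [] := b0P _ (mem_delta q p qs ps).
Qed.
End Approximation.

(** * Finite extensions and common eigenvectors *)
(** The space [V] is given by its elements; the induction replaces it by the
    eigenvectors in [V] of the first matrix, which exist by the theorem of
    Cayley and Hamilton. *)
Lemma stable_common_eigenvector (K : closedFieldType) m (As : seq 'M[K]_m.+1)
    (V : set 'rV[K]_m.+1) :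
  (forall A v a, A \in As -> V v -> V (v *m A - a *: v)) ->
  {in As &, forall A B, A *m B = B *m A} ->
  (exists2 v, v != 0 & V v) ->
  exists v, [/\ v != 0, V v & forall A, A \in As -> exists a, v *m A = a *: v].
Proof.
elim: As V => [|A As IH] V stab comm [v v0 Vv]; first by exists v.
have [rs Drs] := closed_field_poly_normal (char_poly A).
have vA0 : v *m horner_mx A (\prod_(r <- rs) ('X - r%:P)) = 0.
  have := Cayley_Hamilton A; rewrite Drs (monicP (char_poly_monic A)) scale1r => ->.
  by rewrite mulmx0.
have [w [a [w0 Vw wA]]] : exists w a, [/\ w != 0, V w & w *m A = a *: w].
  elim: rs v v0 Vv vA0 {Drs} => [|r rs IHrs] v v0 Vv.
    by rewrite big_nil rmorph1 mulmx1 => e; rewrite e eqxx in v0.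
  rewrite big_cons rmorphM rmorphB /= horner_mx_X horner_mx_C mulmxA.
  rewrite mulmxBr mul_mx_scalar.
  have [e _|n0 e] := eqVneq (v *m A - r *: v) 0.
    by exists v, r; split=> //; apply/eqP; rewrite -subr_eq0 e.
  by apply: IHrs e => //; apply: stab; rewrite ?mem_head.
have [||| u [u0 [Vu uA] uAs]] := IH [set u | V u /\ u *m A = a *: u].
- move=> B u b BAs [Vu uA]; split; first by apply: stab => //; rewrite inE BAs orbT.
  rewrite mulmxBl -mulmxA -(comm A B) ?mem_head ?inE ?BAs ?orbT // mulmxA uA.
  by rewrite -!scalemxAl uA scalerBr scalerA mulrC scalerA.
- by move=> B C BAs CAs; apply: comm; rewrite inE ?BAs ?CAs orbT.
- by exists w.
exists u; split=> // B; rewrite inE => /predU1P[->|]; last exact: uAs.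
by exists a.
Qed.

Section FiniteSpan.
Variables (R : idomainType) (M : fieldType) (phi : {rmorphism R -> M}).
Hypothesis phi_inj : injective phi.
Implicit Types (s e : seq M).

(** The span over the field of fractions of [R], as the smallest set with the
    closure properties in use; coordinates are extracted in [lspan_coord]. *)
Inductive lspan s : M -> Prop :=
| lspan0 : lspan s 0
| lspanD a b x y : b != 0 -> x \in s -> lspan s y -> lspan s (phi a / phi b * x + y).

Lemma phi_eq0 a : (phi a == 0) = (a == 0).
Proof. by rewrite -(inj_eq phi_inj) rmorph0. Qed.

Lemma lspan_mem s x : x \in s -> lspan s x.
Proof.
move=> xs; rewrite -[x]addr0 -[x]mul1r -(divr1 1) -(rmorph1 phi).
by right=> //; [apply: oner_neq0|left].
Qed.

Lemma lspan_add s x y : lspan s x -> lspan s y -> lspan s (x + y).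
Proof.
elim=> [|a b x' y' b0 xs _ IH] hy; first by rewrite add0r.
by rewrite -addrA; right=> //; apply: IH.
Qed.

Lemma lspan_scale s a b x : b != 0 -> lspan s x -> lspan s (phi a / phi b * x).
Proof.
move=> b0; elim=> [|a' b' x' y' b'0 xs _ IH]; first by rewrite mulr0; left.
rewrite mulrDr mulrA mulf_div -!rmorphM; right=> //.
by rewrite mulf_neq0.
Qed.

Lemma lspan_sum s (I : Type) (r : seq I) (P : pred I) (F : I -> M) :
  (forall i, P i -> lspan s (F i)) -> lspan s (\sum_(i <- r | P i) F i).
Proof.
move=> h; apply: (big_ind (lspan s)) => //; first by left.
exact: lspan_add.
Qed.

Lemma lspan_trans s s' x : (forall y, y \in s -> lspan s' y) -> lspan s x -> lspan s' x.
Proof.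
move=> sub; elim=> [|a b y z b0 ys _ IH]; first by left.
by apply: lspan_add => //; apply: lspan_scale => //; apply: sub.
Qed.

Lemma lspan_mul s s' z x : (forall y, y \in s -> lspan s' (z * y)) ->
  lspan s x -> lspan s' (z * x).
Proof.
move=> sub; elim=> [|a b y w b0 ys _ IH]; first by rewrite mulr0; left.
by rewrite mulrDr mulrCA; apply: lspan_add => //; apply: lspan_scale => //; apply: sub.
Qed.

Definition lfree e : Prop := forall c : 'I_(size e) -> R,
  \sum_i phi (c i) * e`_i = 0 -> forall i, c i = 0.

Lemma lspan_coord e x : lspan e x -> exists2 b, b != 0 &
  exists c : 'I_(size e) -> R, phi b * x = \sum_i phi (c i) * e`_i.
Proof.
elim=> [|a b y z b0 ye _ [b' b'0 [c Dz]]].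
  exists 1; first exact: oner_neq0.
  by exists (fun=> 0); rewrite mulr0 big1 // => i _; rewrite rmorph0 mul0r.
exists (b * b'); first by rewrite mulf_neq0.
have iy : (index y e < size e)%N by rewrite index_mem.
exists (fun i => b * c i + a * b' *+ (i == Ordinal iy)).
under eq_bigr do rewrite rmorphD mulrDl rmorphM -mulrA.
rewrite big_split /= -mulr_sumr -Dz (bigD1 (Ordinal iy)) //= big1; last first.
  by move=> i /negPf ->; rewrite mulr0n rmorph0 mul0r.
by rewrite eqxx mulr1n addr0 nth_index // !rmorphM; field; rewrite phi_eq0.
Qed.

Lemma free_sublist s : exists e, [/\ {subset e <= s}, lfree e &
  forall x, x \in s -> lspan e x].
Proof.
elim: s => [|x s [e [sub free sp]]].
  by exists [::]; split=> // c _ [].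
have [fr|nfr] := pselect (lfree (x :: e)).
  exists (x :: e); split=> // y; rewrite !inE => /predU1P[->|]; rewrite ?eqxx //.
  - by move=> /sub ->; rewrite orbT.
  - by apply: lspan_mem; rewrite mem_head.
  - move=> /sp; apply: lspan_trans => z ze.
    by apply: lspan_mem; rewrite inE ze orbT.
exists e; split=> // [y ye|y]; first by rewrite inE sub ?orbT.
rewrite inE => /predU1P[->|]; last exact: sp.
have {nfr} [c Dc [i ci]] : exists2 c : 'I_(size (x :: e)) -> R,
    \sum_i phi (c i) * (x :: e)`_i = 0 & exists i, c i != 0.
  apply: contrapT => no; apply: nfr => c Dc i; apply: contrapT => /eqP ci.
  by apply: no; exists c => //; exists i.
rewrite big_ord_recl /= in Dc.
have c0 : c ord0 != 0.
  apply: contra_neq ci => c0; move: Dc; rewrite c0 rmorph0 mul0r add0r => /free h.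
  by case: (unliftP ord0 i) => [j ->|->//]; apply: (h j).
have -> : x = \sum_i phi (- c (fintype.lift ord0 i)) / phi (c ord0) * e`_i.
  have pc0 : phi (c ord0) != 0 by rewrite phi_eq0.
  apply: (mulfI pc0); rewrite mulr_sumr.
  apply: oppr_inj; rewrite (addr0_eq Dc) -sumrN; apply: eq_bigr => j _.
  by rewrite rmorphN; field.
apply: lspan_sum => j _; rewrite -[_ * _]addr0; right=> //; last by left.
exact: mem_nth.
Qed.

Definition algebraic_elt (x : M) := exists2 p : {poly R}, p != 0 & root (map_poly phi p) x.

(** Finitely many algebraic elements generate a finite extension: when [x] of
    degree [n] is added, the generators are multiplied by [1, x, ..., x^(n-1)]. *)
Lemma stable_span (xs : seq M) : (forall x, x \in xs -> algebraic_elt x) ->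
  exists2 s, 1 \in s & forall x y, x \in xs -> y \in s -> lspan s (x * y).
Proof.
elim: xs => [|x xs IH] alg; first by exists [:: 1]; rewrite ?mem_head.
have [s s1 sP] := IH (fun y h => alg y (@mem_behead _ (x :: xs) y h)).
have [p p0 px] := alg x (mem_head _ _).
pose n := size p.
have xpow k : lspan [seq x ^+ i | i <- iota 0 n] (x ^+ k).
  have low i : (i < n)%N -> lspan [seq x ^+ i | i <- iota 0 n] (x ^+ i).
    by move=> i_n; apply: lspan_mem; apply: map_f; rewrite mem_iota.
  have top : lspan [seq x ^+ i | i <- iota 0 n] (x ^+ n).
    have [m Dm] : exists m, n = m.+1 by exists n.-1; rewrite prednK // size_poly_gt0.
    have lc0 : phi p`_m != 0 by rewrite phi_eq0 -[m]/(m.+1.-1) -Dm -lead_coefE lead_coef_eq0.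
    have e : x ^+ m = \sum_(i < m) phi (- p`_i) / phi p`_m * x ^+ i.
      apply: (mulfI lc0); move: px; rewrite rootE (@horner_coef_wide _ m.+1); last first.
        by rewrite -Dm (leq_trans (size_poly _ _)).
      rewrite big_ord_recr /= addrC addr_eq0 coef_map => /eqP ->.
      rewrite mulr_sumr -sumrN; apply: eq_bigr => i _; rewrite coef_map rmorphN.
      by field.
    rewrite Dm exprS {1}e mulr_sumr; apply: lspan_sum => i _; rewrite mulrCA -exprS.
    apply: lspan_scale; first by rewrite -phi_eq0.
    by rewrite -Dm; apply: low; rewrite Dm ltnS.
  elim: k => [|k IHk].
    by apply: low; rewrite size_poly_gt0.
  rewrite exprS; apply: lspan_mul IHk => y /mapP[i]; rewrite mem_iota add0n => /= i_n ->.
  rewrite -exprS; move: i_n; rewrite leq_eqVlt => /predU1P[->|h]; [exact: top|exact: low].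
pose s' := [seq y * x ^+ i | y <- s, i <- iota 0 n].
have mem_s' y i : y \in s -> (i < n)%N -> y * x ^+ i \in s'.
  by move=> ys i_n; apply/allpairsP; exists (y, i); rewrite mem_iota.
have span_s' y k : y \in s -> lspan s' (y * x ^+ k).
  move=> ys; apply: lspan_mul (xpow k) => z /mapP[i]; rewrite mem_iota add0n => /= i_n ->.
  by apply: lspan_mem; apply: mem_s'.
exists s'.
  by rewrite -(mulr1 1) -[X in _ * X](expr0 x); apply: mem_s'; rewrite ?size_poly_gt0.
move=> z u zx /allpairsP[[y i] [/= ys]]; rewrite mem_iota add0n => /= i_n -> {u}.
move: zx; rewrite inE => /predU1P[->|zx].
  by rewrite mulrCA -exprS; apply: span_s'.
rewrite mulrA mulrC; apply: lspan_mul (sP z y zx ys) => w ws.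
by rewrite mulrC; apply: span_s'.
Qed.

End FiniteSpan.

(** * Specialization of one transcendental element *)
Lemma row_eigen_prod (K : comNzRingType) (I : Type) m (v : 'rV[K]_m.+1)
    (A : I -> 'M[K]_m.+1) (y : I -> K) (r : seq I) (k : I -> nat) :
  (forall i, v *m A i = y i *: v) ->
  v *m (\prod_(i <- r) A i ^+ k i) = (\prod_(i <- r) y i ^+ k i) *: v.
Proof.
move=> vA.
have vAk i l : v *m A i ^+ l = y i ^+ l *: v.
  elim: l => [|l IH]; first by rewrite !expr0 mulmx1 scale1r.
  by rewrite exprSr mulmxA IH -scalemxAl vA scalerA -exprSr.
elim: r => [|i r IH]; first by rewrite !big_nil mulmx1 scale1r.
by rewrite !big_cons mulmxA vAk -scalemxAl IH scalerA.
Qed.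

Lemma col_eigen_prod (K : comNzRingType) (I : Type) m (v : 'cV[K]_m.+1)
    (A : I -> 'M[K]_m.+1) (y : I -> K) (r : seq I) (k : I -> nat) :
  (forall i, A i *m v = y i *: v) ->
  (\prod_(i <- r) A i ^+ k i) *m v = (\prod_(i <- r) y i ^+ k i) *: v.
Proof.
move=> vA.
have vAk i l : A i ^+ l *m v = y i ^+ l *: v.
  elim: l => [|l IH]; first by rewrite !expr0 mul1mx scale1r.
  by rewrite exprS -mulmxA IH -scalemxAr vA scalerA -exprSr.
elim: r => [|i r IH]; first by rewrite !big_nil mul1mx scale1r.
by rewrite !big_cons -mulmxA IH -scalemxAr vAk scalerA mulrC.
Qed.

Definition horner2 (R K : comNzRingType) (rho : {rmorphism R -> K}) (z : K) :
  {rmorphism {poly R} -> K} := horner_eval z \o map_poly rho.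

Lemma horner2C (R K : comNzRingType) (rho : {rmorphism R -> K}) z c :
  horner2 rho z c%:P = rho c.
Proof. by rewrite /horner2 /= /horner_eval map_polyC hornerC. Qed.

Lemma horner2X (R K : comNzRingType) (rho : {rmorphism R -> K}) z k :
  horner2 rho z 'X^k = z ^+ k.
Proof. by rewrite /horner2 /= /horner_eval map_polyXn hornerXn. Qed.

(** Multiplication by algebraic elements [x i] on a finite extension, written in
    a basis [e] with a common denominator [delta]. *)
Lemma multiplication_matrices (R : idomainType) (M : fieldType)
    (phi : {rmorphism R -> M}) n (x : 'I_n -> M) :
  injective phi -> (forall i, algebraic_elt phi (x i)) ->
  exists (m : nat) (e : 'cV[M]_m.+1) (delta : R) (A : 'I_n -> 'M[R]_m.+1),
    [/\ delta != 0,
        (forall B : 'M[R]_m.+1, map_mx phi B *m e = 0 -> B = 0) &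
        forall i, map_mx phi (A i) *m e = (phi delta * x i) *: e].
Proof.
move=> phi_inj alg.
have [s s1 sP] : exists2 s, 1 \in s & forall y z, y \in codom x -> z \in s -> lspan phi s (y * z).
  by apply: stable_span => // _ /codomP[i ->].
have [e [sub free sp]] := free_sublist phi_inj s.
case: e sub free sp => [|e0 e] sub free sp.
  have [c c0 [d]] := lspan_coord phi_inj (sp 1 s1).
  by rewrite big_ord0 mulr1 => /eqP; rewrite phi_eq0 // (negPf c0).
pose E := e0 :: e; pose m := size e.
have coord (ij : 'I_n * 'I_m.+1) : exists bc : R * ('I_m.+1 -> R), bc.1 != 0 /\
    phi bc.1 * (x ij.1 * E`_ij.2) = \sum_k phi (bc.2 k) * E`_k.
  have Ej : E`_ij.2 \in s by apply/sub/mem_nth.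
  have h : lspan phi E (x ij.1 * E`_ij.2).
    by apply: lspan_trans (sP _ _ (codom_f x ij.1) Ej) => y ys; apply: sp.
  by have [b b0 [c Dc]] := lspan_coord phi_inj h; exists (b, c).
have [bc bcP] := choice coord.
pose delta := \prod_ij (bc ij).1.
pose rest ij := \prod_(ij' | ij' != ij) (bc ij').1.
pose A i := \matrix_(j, k) ((bc (i, j)).2 k * rest (i, j)).
exists m, (\col_j E`_j), delta, A; split.
- by apply/prodf_neq0 => ij _; case: (bcP ij).
- move=> B BE; apply/matrixP => i k; rewrite !mxE.
  apply: (free (fun k => B i k)) => //.
  transitivity ((map_mx phi B *m (\col_j E`_j)) i 0); last by rewrite BE mxE.
  by rewrite mxE; apply: eq_bigr => j _; rewrite !mxE.
- move=> i; apply/colP => j; rewrite !mxE.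
  have [_ Dij] := bcP (i, j); rewrite /= in Dij.
  have -> : phi delta = phi (bc (i, j)).1 * phi (rest (i, j)).
    by rewrite -rmorphM /delta (bigD1 (i, j)).
  transitivity (phi (rest (i, j)) * (phi (bc (i, j)).1 * (x i * E`_j))); last by ring.
  rewrite Dij mulr_sumr; apply: eq_bigr => k _; rewrite !mxE rmorphM; ring.
Qed.

Section Specialization.
Variables (N M : closedFieldType) (f : {rmorphism N -> M}) (W : set M).
Hypothesis vW : valuation_ring W.
Hypothesis nontrivial : (exists2 u, u != 0 & vlt W (f u) 1) \/ W = setT.
Variable t : M.
Hypothesis t_transcendental : forall p : {poly N}, p != 0 -> (map_poly f p).[t] != 0.
Local Notation R := {poly N}.

Definition eval_at_t : {rmorphism R -> M} := horner_eval t \o map_poly f.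
Local Notation phi := eval_at_t.

Lemma eval_at_tE p : phi p = (map_poly f p).[t]. Proof. by []. Qed.

Lemma eval_at_t_inj : injective phi.
Proof.
apply: raddf_inj => p /eqP; apply: contraTeq => p0; exact: t_transcendental.
Qed.

(** The polynomial [\det (d * T - B)] in [T]: its roots are the eigenvalues of
    [B] divided by [d], without a division before specialization. *)
Definition pencil_det (S : comNzRingType) m (d : S) (B : 'M[S]_m) : {poly S} :=
  \det ((d *: 'X)%:M - map_mx polyC B).

Lemma pencil_det_map (S K : comNzRingType) (psi : {rmorphism S -> K}) m d (B : 'M[S]_m) x :
  (map_poly psi (pencil_det d B)).[x] = \det ((psi d * x)%:M - map_mx psi B).
Proof.
pose ev : {rmorphism {poly S} -> K} := horner_eval x \o map_poly psi.
rewrite -[LHS]/(ev (pencil_det d B)) -det_map_mx; congr (\det _).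
apply/matrixP => i j; rewrite !mxE rmorphB rmorphMn /=; congr (_ *+ _ - _).
  by rewrite /ev /= /horner_eval map_polyZ hornerZ map_polyX hornerX.
by rewrite /ev /= /horner_eval map_polyC hornerC.
Qed.

Lemma pencil_det_neq0 (K : closedFieldType) (S : comNzRingType) (psi : {rmorphism S -> K})
    m d (B : 'M[S]_m) : psi d != 0 -> map_poly psi (pencil_det d B) != 0.
Proof.
move=> d0; have [x nx] : exists x, ~~ root (char_poly (map_mx psi B)) x.
  by apply/closed_nonrootP/monic_neq0/char_poly_monic.
apply: contraNneq nx => P0.
have := pencil_det_map psi d B (x / psi d).
rewrite P0 horner0 mulrCA divff // mulr1 => /esym/eqP/det0P[v v0 vB].
rewrite -eigenvalue_root_char; apply/eigenvalueP; exists v => //.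
by apply/eqP; rewrite -mul_mx_scalar eq_sym -subr_eq0 -mulmxBr vB.
Qed.

Lemma horner_cmp (K : fieldType) (U : set K) b (p : {poly K}) (z y : K) :
  valuation_ring U -> U z -> y != 0 -> (forall i, vcmp U b p`_i y) -> vcmp U b p.[z] y.
Proof.
move=> vU Uz y0 h; rewrite horner_coef; apply: vcmp_sum => // i _.
apply: (@vle_vcmp_trans _ _ vU _ _ p`_i) => //.
rewrite -[X in vle _ _ X]mulr1; apply: vleMl => //; apply/vle1.
by elim: (nat_of_ord i) => [|k IH]; rewrite ?expr0 ?exprS; [apply: val_ring1|apply: val_ringM].
Qed.

Lemma val_ringX (K : fieldType) (U : set K) z k : valuation_ring U -> U z -> U (z ^+ k).
Proof.
move=> vU Uz; elim: k => [|k IH]; first by rewrite expr0; apply: val_ring1.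
by rewrite exprS; apply: val_ringM.
Qed.

Definition poly_of_vec (K : nzRingType) n (c : 'I_n -> K) : {poly K} :=
  \sum_(i < n) c i *: 'X^i.

Lemma coef_poly_of_vec (K : nzRingType) n (c : 'I_n -> K) (i : 'I_n) : (poly_of_vec c)`_i = c i.
Proof.
rewrite coef_sum (bigD1 i) //= coefZ coefXn eqxx mulr1 big1 ?addr0 // => j ji.
by rewrite coefZ coefXn -val_eqE eq_sym in ji *; rewrite (negPf ji) mulr0.
Qed.

Lemma horner_poly_of_vec (K : comNzRingType) n (c : 'I_n -> K) z :
  (poly_of_vec c).[z] = \sum_(i < n) c i * z ^+ i.
Proof.
by rewrite horner_sum; apply: eq_bigr => i _; rewrite hornerZ hornerXn.
Qed.

(** The matrices represent multiplication by [d * x i] rather than [x i], so the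
    relation [g] is made homogeneous with the help of [d]. *)
Lemma homogenization (K : comNzRingType) n (s : N -> K) (d : K) (x : 'I_n -> K)
    (g : {mpoly N[n]}) :
  \sum_(k <- msupp g) s g@_k * d ^+ (msize g - mdeg k) * \prod_i (d * x i) ^+ k i =
  d ^+ msize g * mmap s x g.
Proof.
rewrite /mmap mulr_sumr; apply: eq_big_seq => k kg.
have -> : \prod_i (d * x i) ^+ k i = d ^+ mdeg k * mmap1 x k.
  by under eq_bigr do rewrite exprMn; rewrite big_split prodrXr -mdegE.
have -> : d ^+ msize g = d ^+ (msize g - mdeg k) * d ^+ mdeg k.
  by rewrite -exprD subnK // ltnW // msize_mdeg_lt.
move: (d ^+ _) (d ^+ _) (mmap1 x k) (s _) => u v w z; ring.
Qed.

Definition relation_matrix n m (delta : R) (A : 'I_n -> 'M[R]_m.+1) (g : {mpoly N[n]}) :=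
  \sum_(k <- msupp g) ((g@_k)%:P * delta ^+ (msize g - mdeg k)) *: \prod_i A i ^+ k i.

Lemma map_relation_matrix (K : comNzRingType) (s : {rmorphism N -> K})
    (rho : {rmorphism R -> K}) n m (delta : R) (A : 'I_n -> 'M[R]_m.+1) (g : {mpoly N[n]}) :
  (forall c, rho c%:P = s c) ->
  map_mx rho (relation_matrix delta A g) = \sum_(k <- msupp g)
    (s g@_k * rho delta ^+ (msize g - mdeg k)) *: \prod_i map_mx rho (A i) ^+ k i.
Proof.
move=> rhoC; rewrite map_mx_sum; apply: eq_bigr => k _.
rewrite map_mxZ rmorphM rmorphXn rhoC rmorph_prod; congr (_ *: _).
by apply: eq_bigr => i _; rewrite rmorphXn.
Qed.

Variables (b : bool) (n : nat) (x : 'I_n -> M).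
Hypothesis x_alg : forall i, algebraic_elt phi (x i).
Hypothesis x_small : forall i, vcmp W b (x i) 1.

(** In the notation of [multiplication_matrices], the [x i] are simultaneous
    eigenvalues of the commuting matrices [A i / delta]. Every relation between
    the [x i] holds for these matrices, hence for their specializations and for
    the simultaneous eigenvalues of the latter. To find small ones among them,
    consider the combination of the matrices with coefficients [1, Z, Z^2, ...],
    whose eigenvalue has a Gauss norm equal to the largest of the [x i]. *)
Lemma specialize : exists y : 'I_n -> N, (forall i, vcmp W b (f (y i)) 1) /\
  forall g : {mpoly N[n]}, mmap f x g = 0 -> g.@[y] = 0.
Proof.
have [m [e [delta [A [delta0 free Ae]]]]] := multiplication_matrices eval_at_t_inj x_alg.
have e0 : e != 0.
  apply/eqP => e0; have := free 1; rewrite e0 mulmx0 => /(_ erefl)/eqP.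
  by rewrite oner_eq0.
have AC i j : A i *m A j = A j *m A i.
  apply/eqP; rewrite -subr_eq0; apply/eqP/free.
  rewrite map_mxB !map_mxM mulmxBl -!mulmxA !Ae -!scalemxAr !Ae !scalerA.
  by rewrite mulrC subrr.
pose S := {poly R}.
pose B : 'M[S]_m.+1 := \sum_(i < n) 'X^i *: map_mx polyC (A i).
pose Q : {poly S} := pencil_det delta%:P B.
have evB (K : fieldType) (rho : {rmorphism R -> K}) z :
    map_mx (horner2 rho z) B = \sum_(i < n) z ^+ i *: map_mx rho (A i).
  rewrite /B map_mx_sum; apply: eq_bigr => i _; rewrite map_mxZ horner2X; congr (_ *: _).
  by apply/matrixP => j k; rewrite !mxE horner2C.
(* at [t] the combination has the small eigenvalue [lam], for a [z] which
   computes the Gauss norm of the constant coefficient *)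
have [z Wz [_ zP]] := generic_unit vW [:: map_poly phi Q`_0].
pose Qt := map_poly (horner2 phi z) Q.
have Qt0 : Qt != 0 by apply: pencil_det_neq0; rewrite horner2C (phi_eq0 eval_at_t_inj).
pose lam := \sum_(i < n) z ^+ i * x i.
have lam_small : vcmp W b lam 1.
  apply: vcmp_sum => // [|i _]; first exact: oner_neq0.
  apply: (@vle_vcmp_trans _ _ vW _ _ (x i)) => //.
  rewrite -[X in vle _ _ X]mul1r; apply: vleM => //; last exact: vle_refl.
  by apply/vle1; apply: val_ringX.
have Qtlam : root Qt lam.
  rewrite rootE pencil_det_map horner2C evB -det_tr; apply/det0P; exists e^T.
    by rewrite -(inj_eq trmx_inj) trmxK trmx0.
  rewrite -trmx_mul mulmxBl mul_scalar_mx mulmx_suml.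
  under eq_bigr do rewrite -scalemxAl Ae scalerA.
  rewrite -scaler_suml -scalerBl mulr_sumr.
  under [X in _ - X]eq_bigr do rewrite mulrCA.
  by rewrite subrr scale0r trmx0.
have [k [k0 Qtk Qt0k]] := small_root_coef vW Qt0 Qtlam lam_small.
have coefQt i : Qt`_i = (map_poly phi Q`_i).[z] by rewrite coef_map.
rewrite !coefQt in Qtk Qt0k.
have [l [lk lP]] := vle_last_max vW (fun i => phi (Q`_k)`_i) (size Q`_k).
have {}lP i : vle W (phi (Q`_k)`_i) (phi (Q`_k)`_l).
  have [h|h] := leqP i (size Q`_k); first by case: (lP i h).
  by rewrite [_`_i]nth_default ?(ltnW h) // rmorph0; apply: vle0.
have ql0 : (Q`_k)`_l != 0.
  apply: contra_neq Qtk => q0; rewrite horner_coef big1 // => i _; rewrite coef_map.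
  have := lP i; rewrite q0 rmorph0 => /vle_eq0 e1.
  by apply/eqP; rewrite mulf_eq0; apply/orP; left; apply/eqP; exact: e1.
have phiql0 : phi (Q`_k)`_l != 0 by rewrite (phi_eq0 eval_at_t_inj).
have Q0l i : vcmp W b (phi (Q`_0)`_i) (phi (Q`_k)`_l).
  apply: (@vle_vcmp_trans _ _ vW _ _ (map_poly phi Q`_0).[z]).
    by have := zP _ (mem_head _ _) i; rewrite coef_map.
  apply: (vcmp_vle_trans vW Qt0k).
  apply: (horner_cmp (b := false)) => // i'; rewrite coef_map; exact: lP.
(* the replacement [a] of [t] preserves the resulting comparison *)
have [a aP] := approximate_transcendental vW nontrivial t_transcendental
  [:: delta, (Q`_k)`_l & (Q`_0 : seq R)].
have da0 : delta.[a] != 0 by apply: (aP delta _).1; rewrite ?mem_head.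
have [qa0 qaP] := aP (Q`_k)`_l (ltac:(by rewrite !inE eqxx orbT)).
have {}qa0 := qa0 ql0.
pose rho : {rmorphism R -> N} := horner_eval a.
pose U := f @^-1` W.
have vU : valuation_ring U by apply: valuation_ring_preimage.
have Q0a i : vcmp U b ((Q`_0)`_i).[a] ((Q`_k)`_l).[a].
  have [h|h] := ltnP i (size Q`_0); last first.
    by rewrite [_`_i]nth_default // horner0; apply: vcmp0.
  have mi : (Q`_0)`_i \in [:: delta, (Q`_k)`_l & (Q`_0 : seq R)].
    by rewrite !inE mem_nth ?orbT.
  have h1 := qaP _ mi; have h2 := (aP _ mi).2 (Q`_k)`_l (ltac:(by rewrite !inE eqxx orbT)).
  apply/vcmp_preimage => //; move: (Q0l i).
  by case: (b) => /=; rewrite /vlt -?h1 -?h2.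
have [ys ysP] : exists ys : 'I_n -> seq N, forall i,
    char_poly (map_mx rho (A i)) = \prod_(r <- ys i) ('X - r%:P).
  have h i : exists r : seq N, char_poly (map_mx rho (A i)) = \prod_(r <- r) ('X - r%:P).
    have [r Dr] := closed_field_poly_normal (char_poly (map_mx rho (A i))).
    by exists r; rewrite {1}Dr (monicP (char_poly_monic _)) scale1r.
  by have [h1 h1P] := choice h; exists h1.
have size_ys i : size (ys i) = m.+1.
  have := congr1 (fun p : {poly N} => size p) (ysP i).
  by rewrite size_char_poly size_prod_XsubC => -[].
(* the simultaneous eigenvalues are taken from finitely many families [cand g],
   so [w] can be chosen generic for all of these in advance *)
pose cand (g : {ffun 'I_n -> 'I_m.+1}) := poly_of_vec (fun i => (ys i)`_(g i) / delta.[a]).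
have [w Uw [_ wP]] := generic_unit vU
  (map_poly rho Q`_k :: [seq cand g | g <- enum {ffun 'I_n -> 'I_m.+1}]).
pose Qa := map_poly (horner2 rho w) Q.
have coefQa i : Qa`_i = (map_poly rho Q`_i).[w] by rewrite coef_map.
have qlQak : vle U ((Q`_k)`_l).[a] Qa`_k.
  by rewrite coefQa; have := wP _ (mem_head _ _) l; rewrite coef_map.
have Qak0 : Qa`_k != 0 by apply: contra_neq qa0 => h; apply: (@vle_eq0 _ U); rewrite -h.
have Qa0k : vcmp U b Qa`_0 Qa`_k.
  apply: vcmp_vle_trans qlQak => //; rewrite coefQa; apply: horner_cmp => // i.
  by rewrite coef_map; apply: Q0a.
have [mu Qamu mu_small] := small_root vU k0 Qak0 Qa0k.
have := Qamu; rewrite rootE pencil_det_map horner2C evB => /det0P[v0 v00 v0B].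
pose As := [seq map_mx rho (A i) | i <- enum 'I_n].
pose C := \sum_(i < n) w ^+ i *: map_mx rho (A i).
have AsC i j : map_mx rho (A i) *m map_mx rho (A j) = map_mx rho (A j) *m map_mx rho (A i).
  by rewrite -!map_mxM AC.
have AC' i : map_mx rho (A i) *m C = C *m map_mx rho (A i).
  rewrite mulmx_sumr mulmx_suml; apply: eq_bigr => j _.
  by rewrite -scalemxAr -scalemxAl AsC.
(* the small eigenvalue [mu] belongs to a common eigenvector *)
have [||| v [vn0 vC vA]] := @stable_common_eigenvector N m As
  [set v : 'rV[N]_m.+1 | v *m C = (rho delta * mu) *: v].
- move=> _ v c /mapP[i _ ->] /= vC.
  by rewrite mulmxBl -mulmxA AC' mulmxA vC -!scalemxAl vC scalerBr !scalerA [c * _]mulrC.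
- by move=> _ _ /mapP[i _ ->] /mapP[j _ ->].
- exists v0 => //=; apply/eqP; rewrite -mul_mx_scalar eq_sym -subr_eq0 -mulmxBr.
  by rewrite v0B.
have {vA} [eta vA] : exists eta : 'I_n -> N, forall i, v *m map_mx rho (A i) = eta i *: v.
  have h i : exists c, v *m map_mx rho (A i) = c *: v.
    by apply: vA; apply: map_f; rewrite mem_enum.
  by have [h1 h1P] := choice h; exists h1.
have eta_root i : eta i \in ys i.
  rewrite -root_prod_XsubC -ysP -eigenvalue_root_char.
  by apply/eigenvalueP; exists v.
pose y i := eta i / delta.[a].
exists y; split.
  have y_root : exists2 g : {ffun 'I_n -> 'I_m.+1}, g \in enum {ffun 'I_n -> 'I_m.+1} &
      cand g = poly_of_vec y.
    have lt_idx i : (index (eta i) (ys i) < m.+1)%N by rewrite -(size_ys i) index_mem.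
    exists [ffun i => Ordinal (lt_idx i)]; first by rewrite mem_enum.
    by apply: eq_bigr => i _; rewrite ffunE /= nth_index.
  have [g genum Dg] := y_root.
  have yw : (poly_of_vec y).[w] = mu.
    have vC2 : v *m C = (\sum_(i < n) w ^+ i * eta i) *: v.
      rewrite mulmx_sumr scaler_suml; apply: eq_bigr => i _.
      by rewrite -scalemxAr vA scalerA.
    have Deta : \sum_(i < n) w ^+ i * eta i = rho delta * mu.
      apply/eqP; rewrite -subr_eq0; apply: contraNT vn0 => d0.
      have : (\sum_(i < n) w ^+ i * eta i - rho delta * mu) *: v = 0.
        by rewrite scalerBl -vC2 -vC subrr.
      by move/eqP; rewrite scaler_eq0 (negPf d0).
    rewrite horner_poly_of_vec; apply: (mulfI da0); rewrite -[RHS]Deta mulr_sumr.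
    by apply: eq_bigr => i _; rewrite /y; field.
  move=> i; rewrite -(rmorph1 f); apply/vcmp_preimage => //.
  apply: vle_vcmp_trans mu_small => //; rewrite -yw -(coef_poly_of_vec y i) -Dg.
  by apply: wP; rewrite inE map_f ?orbT.
move=> g gx0.
have phiC c : phi c%:P = f c by rewrite eval_at_tE map_polyC hornerC.
have rhoC c : rho c%:P = c by rewrite /rho /= /horner_eval hornerC.
have T0 : relation_matrix delta A g = 0.
  apply: free; rewrite (map_relation_matrix _ _ _ phiC) mulmx_suml.
  under eq_bigr do rewrite -scalemxAl (col_eigen_prod _ _ Ae) scalerA.
  by rewrite -scaler_suml homogenization gx0 mulr0 scale0r.
have {}vA i : v *m map_mx rho (A i) = (rho delta * y i) *: v.
  by rewrite vA /y mulrCA divff // mulr1.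
have : v *m map_mx rho (relation_matrix delta A g) = 0 by rewrite T0 map_mx0 mulmx0.
rewrite (map_relation_matrix (s := idfun) _ _ _ rhoC) mulmx_sumr.
under eq_bigr do rewrite -scalemxAr (row_eigen_prod _ _ vA) scalerA.
rewrite -scaler_suml homogenization => /eqP.
rewrite scaler_eq0 (negPf vn0) orbF mulf_eq0 expf_eq0 (negPf da0) andbF => /eqP.
exact.
Qed.
End Specialization.

(** * Points over valued extensions *)
Lemma rmorph_mmap (R : nzRingType) (S T : comNzRingType) (h : {rmorphism S -> T})
    n (g : R -> S) (x : 'I_n -> S) (p : {mpoly R[n]}) :
  h (mmap g x p) = mmap (h \o g) (h \o x) p.
Proof.
rewrite /mmap rmorph_sum; apply: eq_bigr => k _; rewrite rmorphM rmorph_prod.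
by congr (_ * _); apply: eq_bigr => i _; rewrite rmorphXn.
Qed.

Lemma mpoly_mmap (R : comNzRingType) n (p : {mpoly R[n]}) :
  p = mmap (@mpolyC n R) (fun i => 'X_i) p.
Proof.
rewrite {1}[p]mpolyE; apply: eq_bigr => k _.
by rewrite -mul_mpolyC mpolyXE_id.
Qed.

Lemma algebraic_elt_clear (R : idomainType) (K M : fieldType)
    (phi : {rmorphism R -> M}) (j : {rmorphism K -> M}) x :
  injective phi -> (forall z, exists a b, b != 0 /\ j z = phi a / phi b) ->
  algebraicOver j x -> algebraic_elt phi x.
Proof.
move=> phi_inj jP [p p0 px].
have jP' z : exists ab : R * R, ab.2 != 0 /\ j z = phi ab.1 / phi ab.2.
  by have [a [b ab]] := jP z; exists (a, b).
have [ab abP] := choice jP'.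
pose c (k : 'I_(size p)) := (ab p`_k).2.
pose d := \prod_k c k.
have d0 : d != 0 by apply/prodf_neq0 => k _; case: (abP p`_k).
have phid0 : phi d != 0 by rewrite phi_eq0.
have coefP i : exists a, phi d * j p`_i = phi a.
  have [h|h] := ltnP i (size p); last first.
    by exists 0; rewrite nth_default // !rmorph0 mulr0.
  exists ((ab p`_i).1 * \prod_(k | k != Ordinal h) c k).
  have [b0 ->] := abP p`_i.
  rewrite /d (bigD1 (Ordinal h)) //= !rmorphM.
  by rewrite /c /=; field; rewrite phi_eq0.
have [a aP] := choice coefP.
pose q := \poly_(i < size p) a i.
have Dq : map_poly phi q = phi d *: map_poly j p.
  apply/polyP => i; rewrite coef_map coef_poly coefZ coef_map -[RHS]/(phi d * j p`_i).
  case: ltnP => h; first by rewrite [RHS]aP.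
  have -> : p`_i = 0 by exact: nth_default.
  by rewrite (rmorph0 j) mulr0; exact: rmorph0.
exists q; last by rewrite Dq rootZ.
have : map_poly phi q != 0 by rewrite Dq scaler_eq0 negb_or phid0 map_poly_eq0.
by apply: contra_neq => ->; rewrite map_poly0.
Qed.

Lemma transcendental_of_notin (N : closedFieldType) (M : fieldType) (f : {rmorphism N -> M}) t :
  ~ (exists c, f c = t) -> forall p : {poly N}, p != 0 -> (map_poly f p).[t] != 0.
Proof.
move=> nt p p0; have [rs Dp] := closed_field_poly_normal p.
rewrite Dp map_polyZ hornerZ mulf_neq0 ?fmorph_eq0 ?lead_coef_eq0 //.
rewrite rmorph_prod horner_prod prodf_seq_neq0; apply/allP => r _; apply/implyP => _ /=.
rewrite map_polyXsubC hornerXsubC subr_eq0; apply/eqP => tr.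
by apply: nt; exists r.
Qed.

(** Induction on the number of coordinates outside [N]. If [t] is such a
    coordinate, then the point is first moved into the algebraic closure of
    [N(t)] in [M], over which fewer coordinates are missing, and then into [N]. *)
Lemma descent (M : closedFieldType) (W : set M) b n (N : closedFieldType)
    (f : {rmorphism N -> M}) (x : 'I_n -> M) :
  valuation_ring W -> (exists2 u, u != 0 & vlt W (f u) 1) \/ W = setT ->
  (forall i, vcmp W b (x i) 1) ->
  exists y : 'I_n -> N, (forall i, vcmp W b (f (y i)) 1) /\
    forall g : {mpoly N[n]}, mmap f x g = 0 -> g.@[y] = 0.
Proof.
move=> vW nontriv xs.
pose out (N : closedFieldType) (f : {rmorphism N -> M}) :=
  [pred i | ~~ `[< exists c, f c = x i >]].
have [k] := ubnP #|out N f|; elim: k N f nontriv => // k IH N f nontriv le_k.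
have [[i0 ni0]|all_in] := pselect (exists i, ~ exists c, f c = x i); last first.
  have /choice[y Dy] i : exists c, f c = x i.
    by apply: contrapT => ni; apply: all_in; exists i.
  exists y; split=> [i|g]; first by rewrite Dy.
  have -> : x = f \o y by apply/funext => i; rewrite /= Dy.
  have -> : mmap f (f \o y) g = f g.@[y] by rewrite [RHS](rmorph_mmap f idfun).
  by move/eqP; rewrite fmorph_eq0 => /eqP.
pose t := x i0.
have tr := transcendental_of_notin ni0.
pose phi := eval_at_t f t.
have phi_inj : injective phi by exact: eval_at_t_inj.
pose E := [set z | exists p q, q != 0 /\ z = phi p / phi q].
have [||| K [j jP]] := @subfield_type M E.
- by exists 1, 1; rewrite oner_neq0 rmorph1 divr1.
- move=> _ _ [p [q [q0 ->]]] [p' [q' [q'0 ->]]].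
  exists (p * q' - p' * q), (q * q'); rewrite mulf_neq0 //; split=> //.
  by rewrite rmorphB !rmorphM; field; rewrite !phi_eq0 // q0 q'0.
- move=> _ _ [p [q [q0 ->]]] [p' [q' [q'0 ->]]].
  have [->|p'0] := eqVneq p' 0.
    by exists 0, 1; rewrite oner_neq0 !rmorph0 !mul0r invr0 mulr0.
  exists (p * q'), (q * p'); rewrite mulf_neq0 //; split=> //.
  by rewrite !rmorphM; field; rewrite !phi_eq0 // q0 q'0 p'0.
have [|N1 [i1 i1P]] := @relative_closure K M j.
  move=> p pm; have [rs Dp] := closed_field_poly_normal (map_poly j p).
  by exists rs; rewrite {1}Dp (monicP _) ?scale1r // monic_map.
have in_N1 z : E z -> exists w, i1 w = z.
  by move=> /jP[w <-]; apply/i1P/algebraic_id.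
have [kap kapP] : exists kap : {rmorphism N -> N1}, forall c, i1 (kap c) = f c.
  apply: rmorph_factor => c; apply: in_N1; exists c%:P, 1.
  rewrite oner_neq0 rmorph1 divr1; split=> //.
  by rewrite /phi eval_at_tE map_polyC hornerC.
have [||y1 [y1s y1P]] := IH N1 i1.
- case: nontriv => [[u u0 u1]|]; last by right.
  by left; exists (kap u); rewrite ?fmorph_eq0 // kapP.
- rewrite ltnS in le_k; apply: leq_trans le_k; apply: proper_card; apply/properP; split.
    apply/fintype.subsetP => i; rewrite !inE; apply: contraNN => /asboolP[c Dc].
    by apply/asboolP; exists (kap c); rewrite kapP.
  exists i0; first by rewrite inE; apply/asboolP.
  rewrite inE negbK; apply/asboolP; apply: in_N1; exists 'X, 1.
  rewrite oner_neq0 rmorph1 divr1; split=> //.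
  by rewrite /phi eval_at_tE map_polyX hornerX.
have alg i : algebraic_elt phi (i1 (y1 i)).
  apply: (algebraic_elt_clear phi_inj (j := j)); last by apply/i1P; exists (y1 i).
  by move=> z; apply/jP; exists z.
have [y [ys yP]] := specialize vW nontriv tr alg y1s.
exists y; split=> // g gx; apply: yP.
have -> : mmap f (fun i => i1 (y1 i)) g = i1 (mmap kap y1 g).
  rewrite (rmorph_mmap i1); congr (mmap _ _ g).
  by apply/funext => c /=; rewrite kapP.
pose g1 : {mpoly N1[n]} := map_mpoly kap g.
have Dg1 (T : comNzRingType) (h : {rmorphism N1 -> T}) (z : 'I_n -> T) :
    mmap h z g1 = mmap (h \o kap) z g.
  have -> : g1 = mmap (@mpolyC n N1 \o kap) (fun i => 'X_i) g by [].
  rewrite (rmorph_mmap (mmap h z)); congr (mmap _ _ g).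
    by apply/funext => c; rewrite /= mmapC.
  by apply/funext => i; rewrite /= mmapX mmap1U.
have := y1P g1; rewrite Dg1.
have -> : mmap (i1 \o kap) x g = mmap f x g.
  by congr (mmap _ _ g); apply/funext => c /=; rewrite kapP.
rewrite gx => /(_ erefl) g1y.
have -> : mmap kap y1 g = g1.@[y1] by rewrite [RHS]Dg1.
by rewrite g1y rmorph0.
Qed.

(** * Systems whose consequences have zeros *)
(** The two shapes that the fibre over [1] can have: all units of a valuation
    ring, or the units congruent to [1]. *)
Definition units_of_shape (F : fieldType) (O U : set F) (all_units : bool) : Prop :=
  if all_units then forall x, U x <-> vle O x 1 /\ vle O 1 x
  else forall x, U x <-> vlt O (x - 1) 1.


Lemma mmap_subst (R T : comNzRingType) n k (s : {rmorphism R -> T}) (z : 'I_k -> T)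
    (h : 'I_n -> {mpoly R[k]}) (p : {mpoly R[n]}) :
  mmap s z (mmap (@mpolyC k R) h p) = mmap s (fun i => mmap s z (h i)) p.
Proof.
rewrite (rmorph_mmap (mmap s z)); congr (mmap _ _ p).
by apply/funext => c; rewrite /= mmapC.
Qed.

(** The polynomials without zeros in [P] are invertible modulo a prime ideal
    that avoids them. The fractions with integral values on [P] form a subring
    of the residue field, and those with values in the maximal ideal form a
    proper ideal of it: a fraction [p / s] equal to [1] there would put [p - s],
    which has no zero in [P], into the prime ideal. *)
Lemma valued_extension (F : closedFieldType) (O : set F) n (P : set ('I_n -> F))
    (I : set {mpoly F[n]}) :
  valuation_ring O -> ideal I -> (forall p, I p -> exists2 y, P y & p.@[y] = 0) ->
  exists (M : closedFieldType) (W : set M) (psi : {rmorphism {mpoly F[n]} -> M}),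
    [/\ valuation_ring W, [set c | W (psi c%:MP)] = O,
        forall p, I p -> psi p = 0,
        forall s, (forall y, P y -> s.@[y] != 0) -> psi s != 0 &
        forall b p s, (forall y, P y -> s.@[y] != 0) ->
          (forall y, P y -> vcmp O b p.@[y] s.@[y]) -> vcmp W b (psi p) (psi s)].
Proof.
move=> vO Iid Izero.
pose S := [set s : {mpoly F[n]} | forall y, P y -> s.@[y] != 0].
have SM p q : S p -> S q -> S (p * q).
  by move=> Sp Sq y Py; rewrite mevalM mulf_neq0 ?Sp ?Sq.
have S1 : S 1 by move=> y _; rewrite meval1 oner_neq0.
have [|Q [Qpr IQ QS]] := @prime_ideal_avoiding _ I S Iid S1 SM.
  by move=> p /Izero[y Py py] /(_ y Py); rewrite py eqxx.
have [K [phi phi0]] := prime_ideal_residue_field Qpr.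
have [M [g _]] := algebraic_closure_exists K.
pose psi : {rmorphism {mpoly F[n]} -> M} := g \o phi.
have psi0 p : psi p = 0 <-> Q p.
  apply: iff_trans (phi0 p); split=> [/eqP|e]; first by rewrite /psi /= fmorph_eq0 => /eqP.
  by rewrite /psi /= e rmorph0.
have psiS s : S s -> psi s != 0 by move=> Ss; apply/eqP => /psi0/QS.
pose fr b := [set z | exists p s, [/\ S s, z = psi p / psi s &
  forall y, P y -> vcmp O b p.@[y] s.@[y]]].
have fr1 : fr false 1.
  exists 1, 1; split=> //; first by rewrite rmorph1 divr1.
  by move=> y _; apply: vle_refl.
have frB b y z : fr b y -> fr b z -> fr b (y - z).
  move=> [p [s [Ss -> ps]]] [q [r [Sr -> qr]]].
  have [s0 r0] := (psiS s Ss, psiS r Sr).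
  exists (p * r - q * s), (s * r); split; first exact: SM.
    by rewrite rmorphB !rmorphM; field; rewrite ?s0 ?r0.
  move=> u Pu; rewrite mevalB !mevalM; apply: vcmpD => //.
    by rewrite ![_ * r.@[u]]mulrC; apply/vcmpMl; [|apply: Sr|apply: ps].
  apply: vcmpN => //; rewrite [q.@[u] * _]mulrC.
  by apply/vcmpMl; [|apply: Ss|apply: qr].
have frM b y z : fr b y -> fr false z -> fr b (y * z).
  move=> [p [s [Ss -> ps]]] [q [r [Sr -> qr]]].
  have [s0 r0] := (psiS s Ss, psiS r Sr).
  exists (p * q), (s * r); split; first exact: SM.
    by rewrite !rmorphM; field; rewrite ?s0 ?r0.
  move=> u Pu; rewrite !mevalM; apply: (@vle_vcmp_trans _ _ vO _ _ (p.@[u] * r.@[u])).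
    by apply: vleMl => //; apply: qr.
  by rewrite ![_ * r.@[u]]mulrC; apply/vcmpMl; [|apply: Sr|apply: ps].
have fr0 b : fr b 0.
  exists 0, 1; split=> //; first by rewrite rmorph0 mul0r.
  by move=> y _; rewrite meval0 meval1; apply: vcmp0 => //; apply: oner_neq0.
have nofr1 : ~ fr true 1.
  move=> [p [s [Ss e ps]]].
  have Qps : Q (p - s).
    apply/psi0; rewrite rmorphB; apply/eqP; rewrite subr_eq0; apply/eqP.
    by rewrite -[LHS](divfK (psiS s Ss)) -e mul1r.
  apply: (QS _ Qps) => y Py; rewrite mevalB subr_eq0; apply/eqP => e'.
  by apply: (ps y Py); rewrite e'; apply: vle_refl.
have [|||W [vW frW trW]] := @dominating_valuation_ring M (fr false) (fr true).
- by split; [exact: fr1|exact: frB|exact: frM].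
- move=> z [p [s [Ss -> ps]]]; exists p, s; split=> // y Py.
  by apply: vltW => //; apply: ps.
- suff sp z : ideal_span (fr true) (fr false) z -> fr true z by move/sp/nofr1.
  elim=> [|a w y fa fw _ fy]; first exact: fr0.
  by rewrite -[y]opprK -[X in _ - X]sub0r; apply: (frB) (frM _ _ _ fa fw) (frB _ _ _ (fr0 _) fy).
exists M, W, psi; split=> //.
- apply/seteqP; split=> c /=; last first.
    move=> Oc; apply: frW; exists c%:MP, 1; split=> //; first by rewrite rmorph1 divr1.
    by move=> y _; rewrite mevalC meval1; apply/vle1.
  move=> Wc; apply: contrapT => nOc.
  have c0 : c != 0 by apply/eqP => c0; apply: nOc; rewrite c0; apply: val_ring0.
  apply: (trW (psi (c^-1)%:MP)); last first.
    by exists (psi c%:MP) => //; rewrite -rmorphM -mpolyCM mulfV // rmorph1.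
  exists (c^-1)%:MP, 1; split=> //; first by rewrite rmorph1 divr1.
  move=> y _; rewrite mevalC meval1 => -[w Ow e]; apply: nOc.
  suff -> : c = w by [].
  by rewrite -[w](mulfVK c0) -e mul1r.
- by move=> p /IQ/psi0.
- move=> b p s Ss ps; have ps0 := psiS s Ss.
  have : fr b (psi p / psi s) by exists p, s.
  have -> : vcmp W b (psi p) (psi s) <-> vcmp W b (psi p / psi s) 1.
    by rewrite -(vcmpMl vW b (psi p / psi s) 1 ps0) mulrC divfK // mulr1.
  by case: b {ps} => [/trW|/frW]//= /vle1.
Qed.

(** The conditions that define [U^n] are transported to [M] and back as strict or
    large inequalities: the point [x - 1] is small in one case, and the points
    [x] and [x^-1] are integral in the other. *)
Lemma common_zero (F : closedFieldType) (O U : set F) (sh : bool) n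
    (I : set {mpoly F[n]}) :
  valuation_ring O -> units_of_shape O U sh -> ideal I ->
  (forall p, I p -> exists2 y : 'I_n -> F, forall i, U (y i) & p.@[y] = 0) ->
  exists2 y : 'I_n -> F, forall i, U (y i) & forall p, I p -> p.@[y] = 0.
Proof.
move=> vO shU Iid Izero.
have Ocmp (M : fieldType) (W : set M) (f : {rmorphism F -> M}) b c :
    valuation_ring W -> f @^-1` W = O -> vcmp W b (f c) 1 <-> vcmp O b c 1.
  by move=> vW <-; rewrite -{1}(rmorph1 f); apply: vcmp_preimage.
have triv_or : (forall u, u != 0 -> ~ vlt O u 1) \/ (exists2 u, u != 0 & vlt O u 1).
  have [?|no] := pselect (exists2 u, u != 0 & vlt O u 1); [by right|left].
  by move=> u un0 u1; apply: no; exists u.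
have [M [W [psi [vW WO psiI psiS psicmp]]]] := valued_extension vO Iid Izero.
pose f : {rmorphism F -> M} := psi \o @mpolyC n F.
have fE c : f c = psi c%:MP by [].
pose x i := psi 'X_i.
have psiE p : psi p = mmap f x p by rewrite {1}[p]mpoly_mmap rmorph_mmap.
case: sh shU => shU; last first.
  case: triv_or => [triv|[u u0 u1]].
    exists (fun=> 1) => [i|p /Izero[y yU py]].
      by apply/shU; rewrite subrr; apply: (@vcmp0 _ _ vO true); apply: oner_neq0.
    rewrite -py; congr meval; apply/funext => i; apply/esym/eqP.
    by rewrite -subr_eq0; apply: contrapT => /negP/triv; apply; apply/shU.
  have [||y [ys yP]] := @descent M W true n F f (fun i => x i - 1) vW.
  - by left; exists u => //; apply/(Ocmp _ _ f true u vW WO).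
  - move=> i; have := psicmp true ('X_i - 1) 1; rewrite rmorphB rmorph1; apply.
      by move=> z _; rewrite meval1 oner_neq0.
    by move=> z zU; rewrite mevalB mevalXU meval1; apply/shU.
  exists (fun i => y i + 1) => [i|p Ip].
    by apply/shU; rewrite addrK; apply/(Ocmp _ _ f true (y i) vW WO).
  pose g := mmap (@mpolyC n F) (fun i => 'X_i + 1) p.
  have : g.@[y] = 0.
    apply: yP; rewrite /g mmap_subst -(psiI p Ip) psiE; congr (mmap _ _ p).
    by apply/funext => i; rewrite rmorphD rmorph1 /= mmapX mmap1U subrK.
  rewrite /g /meval mmap_subst => <-; congr (mmap _ _ p).
  by apply/funext => i; rewrite rmorphD rmorph1 /= mmapX mmap1U.
have shU' y : U y <-> y != 0 /\ vle O y 1 /\ vle O y^-1 1.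
  apply: (iff_trans (shU y)); split=> [[y1 [w Ow e]]|[y0 [y1 [w Ow e]]]].
    have y0 : y != 0 by apply: contra_eq_neq e => ->; rewrite mulr0 oner_neq0.
    split=> //; split=> //; exists w => //; rewrite mulr1.
    by apply: (mulIf y0); rewrite mulVf.
  split=> //; exists w => //.
  by rewrite -(mulVf y0) e mulr1.
have xX i : x i != 0 /\
    (forall y : 'I_n -> F, (forall i, U (y i)) -> ('X_i : {mpoly F[n]}).@[y] != 0).
  split=> [|y yU]; last by rewrite mevalXU; case/shU': (yU i).
  by apply: psiS => y yU; rewrite mevalXU; case/shU': (yU i).
(* for the trivial valuation the extension has to be trivial too *)
have [W' [vW' W'O nontriv xW' xVW']] : exists W', [/\ valuation_ring W', f @^-1` W' = O,
    (exists2 u, u != 0 & vlt W' (f u) 1) \/ W' = setT,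
    forall i, vle W' (x i) 1 & forall i, vle W' (x i)^-1 1].
  case: triv_or => [triv|[u u0 u1]].
    exists setT; split; first by split=> // *; left.
    - rewrite preimage_setT; apply/esym/seteqP; split=> // c _.
      apply: contrapT => nc.
      have c0 : c != 0 by apply/eqP => c0; apply: nc; rewrite c0; apply: val_ring0.
      apply: (triv c^-1); rewrite ?invr_eq0 // => -[w Ow e]; apply: nc.
      by rewrite -[c]mul1r e -mulrA mulVf // mulr1.
    - by right.
    - by move=> i; apply/vle1.
    - by move=> i; apply/vle1.
  exists W; split=> //.
  - by left; exists u => //; apply/(Ocmp _ _ f true u vW WO).
  - move=> i; have := psicmp false 'X_i 1; rewrite rmorph1; apply.
      by move=> z _; rewrite meval1 oner_neq0.
    by move=> z zU; rewrite mevalXU meval1; case/shU': (zU i) => _ [].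
  - move=> i; have [x0 X0] := xX i.
    have [w Ww e] : vle W (psi 1) (psi 'X_i).
      apply: (psicmp false) => // z zU; rewrite mevalXU meval1.
      have [z0 [_ [w Ow e]]] : z i != 0 /\ vle O (z i) 1 /\ vle O (z i)^-1 1 by apply/shU'.
      by exists w => //; rewrite -(mulVf z0) e mulr1.
    exists w => //; rewrite mulr1; apply: (mulIf x0).
    by rewrite mulVf // -e rmorph1.
(* the inverses are further coordinates, tied to [x] by polynomial relations *)
pose xx (k : 'I_(n + n)) := match fintype.split k with inl i => x i | inr i => (x i)^-1 end.
have xxl i : xx (lshift n i) = x i by rewrite /xx (unsplitK (inl i)).
have xxr i : xx (rshift n i) = (x i)^-1 by rewrite /xx (unsplitK (inr i)).
have [|y [ys yP]] := @descent M W' false (n + n) F f xx vW' nontriv.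
  by move=> k; rewrite /xx; case: (fintype.split k) => i /=; [apply: xW'|apply: xVW'].
have inv i : y (lshift n i) * y (rshift n i) = 1.
  have := yP ('X_(lshift n i) * 'X_(rshift n i) - 1).
  rewrite rmorphB rmorphM rmorph1 /= !mmapX !mmap1U xxl xxr mulfV ?(xX i).1 // subrr.
  move=> /(_ erefl)/eqP; rewrite mevalB mevalM !mevalXU meval1 subr_eq0 => /eqP.
  by [].
have y0 i : y (lshift n i) != 0.
  by apply: contra_eq_neq (inv i) => ->; rewrite mul0r eq_sym oner_neq0.
have yV i : (y (lshift n i))^-1 = y (rshift n i).
  by apply: (mulfI (y0 i)); rewrite divff // inv.
exists (fun i => y (lshift n i)) => [i|p Ip].
  apply/shU'; split=> //; rewrite yV.
  split; apply/(Ocmp _ _ f false _ vW' W'O); exact: ys.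
pose g := mmap (@mpolyC (n + n) F) (fun i => 'X_(lshift n i)) p.
have : g.@[y] = 0.
  apply: yP; rewrite /g mmap_subst -(psiI p Ip) psiE; congr (mmap _ _ p).
  by apply/funext => i; rewrite /= mmapX mmap1U xxl.
rewrite /g /meval mmap_subst => <-; congr (mmap _ _ p).
by apply/funext => i; rewrite /= mmapX mmap1U.
Qed.

(** * The fibre over one *)
(** If [U] is the fibre over [1], then the hypothesis makes [1] a root of the
    push-forward of [p], and the conclusion is that this root lifts. *)
Definition root_lifting (F : fieldType) (U : set F) : Prop :=
  forall (p : {poly F}) (u : nat -> F), (forall i, U (u i)) ->
    \sum_(i < size p) p`_i * u i = 0 -> exists2 w, U w & root p w.

Lemma quadratic_roots (F : comNzRingType) (r s : F) :
  ('X - r%:P) * ('X - s%:P) = 'X^2 - (r + s) *: 'X + (r * s)%:P.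
Proof. by rewrite -mul_polyC polyCD polyCM; ring. Qed.

Section Shape.
Variables (F : fieldType) (U : set F).
Hypotheses (U1 : U 1) (U0 : ~ U 0).
Hypothesis UM : forall x y, U x -> U y -> U (x * y).
Hypothesis UV : forall x, U x -> U x^-1.
Hypothesis Url : root_lifting U.

Let Uneq0 x : U x -> x != 0.
Proof. by move=> Ux; apply/eqP => x0; rewrite x0 in Ux. Qed.

Let Udiv x y : U x -> U y -> U (x / y).
Proof. by move=> Ux Uy; apply: UM => //; apply: UV. Qed.

(** Seen from a point outside, [U] is a ball: the quadratic with roots [s] and
    [r = (u - s) / (1 - s / v)] has a root in [U], and that can only be [r]. *)
Lemma ball_from_outside s u v : ~ U s -> U u -> U v -> U ((s - u) / (s - v)).
Proof.
move=> ns Uu Uv.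
have v0 := Uneq0 Uv.
have sv : s - v != 0 by rewrite subr_eq0; apply: contra_notN ns => /eqP ->.
pose r := v * ((s - u) / (s - v)).
suff Ur : U r by rewrite -[X in U X](mulKf v0); apply: UM => //; apply: UV.
pose p := ('X - r%:P) * ('X - s%:P).
pose c (i : nat) := if i == 0%N then v^-1 else if i == 1%N then 1 else u.
have sp : size p = 3 by rewrite size_Mmonic ?polyXsubC_eq0 ?monicXsubC // !size_XsubC.
have Dp : p = 'X^2 - (r + s) *: 'X + (r * s)%:P.
  exact: quadratic_roots.
have [||w Uw] := Url (p := p) (u := c).
- by move=> i; rewrite /c; case: eqP => _; [apply: UV|case: eqP].
- rewrite sp !big_ord_recl big_ord0 Dp !coefD !coefN !coefZ !coefXn !coefX !coefC /c /=.
  by rewrite /r; field; rewrite sv.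
rewrite rootM !root_XsubC => /orP[] /eqP e; first by rewrite e in Uw.
by rewrite e in Uw.
Qed.

Section LargeU.
Variable u0 : F.
Hypotheses (Uu0 : U u0) (U1u0 : U (1 - u0)).

Let UN1 : U (- 1).
Proof.
(* otherwise [U] is closed under addition; but the roots of [X^2 - X + 1] have
   cube [-1] *)
apply: contrapT => n1.
have add1 u : U u -> U (1 + u).
  move=> Uu; have u00 := Uneq0 Uu0.
  have h := ball_from_outside n1 Uu (Udiv U1u0 Uu0).
  have -> : 1 + u = (-1 - u) / (-1 - (1 - u0) / u0) / u0.
    have -> : -1 - (1 - u0) / u0 = - u0^-1 by field.
    by rewrite invrN invrK; field.
  exact: Udiv.
have U2 : U (1 + 1) by apply: add1.
pose p : {poly F} := 'X^2 - 'X + 1.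
have sp : size p = 3.
  rewrite /p -addrA size_polyDl size_polyXn //.
  by rewrite (leq_ltn_trans (size_polyD _ _)) // size_polyN size_polyX size_poly1.
have [||w Uw pw] := Url (p := p) (u := fun i => if i == 1%N then 1 + 1 else 1).
- by move=> i; case: eqP.
- rewrite sp !big_ord_recl big_ord0 !coefD !coefN !coefXn !coefX !coef1 /=; ring.
apply: n1; have -> : -1 = w * (w * w).
  have e : w ^+ 2 - w + 1 = 0 by apply/eqP; move: pw; rewrite rootE !hornerE.
  have : (w + 1) * (w ^+ 2 - w + 1) = 0 by rewrite e mulr0.
  move=> e'; transitivity ((w + 1) * (w ^+ 2 - w + 1) - 1); last by ring.
  by rewrite e' sub0r.
by apply: UM => //; apply: UM.
Qed.

Let UN x : U x -> U (- x).
Proof. by move=> Ux; rewrite -mulN1r; apply: UM. Qed.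

Let outside_add x u v : ~ U x -> U u -> U v -> U (x + v) -> U (x + u).
Proof.
move=> nx Uu Uv Uxv; have := ball_from_outside nx (UN Uu) (UN Uv).
rewrite !opprK => h; rewrite -(divfK (Uneq0 Uxv) (x + u)); exact: UM.
Qed.

(** The elements of the maximal ideal: what [U] absorbs under addition. *)
Let small x := ~ U x /\ U (x + 1).

Let small_add x u : small x -> U u -> U (x + u).
Proof. by move=> [nx x1] Uu; apply: (outside_add nx Uu U1). Qed.

Let small_mul x u : small x -> U u -> small (x * u).
Proof.
move=> sx Uu; have u00 := Uneq0 Uu; split.
  by move=> h; apply: sx.1; rewrite -(mulfK u00 x); apply: Udiv.
have -> : x * u + 1 = u * (x + u^-1) by field.
by apply: UM => //; apply: small_add => //; apply: UV.
Qed.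

Let ring_of x := U x \/ small x.

Let ring_ofN x : ring_of x -> ring_of (- x).
Proof.
by case=> h; [left; apply: UN|right; rewrite -mulrN1; apply: small_mul].
Qed.

Let ring_ofD x y : ring_of x -> ring_of y -> ring_of (x + y).
Proof.
move=> [Ux|sx] [Uy|sy].
- have [|n] := pselect (U (x + y)); [by left|right; split=> //].
  by apply: (outside_add n U1 (UN Ux)); rewrite addrAC subrr add0r.
- by left; rewrite addrC; apply: small_add.
- by left; apply: small_add.
have [|n] := pselect (U (x + y)); [by left|right; split=> //].
by rewrite -addrA; apply: small_add => //; case: sy.
Qed.

Let ring_ofM x y : ring_of x -> ring_of y -> ring_of (x * y).
Proof.
move=> [Ux|sx] [Uy|sy].
- by left; apply: UM.
- by right; rewrite mulrC; apply: small_mul.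
- by right; apply: small_mul.
have [|n] := pselect (U (x * y)); [by left|right; split=> //].
have smallN z : small z -> small (- z) by rewrite -mulrN1 => sz; apply: small_mul.
have -> : x * y + 1 = - y + (- x + (x + 1) * (y + 1)) by ring.
apply: small_add (smallN _ sy) _; apply: small_add (smallN _ sx) _.
by apply: UM; [case: sx|case: sy].
Qed.

Let ring_ofV x : ring_of x \/ ring_of x^-1.
Proof.
have [Ux|nx] := pselect (U x); first by left; left.
have [U1x|n1x] := pselect (U (x + 1)); first by left; right.
have x0 : x != 0 by apply/eqP => x0; apply: n1x; rewrite x0 add0r.
right; right; split; first by move=> /UV; rewrite invrK.
have h1 := ball_from_outside n1x Uu0 U1.
have h2 := ball_from_outside nx (UN U1) (UN U1u0).
rewrite addrK in h1; rewrite !opprK in h2.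
have xu0 : x + (1 - u0) != 0.
  by apply/eqP => e; apply: U0; move: h1; rewrite -addrA e mul0r.
have -> : x^-1 + 1 = (x + 1) / (x + (1 - u0)) * ((x + 1 - u0) / x).
  by field; rewrite x0 addrA -addrA xu0.
exact: UM.
Qed.

(** If [1] is a sum of two elements of [U], then every element lies in [U], is
    absorbed by [U] under addition, or is the inverse of an absorbed one. *)
Lemma unit_group_of_valuation_ring : exists O, valuation_ring O /\
  forall x, U x <-> vle O x 1 /\ vle O 1 x.
Proof.
exists ring_of; split.
  split=> [|x y rx ry||].
  - by left.
  - by apply: ring_ofD => //; apply: ring_ofN.
  - exact: ring_ofM.
  - exact: ring_ofV.
move=> x; split=> [Ux|[[w rw ->]]].
  split; first by exists x; rewrite ?mulr1 //; left.
  by exists x^-1; [left; apply: UV|rewrite mulVf // Uneq0].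
rewrite mulr1 => -[v rv e].
have w0 : w != 0 by apply: contra_eq_neq e => ->; rewrite mulr0 oner_neq0.
have Dv : v = w^-1 by rewrite -[LHS](mulfK w0) -e mul1r.
case: rw => // -[nw w1]; case: rv => [Uv|[nv v1]].
  by rewrite -(invrK w) -Dv; apply: UV.
have -> : w = (w + 1) / (v + 1).
  apply: (mulIf (Uneq0 v1)); rewrite divfK ?Uneq0 //.
  by rewrite Dv mulrDr mulfV // mulr1 addrC.
exact: Udiv.
Qed.
End LargeU.

Section SmallU.
Hypothesis no_split : forall u, U u -> ~ U (1 - u).

Let add_dev u v : U u -> U v -> U (u + v - 1).
Proof.
move=> Uu Uv; have u_n0 := Uneq0 Uu.
have h := ball_from_outside (no_split Uu) Uv U1.
have -> : u + v - 1 = (1 - u - v) / (1 - u - 1) * u.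
  have -> : 1 - u - 1 = - u by ring.
  by rewrite invrN; field.
exact: UM.
Qed.

Let opp_dev u : U u -> U (2 - u).
Proof.
move=> Uu; have u_n0 := Uneq0 Uu.
have [h|n] := pselect (U (u - 1)).
  case: (no_split (Udiv h Uu)).
  have -> : 1 - (u - 1) / u = u^-1 by field.
  exact: UV.
have h := ball_from_outside n U1 Uu.
have e : u - 1 - u = -1 by ring.
have -> : 2 - u = (u - 1 - 1) / (u - 1 - u) by rewrite e invrN invr1; ring.
exact: h.
Qed.

(** The differences [u - 1] form the maximal ideal; these are its multipliers. *)
Let dev_ring x := forall u, U u -> U (1 + x * (u - 1)).

Let dev_ringV x : dev_ring x \/ dev_ring x^-1.
Proof.
have [|n] := pselect (dev_ring x); [by left|right].
have [u Uu nu] : exists2 u, U u & ~ U (1 + x * (u - 1)).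
  by apply: contrapT => no; apply: n => u Uu; apply: contrapT => nu; apply: no; exists u.
have y0 : x * (u - 1) != 0.
  by apply/eqP => e; apply: nu; rewrite e addr0.
have [x0 u10] : x != 0 /\ u - 1 != 0.
  by move: y0; rewrite mulf_eq0 negb_or => /andP.
move=> v Uv.
have Uw : U (v * (2 - u) + (2 - v) - 1 + u - 1).
  by apply: add_dev => //; apply: add_dev; [apply: UM => //; apply: opp_dev|apply: opp_dev].
have := ball_from_outside nu Uw U1.
suff -> : (1 + x * (u - 1) - (v * (2 - u) + (2 - v) - 1 + u - 1)) /
  (1 + x * (u - 1) - 1) = 1 + x^-1 * (v - 1) by [].
have -> : 1 + x * (u - 1) - 1 = x * (u - 1) by ring.
by field; rewrite x0 u10.
Qed.

(** Otherwise [ball_from_outside] makes the differences [u - 1] an additive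
    group; from [x] outside its ring of multipliers, [U] is seen as a ball
    around [1] small enough for [x^-1] to be a multiplier. *)
Lemma principal_units_of_valuation_ring : exists O, valuation_ring O /\
  forall x, U x <-> vlt O (x - 1) 1.
Proof.
have dev1 : dev_ring 1 by move=> u Uu; rewrite mul1r addrC subrK.
exists dev_ring; split.
  split=> // [x y dx dy u Uu|x y dx dy u Uu].
  - have := add_dev (dx u Uu) (opp_dev (dy u Uu)).
    by suff -> : 1 + x * (u - 1) + (2 - (1 + y * (u - 1))) - 1 = 1 + (x - y) * (u - 1) by []; ring.
  - have := dx _ (dy u Uu).
    by suff -> : 1 + x * (1 + y * (u - 1) - 1) = 1 + x * y * (u - 1) by []; ring.
move=> x; split=> [Ux [w dw e]|h].
  have U2 : U (1 + 1) by have := dw x Ux; rewrite -e.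
  have n2 := Uneq0 U2.
  apply: (no_split (UV U2)).
  have -> : 1 - (1 + 1)^-1 = (1 + 1 : F)^-1 by field.
  exact: UV.
apply: contrapT => nx; apply: h.
have x1 : x - 1 != 0 by rewrite subr_eq0; apply: contra_notN nx => /eqP ->.
exists (x - 1)^-1; last by rewrite mulVf.
move=> v Uv; have := ball_from_outside nx (opp_dev Uv) U1.
by suff -> : (x - (2 - v)) / (x - 1) = 1 + (x - 1)^-1 * (v - 1) by []; field.
Qed.
End SmallU.

Lemma root_lifting_shape : exists O sh, valuation_ring O /\ units_of_shape O U sh.
Proof.
have [[u [Uu U1u]]|no] := pselect (exists u, U u /\ U (1 - u)).
  by have [O [vO OU]] := unit_group_of_valuation_ring Uu U1u; exists O, true.
have [|O [vO OU]] := principal_units_of_valuation_ring; last by exists O, false.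
by move=> u Uu U1u; apply: no; exists u.
Qed.
End Shape.

(** * Hypersums of images *)
Section Hypersums.
Variable H : hyperfieldType.
Implicit Types (A B C : set H).

Let hplus : set H -> set H -> set H := setwise (@hadd H).

Lemma setwise_haddC : commutative hplus.
Proof.
move=> A B; apply/seteqP; split=> x [a Aa [b Bb abx]]; exists b => //; exists a => //;
  by rewrite haddC.
Qed.

Lemma setwise_haddA : associative hplus.
Proof.
move=> A B C; apply/seteqP; split=> x.
  move=> [a Aa [y [b Bb [c Cc bcy]] ayx]].
  have : setwise (@hadd H) [set a] (hadd b c) x by exists a => //; exists y.
  rewrite -haddA => -[z abz [_ -> zcx]].
  by exists z; [exists a => //; exists b|exists c].
move=> [y [a Aa [b Bb aby]] [c Cc ycx]].
have : setwise (@hadd H) (hadd a b) [set c] x by exists y => //; exists c.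
rewrite haddA => -[_ -> [z bcz azx]].
by exists a => //; exists z => //; exists b => //; exists c.
Qed.

Lemma setwise_hadd0 : left_id [set h0] hplus.
Proof.
move=> A; apply/seteqP; split=> x.
  by move=> [_ -> [a Aa]]; rewrite hadd0 => ->.
by move=> Ax; exists h0 => //; exists x => //; rewrite hadd0.
Qed.

HB.instance Definition _ := Monoid.isComLaw.Build (set H) [set h0] hplus
  setwise_haddA setwise_haddC setwise_hadd0.

Definition hypersum (T : Type) (s : seq T) (F : T -> H) : set H :=
  \big[hplus/[set h0]]_(d <- s) [set F d].

Lemma hsum_hypersum (T : Type) (s : seq T) (F : T -> H) :
  hsum [seq F d | d <- s] = hypersum s F.
Proof.
rewrite /hypersum; elim: s => [|d s IH]; first by rewrite big_nil.
by rewrite big_cons /= IH.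
Qed.

Lemma heval_hypersum (M : choiceType) (mon : M -> H) (p : hexpr M H) (s : seq M) :
  uniq s -> {subset finsupp p <= s} ->
  heval mon p = hypersum s (fun d => hmul (p d) (mon d)).
Proof.
move=> us sub; rewrite /heval hsum_hypersum /hypersum.
rewrite [RHS](bigID (mem (finsupp p))) /= [X in hplus _ X]big1; last first.
  by move=> d; rewrite memNfinsupp => /eqP ->; rewrite hmul0.
rewrite [RHS]Monoid.mulm1 -[RHS]big_filter; apply: perm_big.
apply: uniq_perm; rewrite ?filter_uniq ?fset_uniq // => d.
by rewrite mem_filter; case: (boolP (d \in finsupp p)) => //= /sub ->.
Qed.

End Hypersums.

Section FieldHom.
Variables (F : fieldType) (H : hyperfieldType) (f : hyperfield_of F -> H).
Hypothesis fhom : hyperfield_hom f.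

Lemma hom_hypersum (T : Type) (s : seq T) (z : T -> F) :
  hypersum s (fun d => f (z d)) (f (\sum_(d <- s) z d)).
Proof.
rewrite /hypersum; elim: s => [|d s IH]; first by rewrite !big_nil; exact: (hom_0 fhom).
rewrite !big_cons; exists (f (z d)) => //; exists (f (\sum_(d <- s) z d)) => //.
by apply: (hom_add fhom); exists (z d + \sum_(d <- s) z d).
Qed.

Lemma hypersum_field (T : Type) (s : seq T) (z : T -> F) :
  hypersum (H := hyperfield_of F) s z = [set (\sum_(d <- s) z d : hyperfield_of F)].
Proof.
rewrite /hypersum; elim: s => [|d s IH]; first by rewrite !big_nil.
rewrite !big_cons IH; apply/seteqP; split=> x.
  by move=> [_ -> [_ -> ->]].
by move=> ->; exists (z d) => //; eexists; last reflexivity.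
Qed.

Lemma hom_eq0 x : f x = h0 -> x = 0.
Proof.
move=> fx; apply/eqP; apply: contraT => x0.
have := hom_mul fhom x x^-1; rewrite fx hmul0.
have -> : hmul (x : hyperfield_of F) x^-1 = h1 by exact: mulfV.
by rewrite (hom_1 fhom) => /eqP; rewrite (negPf (@h1_neq0 H)).
Qed.

Lemma hom_neq0 x : x != 0 -> f x != h0.
Proof. by apply: contra_neq; apply: hom_eq0. Qed.

Lemma hom_hexp (x : hyperfield_of F) k : f (hexp x k) = hexp (f x) k.
Proof.
elim: k => [|k IH]; first exact: (hom_1 fhom).
by rewrite /hexp /= (hom_mul fhom) -[iter k _ _]/(hexp x k) IH.
Qed.

Lemma hom_hinv (x : F) : x != 0 -> f x^-1 = hinv (f x).
Proof.
move=> x0; have fx0 := hom_neq0 x0; have iv0 := hinv_neq0 _ fx0.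
have fV0 : f x^-1 != h0 by apply: hom_neq0; rewrite invr_eq0.
have e : hmul (f x^-1) (f x) = h1.
  by rewrite -(hom_mul fhom) -(hom_1 fhom); congr f; exact: mulVf.
rewrite -[LHS]hmul1 // -(hmulV _ fx0) -hmulA //.
by rewrite [hmul (f x) _]hmulC // e hmulC ?hmul1 // h1_neq0.
Qed.

Lemma hom_hexpz (x : hyperfield_of F) k : x != h0 -> f (hexpz x k) = hexpz (f x) k.
Proof.
move=> x0; case: k => k; first exact: hom_hexp.
by rewrite /= (hom_hexp _ k.+1) (hom_hinv x0).
Qed.

Lemma hom_prod (I : Type) (s : seq I) (z : I -> F) :
  f (\prod_(i <- s) z i) = \big[@hmul H/h1]_(i <- s) f (z i).
Proof.
elim: s => [|i s IH]; first by rewrite !big_nil; exact: (hom_1 fhom).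
by rewrite !big_cons (hom_mul fhom) IH.
Qed.

Lemma hexp_field (x : F) k : hexp (x : hyperfield_of F) k = x ^+ k.
Proof. by elim: k => // k IH; rewrite exprS -IH. Qed.

Lemma hmonom_field n (a : 'I_n -> F) (d : 'X_{1..n}) :
  hmonom (a : 'I_n -> hyperfield_of F) d = \prod_(i < n) a i ^+ d i.
Proof. by apply: eq_bigr => i _; rewrite hexp_field. Qed.

Lemma hom_hmonom n (a : 'I_n -> hyperfield_of F) (d : 'X_{1..n}) :
  f (hmonom a d) = hmonom (f \o a) d.
Proof.
by rewrite /hmonom [LHS]hom_prod; apply: eq_bigr => i _; rewrite hom_hexp.
Qed.

Lemma hom_hlmonom n (a : 'I_n -> hyperfield_of F) (d : {ffun 'I_n -> int}) :
  (forall i, a i != h0) -> f (hlmonom a d) = hlmonom (f \o a) d.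
Proof.
by move=> a0; rewrite /hlmonom [LHS]hom_prod; apply: eq_bigr => i _; rewrite hom_hexpz.
Qed.

Lemma pushforwardE (M : choiceType) (p : hexpr M (hyperfield_of F)) d :
  pushforward f p d = f (p d).
Proof.
rewrite fsfunE; case: ifP => // /negbT; rewrite memNfinsupp => /eqP ->.
by rewrite (hom_0 fhom).
Qed.

Lemma finsupp_pushforward (M : choiceType) (p : hexpr M (hyperfield_of F)) :
  {subset finsupp (pushforward f p) <= finsupp p}.
Proof.
move=> d; apply: contraLR; rewrite !memNfinsupp pushforwardE => /eqP ->.
by rewrite (hom_0 fhom).
Qed.

Lemma heval_field (M : choiceType) (mon : M -> hyperfield_of F)
    (p : hexpr M (hyperfield_of F)) (s : seq M) :
  uniq s -> {subset finsupp p <= s} ->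
  heval mon p h0 <-> \sum_(d <- s) (p d : F) * (mon d : F) = 0.
Proof.
move=> us sub; rewrite (heval_hypersum mon us sub).
by rewrite (hypersum_field s (fun d => (p d : F) * (mon d : F))); split=> /esym.
Qed.

Lemma heval_pushforward (M : choiceType) (mon : M -> hyperfield_of F) (mon' : M -> H)
    (p : hexpr M (hyperfield_of F)) (s : seq M) :
  (forall d, f (mon d) = mon' d) -> uniq s -> {subset finsupp p <= s} ->
  heval mon' (pushforward f p) = hypersum s (fun d => f ((p d : F) * (mon d : F))).
Proof.
move=> fmon us sub; rewrite (heval_hypersum mon' us (s := s)); last first.
  by move=> d /finsupp_pushforward/sub.
by apply: eq_bigr => d _; rewrite pushforwardE -fmon -(hom_mul fhom).
Qed.

Lemma pushforward_zero (M : choiceType) (mon : M -> hyperfield_of F) (mon' : M -> H)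
    (p : hexpr M (hyperfield_of F)) :
  (forall d, f (mon d) = mon' d) -> heval mon p h0 -> heval mon' (pushforward f p) h0.
Proof.
move=> fmon p0; have us := fset_uniq (finsupp p).
have sub : {subset finsupp p <= (finsupp p : seq M)} by [].
rewrite (heval_pushforward fmon us sub).
have := hom_hypersum (finsupp p) (fun d => (p d : F) * (mon d : F)).
by rewrite ((heval_field mon us sub).1 p0) (hom_0 fhom).
Qed.
End FieldHom.

Section RelativelyClosed.
Variables (F : fieldType) (H : hyperfieldType) (f : hyperfield_of F -> H).
Hypothesis hf : relatively_algebraically_closed f.

Let fhom : hyperfield_hom f. Proof. by case: hf. Qed.

(** The hypothesis says that [1] is a root of the push-forward of the univariate
    polynomial with coefficients [c], so this is relative closedness for the
    root [1]. *)
Lemma lift_hypersum (c : nat -> F) N :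
  hypersum (iota 0 N) (fun i => f (c i)) h0 ->
  exists2 w, f w = h1 & \sum_(i <- iota 0 N) c i * w ^+ i = 0.
Proof.
move=> h; case: (hf) => _ _ lift.
pose mk (i : nat) : 'X_{1..1} := [multinom i | _ < 1].
have mk0 i : mk i ord0 = i by rewrite mnmE.
have mk_inj : injective mk by move=> i j /(congr1 (fun d : 'X_{1..1} => d ord0)); rewrite !mk0.
pose s := [seq mk i | i <- iota 0 N].
have us : uniq s by rewrite map_inj_uniq // iota_uniq.
pose p : hpoly 1 (hyperfield_of F) := [fsfun d in [fset d | d in s]%fset => c (d ord0)].
have sub : {subset finsupp p <= s}.
  by move=> d; apply: contraLR => nd; rewrite memNfinsupp fsfunE !inE (negPf nd).
have pE i : i \in iota 0 N -> p (mk i) = c i.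
  by move=> iN; rewrite fsfunE !inE map_f // mk0.
have fmon1 (d : 'X_{1..1}) : f (hmonom (fun=> h1 : hyperfield_of F) d) = hmonom (fun=> h1) d.
  by rewrite (hom_hmonom fhom); congr hmonom; apply/funext => i /=; exact: (hom_1 fhom).
have mon1 (d : 'X_{1..1}) : hmonom (fun=> h1 : hyperfield_of F) d = 1 :> F.
  by rewrite (hmonom_field (fun=> 1)) big1 // => i _; rewrite expr1n.
have [|a fa Va] := lift p h1.
  rewrite /V /= (heval_pushforward fhom fmon1 us sub).
  suff <- : hypersum (iota 0 N) (fun i => f (c i)) =
      hypersum s (fun d => f ((p d : F) * (hmonom (fun=> h1 : hyperfield_of F) d : F))) by [].
  rewrite /hypersum big_map; apply: eq_big_seq => i iN.
  by rewrite pE // mon1 mulr1.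
exists a => //; rewrite -[RHS]((heval_field _ us sub).1 Va) big_map.
apply: eq_big_seq => i iN; rewrite pE // (hmonom_field (fun=> a)).
by rewrite big_ord_recl big_ord0 mulr1 mk0.
Qed.

Lemma fibre_root_lifting : root_lifting [set u : F | f u = h1].
Proof.
move=> p u fu Su.
have [|w fw Sw] := @lift_hypersum (fun i => p`_i) (size p).
  have -> : (fun i => f p`_i) = (fun i => f (p`_i * u i)).
    apply/funext => i; rewrite (hom_mul fhom) (fu i) -(hom_1 fhom) -(hom_mul fhom).
    by congr f; exact/esym/mulr1.
  rewrite -(hom_0 fhom) -[h0 in f h0]/(0 : F) -[in f _]Su -(big_mkord xpredT (fun i => p`_i * u i)).
  rewrite /index_iota subn0; exact: (hom_hypersum fhom).
exists w => //; apply/eqP; rewrite horner_coef -[RHS]Sw.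
by rewrite -(big_mkord xpredT (fun i => p`_i * w ^+ i)) /index_iota subn0.
Qed.

Lemma lift_hypersum_seq (T : eqType) (s : seq T) (z : T -> F) : uniq s ->
  hypersum s (fun d => f (z d)) h0 ->
  exists2 u : T -> F, forall d, f (u d) = h1 & \sum_(d <- s) z d * u d = 0.
Proof.
move=> us; case: s us => [|d0 s] us.
  by exists (fun=> 1); [move=> d; exact: (hom_1 fhom)|rewrite big_nil].
rewrite /hypersum (big_nth d0) /index_iota subn0 => /lift_hypersum[w fw Sw].
exists (fun d => w ^+ index d (d0 :: s)).
  move=> d; rewrite -hexp_field (hom_hexp fhom) fw.
  by elim: (index _ _) => //= k IH; rewrite /hexp /= -/(hexp _ _) IH hmul1 // h1_neq0.
rewrite (big_nth d0) /index_iota subn0 -[RHS]Sw; apply: eq_big_seq => i.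
by rewrite mem_iota add0n => /andP[_ i_s]; rewrite index_uniq.
Qed.
End RelativelyClosed.

(** * Lifting zeros of polynomials *)
(** Numerals in base [B] are unique; exponents become numerals under Kronecker's
    substitution. *)
Lemma digits_inj B n (d e : 'I_n -> nat) :
  (forall i, (d i < B)%N) -> (forall i, (e i < B)%N) ->
  (\sum_(i < n) d i * B ^ i = \sum_(i < n) e i * B ^ i)%N -> d =1 e.
Proof.
elim: n d e => [|n IH] d e dB eB; first by move=> _ [].
rewrite !big_ord_recl !muln1.
have shift (g : 'I_n.+1 -> nat) :
    (\sum_(i < n) g (fintype.lift ord0 i) * B ^ fintype.lift ord0 i =
     B * \sum_(i < n) g (fintype.lift ord0 i) * B ^ i)%N.
  by rewrite big_distrr; apply: eq_bigr => i _; rewrite /= /bump /= add1n expnS mulnCA.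
rewrite !shift => e0.
have B0 : (0 < B)%N by apply: leq_ltn_trans (dB ord0).
have h0 : d ord0 = e ord0.
  have := congr1 (modn^~ B) e0; rewrite ![(_ + B * _)%N]addnC ![(B * _)%N]mulnC !modnMDl.
  by rewrite !modn_small.
have h1 := IH (d \o fintype.lift ord0) (e \o fintype.lift ord0) (fun i => dB _) (fun i => eB _).
move=> i; case: (unliftP ord0 i) => [j ->|->//]; apply: h1.
move: e0; rewrite h0 => /addnI/eqP; rewrite eqn_pmul2l // => /eqP.
by [].
Qed.

Lemma coef_pairing (R : comNzRingType) (T : eqType) (s : seq T) (a : T -> R)
    (k : T -> nat) (u : nat -> R) (q : {poly R}) :
  q = \sum_(d <- s) a d *: 'X^(k d) ->
  \sum_(i < size q) q`_i * u i = \sum_(d <- s) a d * u (k d).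
Proof.
move=> Dq; pose N := (size q + \sum_(d <- s) (k d).+1)%N.
have kN d : d \in s -> (k d < N)%N.
  by move=> ds; rewrite /N (big_rem d ds) /= addnCA leq_addr.
have -> : \sum_(i < size q) q`_i * u i = \sum_(i < N) q`_i * u i.
  rewrite (big_ord_widen N (fun i => q`_i * u i)) ?leq_addr // big_mkcond.
  by apply: eq_bigr => i _; case: ltnP => // h; rewrite nth_default ?mul0r.
rewrite {1}Dq; under eq_bigr do rewrite coef_sum mulr_suml.
rewrite exchange_big; apply: eq_big_seq => d ds.
rewrite (bigD1 (Ordinal (kN d ds))) //= coefZ coefXn eqxx mulr1 big1 ?addr0 // => i ni.
by rewrite coefZ coefXn -val_eqE /= in ni *; rewrite (negPf ni) mulr0 mul0r.
Qed.

Section Polynomials.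
Variables (F : fieldType) (n : nat).

Lemma poly_hexprE (p : {mpoly F[n]}) d : poly_hexpr p d = p@_d.
Proof.
rewrite fsfunE !inE; case: ifP => // /negbT dp.
by rewrite memN_msupp_eq0.
Qed.

Lemma finsupp_poly_hexpr (p : {mpoly F[n]}) : {subset finsupp (poly_hexpr p) <= msupp p}.
Proof.
move=> d; apply: contraLR => dp; rewrite memNfinsupp poly_hexprE memN_msupp_eq0 //.
Qed.

Lemma V_poly_hexpr (p : {mpoly F[n]}) (a : 'I_n -> F) :
  V (poly_hexpr p) (a : 'I_n -> hyperfield_of F) <-> p.@[a] = 0.
Proof.
rewrite /V /= (heval_field _ (msupp_uniq p) (@finsupp_poly_hexpr p)) mevalE.
by under eq_bigr do rewrite poly_hexprE (hmonom_field a).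
Qed.
End Polynomials.

Section Lifting.
Variables (F : closedFieldType) (H : hyperfieldType) (f : hyperfield_of F -> H).
Hypothesis hf : relatively_algebraically_closed f.
Variable n : nat.

Let fhom : hyperfield_hom f. Proof. by case: hf. Qed.
Let U : set F := [set u : F | f u = h1].

Let fM (x y : F) : f (x * y) = hmul (f x) (f y).
Proof. exact: (hom_mul fhom). Qed.

Let U1 : U 1. Proof. exact: (hom_1 fhom). Qed.
Let U0 : ~ U 0.
Proof.
move=> e; have := hom_0 fhom; rewrite -[f h0]/(f 0) e => /eqP.
by rewrite (negPf (@h1_neq0 H)).
Qed.
Let UM (x y : F) : U x -> U y -> U (x * y).
Proof. by rewrite /U /= fM => -> ->; rewrite hmul1 // h1_neq0. Qed.
Let Uneq0 (x : F) : U x -> x != 0.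
Proof. by move=> Ux; apply/eqP => x0; rewrite x0 in Ux. Qed.
Let UV (x : F) : U x -> U x^-1.
Proof.
move=> Ux; have x0 := Uneq0 Ux.
have e : f (x * x^-1) = h1 by rewrite mulfV //; exact: U1.
by move: e; rewrite fM Ux hmul1 // (hom_neq0 fhom) // invr_eq0.
Qed.
Let UX (x : F) k : U x -> U (x ^+ k).
Proof.
by move=> Ux; elim: k => [|k IH]; [rewrite expr0; exact: U1|rewrite exprS; apply: UM].
Qed.

(** Kronecker's substitution [X_i = X^(B^i)] separates the monomials of a
    polynomial and so reduces a hypersurface to the univariate case. *)
Lemma hypersurface_lifting (p : {mpoly F[n]}) (c : 'I_n -> F) :
  V (pushforward f (poly_hexpr p)) (f \o c) ->
  exists2 y : 'I_n -> F, forall i, U (y i) & p.@[fun i => c i * y i] = 0.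
Proof.
rewrite /V /= (heval_pushforward fhom (hom_hmonom fhom c) (msupp_uniq p)
                 (@finsupp_poly_hexpr _ _ p)).
move/(lift_hypersum_seq hf (msupp_uniq p)) => [u Uu Su].
pose B := msize p.
pose k (d : 'X_{1..n}) := (\sum_(i < n) d i * B ^ i)%N.
have dB d i : d \in msupp p -> (d i < B)%N.
  move=> /msize_mdeg_lt; apply: leq_ltn_trans.
  by rewrite mdegE (bigD1 i) //= leq_addr.
have k_inj d e : d \in msupp p -> e \in msupp p -> k d = k e -> d = e.
  move=> dp ep kde; apply/mnmP; apply: (@digits_inj B) kde => i; exact: dB.
pose a d := p@_d * \prod_(i < n) c i ^+ d i.
pose q := \sum_(d <- msupp p) a d *: 'X^(k d).
pose w j := if pselect (exists2 d, d \in msupp p & k d = j) is left e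
  then u (projT1 (cid2 e)) else 1.
have wU j : U (w j) by rewrite /w; case: pselect => *; [exact: Uu|exact: U1].
have wk d : d \in msupp p -> w (k d) = u d.
  move=> dp; rewrite /w; case: pselect => [e|[]]; last by exists d.
  by congr u; case: cid2 => d' d'p kd /=; apply: k_inj.
have [|x Ux qx] := fibre_root_lifting hf (p := q) wU.
  rewrite (coef_pairing w (erefl q)) -[RHS]Su; apply: eq_big_seq => d dp.
  by rewrite wk // poly_hexprE (hmonom_field c).
exists (fun i => x ^+ (B ^ i)) => [i|]; first exact: UX.
move: qx; rewrite rootE horner_sum => /eqP qx; rewrite mevalE -[RHS]qx.
apply: eq_bigr => d _; rewrite hornerZ hornerXn -mulrA; congr (_ * _).
under eq_bigr do rewrite exprMn -exprM mulnC.
by rewrite big_split /= prodrXr.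
Qed.

(** Rescaling by a preimage [c] of [b] moves the fibre over [b] to [U^n], except
    for the coordinates where [c] vanishes. *)
Lemma lift_point (I : set {mpoly F[n]}) (b : 'I_n -> H) : ideal I ->
  VS [set (pushforward f (poly_hexpr p) : hpoly n H) | p in I] b ->
  exists2 a : 'I_n -> F, f \o a = b & forall p, I p -> p.@[a] = 0.
Proof.
move=> [I0 ID IM] Vb.
have [c Dc] : exists c : 'I_n -> F, forall i, f (c i) = b i.
  case: (hf) => _ fsurj _; have [c cP] := choice (fun i => fsurj (b i)).
  by exists c.
have Db : f \o c = b by apply/funext => i; exact: Dc.
have [O [sh [vO shU]]] := root_lifting_shape U1 U0 UM UV (fibre_root_lifting hf).
pose C := @mpolyC n F.
pose hc i : {mpoly F[n]} := (c i)%:MP * 'X_i.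
pose hr i : {mpoly F[n]} := if c i == 0 then 1 else 'X_i.
pose hv i : {mpoly F[n]} := if c i == 0 then 1 else (c i)^-1%:MP * 'X_i.
have evc (p : {mpoly F[n]}) y : (mmap C hc p).@[y] = p.@[fun i => c i * y i].
  rewrite /meval mmap_subst; congr (mmap _ _ p); apply/funext => i.
  by rewrite -[LHS]/((hc i).@[y]) mevalM mevalC mevalXU.
(* a variable [X_i] with [c i = 0] is not constrained by the rescaled ideal; it
   is set to [1], so that all coordinates range over [U] *)
pose I' : set {mpoly F[n]} := [set q | exists2 p, I p & mmap C hc p = mmap C hr q].
have [||y yU yI'] := common_zero vO shU (I := I').
- split.
  + by exists 0; rewrite ?rmorph0.
  + by move=> q q' [p Ip e] [p' Ip' e']; exists (p + p'); [exact: ID|by rewrite !mmapD e e'].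
  + move=> r q [p Ip e]; exists (mmap C hv r * p); first exact: IM.
    rewrite !rmorphM /= e mmap_subst; congr (mmap _ _ r * _); apply/funext => i.
    rewrite /hv /hr; case: eqP => [_|/eqP ci]; first exact: rmorph1.
    by rewrite rmorphM /= mmapC mmapX mmap1U mulrA -mpolyCM mulVf // mul1r.
- move=> q [p Ip e].
  have [|y yU py] := @hypersurface_lifting p c.
    by rewrite Db; apply: Vb; exists p.
  exists (fun i => if c i == 0 then 1 else y i) => [i|]; first by case: ifP.
  rewrite -[RHS]py -evc e /meval mmap_subst; congr (mmap _ _ q); apply/funext => i.
  rewrite -[RHS]/((hr i).@[y]) /hr; case: ifP => _; first by rewrite meval1.
  by rewrite mevalXU.
exists (fun i => c i * y i).
  apply/funext => i; rewrite /= -Dc.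
  have [->|ci] := eqVneq (c i) 0; first by rewrite mul0r.
  by rewrite mulrC fM yU hmul1 // (hom_neq0 fhom).
move=> p Ip; rewrite -evc; apply: yI'; exists p => //.
rewrite mmap_subst; congr (mmap _ _ p); apply/funext => i.
rewrite rmorphM /= mmapC mmapX mmap1U /hr /hc; case: eqP => // ->.
by rewrite !mul0r.
Qed.
End Lifting.

(** * Laurent polynomials *)
Section LaurentPolynomials.
Variables (F : fieldType) (n : nat).
Local Notation E := {ffun 'I_n -> int}.
Local Notation L := (laurent n F).

Definition lmono (c : F) (d : E) : L := << c *g d >>.

Lemma lmonoM c c' d d' : lmono c d * lmono c' d' = lmono (c * c') (d + d').
Proof.
rewrite -[LHS]/(laurent_mul _ _) /laurent_mul /lmono.
have [->|c0] := eqVneq c 0; first by rewrite mul0r !freegU0 dom0 big_nil.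
have [->|c'0] := eqVneq c' 0.
  by rewrite mulr0 !freegU0 dom0 big1 // => d1 _; rewrite big_nil.
by rewrite !domU // !big_seq1 !coeffU !eqxx !mulr1.
Qed.

Lemma lmono_sum (p : L) : p = \sum_(d <- dom p) lmono (coeff d p) d.
Proof. by rewrite freeg_sumE. Qed.

Definition lconst (c : F) : L := lmono c 0.
Let lconst_zmod : zmod_morphism lconst.
Proof. by move=> c c'; rewrite /lconst /lmono freegUB. Qed.
Let lconst_monoid : monoid_morphism lconst.
Proof. by split=> // c c'; rewrite /lconst lmonoM addr0. Qed.
HB.instance Definition _ := GRing.isZmodMorphism.Build F L lconst lconst_zmod.
HB.instance Definition _ := GRing.isMonoidMorphism.Build F L lconst lconst_monoid.

Definition nat_exponent (m : 'X_{1..n}) : E := [ffun i => Posz (m i)].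

Lemma nat_exponent_inj : injective nat_exponent.
Proof.
move=> m m' /ffunP e; apply/mnmP => i; have := e i; rewrite !ffunE.
by case.
Qed.

Definition lvar (i : 'I_n) : L := lmono 1 (nat_exponent U_(i)%MM).

Definition to_laurent : {rmorphism {mpoly F[n]} -> L} := mmap lconst lvar.

Lemma to_laurentE (q : {mpoly F[n]}) :
  to_laurent q = \sum_(m <- msupp q) lmono q@_m (nat_exponent m).
Proof.
apply: eq_bigr => m _.
have expX (d : E) k : lmono 1 d ^+ k = lmono 1 (d *+ k).
  elim: k => [|k IH]; first by rewrite expr0 mulr0n.
  by rewrite exprS IH lmonoM mulr1 mulrS.
have prodX (I : Type) (s : seq I) (d : I -> E) :
    \prod_(i <- s) lmono 1 (d i) = lmono 1 (\sum_(i <- s) d i).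
  elim: s => [|i s IH]; first by rewrite !big_nil.
  by rewrite !big_cons IH lmonoM mulr1.
rewrite /mmap1 /lvar; under eq_bigr do rewrite expX.
rewrite prodX lmonoM mulr1 add0r; congr lmono; apply/ffunP => j.
rewrite sum_ffunE ffunE (bigD1 j) //= big1 => [|i ij].
  by rewrite ffunMnE ffunE mnm1E eqxx addr0; exact: natz.
by rewrite ffunMnE ffunE mnm1E (negPf ij) mul0rn.
Qed.

Lemma coeff_to_laurent (q : {mpoly F[n]}) d :
  coeff d (to_laurent q) = \sum_(m <- msupp q) q@_m * (nat_exponent m == d)%:R.
Proof.
by rewrite to_laurentE raddf_sum; apply: eq_bigr => m _; rewrite /= coeffU.
Qed.

Lemma coeff_to_laurent_nat (q : {mpoly F[n]}) m : m \in msupp q ->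
  coeff (nat_exponent m) (to_laurent q) = q@_m.
Proof.
move=> mq; rewrite coeff_to_laurent (bigD1_seq m) ?msupp_uniq //= eqxx mulr1 big1 ?addr0 //.
by move=> m' m'm; rewrite (inj_eq nat_exponent_inj) (negPf m'm) mulr0.
Qed.

Lemma laurent_hexprE (p : L) d : laurent_hexpr p d = coeff d p.
Proof. by rewrite fsfunE !inE; case: ifP => // /negbT/coeff_outdom ->. Qed.

Lemma finsupp_laurent_hexpr (p : L) : {subset finsupp (laurent_hexpr p) <= dom p}.
Proof.
move=> d; apply: contraLR => dp; rewrite memNfinsupp laurent_hexprE coeff_outdom //.
Qed.

Lemma finsupp_to_laurent (q : {mpoly F[n]}) :
  {subset finsupp (laurent_hexpr (to_laurent q)) <= [seq nat_exponent m | m <- msupp q]}.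
Proof.
move=> d; apply: contraLR => dq; rewrite memNfinsupp laurent_hexprE coeff_to_laurent.
apply/eqP; rewrite big_seq big1 // => m mq; case: eqP => [e|_]; last by rewrite mulr0.
by move: dq; rewrite -e map_f.
Qed.

Lemma hlmonom_nat (H : hyperfieldType) (a : 'I_n -> H) m :
  hlmonom a (nat_exponent m) = hmonom a m.
Proof. by apply: eq_bigr => i _; rewrite ffunE. Qed.

Lemma hlmonom_field (a : 'I_n -> F) (d : E) : (forall i, a i != 0) ->
  hlmonom (a : 'I_n -> hyperfield_of F) d = \prod_(i < n) a i ^ d i.
Proof.
move=> a0; apply: eq_bigr => i _; case: (d i) => k /=; first exact: hexp_field.
by rewrite NegzE -exprnN -exprVn; exact: (hexp_field (a i)^-1 k.+1).
Qed.

(** Multiplication by a monomial makes all exponents nonnegative. *)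
Lemma monomial_shift (p : L) : exists (k : E) (q : {mpoly F[n]}),
  to_laurent q = lmono 1 k * p /\
  forall a : 'I_n -> F, (forall i, a i != 0) ->
    q.@[a] = (\prod_(i < n) a i ^ k i) * \sum_(d <- dom p) coeff d p * \prod_(i < n) a i ^ d i.
Proof.
pose K : nat := (\sum_(d <- dom p) \sum_(i < n) `|d i|)%N.
have le_K d i : d \in dom p -> (`|d i| <= K)%N.
  move=> dp; rewrite /K (bigD1_seq d) ?uniq_dom //= (bigD1 i) //=.
  by rewrite -addnA leq_addr.
pose k : E := [ffun => K%:Z].
pose mk (d : E) : 'X_{1..n} := [multinom `|(d i + k i)%R|%N | i < n].
have mkE d i : d \in dom p -> (mk d i : int) = d i + k i.
  move=> dp; rewrite mnmE gez0_abs // ffunE.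
  by have := le_K d i dp; move: (d i : int) (K) => x N; lia.
pose q := \sum_(d <- dom p) coeff d p *: 'X_[mk d] : {mpoly F[n]}.
have toX m : to_laurent 'X_[m] = lmono 1 (nat_exponent m).
  by rewrite to_laurentE msuppX big_seq1 mcoeffX eqxx.
have mk_nat d : d \in dom p -> nat_exponent (mk d) = d + k.
  by move=> dp; apply/ffunP => i; rewrite ffunE mkE // [in RHS]ffunE.
exists k, q; split.
  rewrite [in RHS](lmono_sum p) mulr_sumr rmorph_sum; apply: eq_big_seq => d dp.
  rewrite -mul_mpolyC rmorphM toX /= mmapC /lconst mk_nat // !lmonoM.
  by rewrite mulr1 mul1r add0r addrC.
move=> a a0; rewrite /q raddf_sum mulr_sumr; apply: eq_big_seq => d dp.
rewrite /= mevalZ mevalX mulrCA; congr (_ * _); rewrite -big_split; apply: eq_bigr => i _ /=.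
by rewrite -expfzDr // addrC -mkE.
Qed.
End LaurentPolynomials.
Arguments to_laurent {F n}.

Section Main.
Variables (F : closedFieldType) (H : hyperfieldType) (f : hyperfield_of F -> H).
Hypothesis hf : relatively_algebraically_closed f.
Variable n : nat.

Let fhom : hyperfield_hom f. Proof. by case: hf. Qed.

(** At points with nonzero coordinates, [J] and the ideal of the polynomials in
    [J] impose the same conditions. *)
Lemma lift_laurent_point (J : set (laurent n F)) (b : 'I_n -> H) : ideal J ->
  VxS [set (pushforward f (laurent_hexpr p) : hlaurent n H) | p in J] b ->
  exists a : 'I_n -> F, [/\ f \o a = b, forall i, a i != 0 &
    forall p, J p -> \sum_(d <- dom p) coeff d p * \prod_(i < n) a i ^ d i = 0].
Proof.
move=> [J0 JD JM] [b0 Vb].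
have [c Dc] : exists c : 'I_n -> F, f \o c = b.
  case: (hf) => _ fsurj _; have [c cP] := choice (fun i => fsurj (b i)).
  by exists c; apply/funext.
have nonzero (a : 'I_n -> F) : f \o a = b -> forall i, a i != 0.
  move=> Da i; apply: contra_neq (b0 i) => ai.
  by rewrite -Da /= ai; exact: (hom_0 fhom).
have c0 := nonzero c Dc.
pose I : set {mpoly F[n]} := [set q | J (to_laurent q)].
have [||a Da aI] := @lift_point F H f hf n I b.
- split; rewrite /I /=.
  + by rewrite rmorph0.
  + by move=> p q Jp Jq; rewrite rmorphD; apply: JD.
  + by move=> p q Jq; rewrite rmorphM; apply: JM.
- move=> _ [q Iq <-]; rewrite /V /=.
  have [_] : Vx (pushforward f (laurent_hexpr (to_laurent q)) : hlaurent n H) b.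
    by apply: Vb; exists (to_laurent q).
  have us : uniq [seq nat_exponent m | m <- msupp q].
    by rewrite map_inj_uniq ?msupp_uniq //; apply: nat_exponent_inj.
  have hl d : f (hlmonom (c : 'I_n -> hyperfield_of F) d) = hlmonom b d.
    by rewrite (hom_hlmonom fhom) ?Dc.
  have hm d : f (hmonom (c : 'I_n -> hyperfield_of F) d) = hmonom b d.
    by rewrite (hom_hmonom fhom) ?Dc.
  rewrite (heval_pushforward fhom hl us (@finsupp_to_laurent _ _ q)).
  rewrite (heval_pushforward fhom hm (msupp_uniq q) (@finsupp_poly_hexpr _ _ q)).
  suff -> : hypersum [seq nat_exponent m | m <- msupp q]
      (fun d => f ((laurent_hexpr (to_laurent q) d : F) *
        (hlmonom (c : 'I_n -> hyperfield_of F) d : F))) =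
    hypersum (msupp q) (fun m => f ((poly_hexpr q m : F) *
        (hmonom (c : 'I_n -> hyperfield_of F) m : F))) by [].
  rewrite /hypersum big_map; apply: eq_big_seq => m mq.
  by rewrite laurent_hexprE coeff_to_laurent_nat // poly_hexprE hlmonom_nat.
exists a; split=> //; first exact: nonzero.
move=> p Jp; have a0 := nonzero a Da.
have [k [q [Dq qa]]] := monomial_shift p.
have /eqP := aI q (ltac:(by rewrite /I /= Dq; apply: JM)).
rewrite qa // mulf_eq0 => /orP[|/eqP//].
rewrite prodf_seq_eq0 => /hasP[i _] /=.
by rewrite expfz_eq0 (negPf (a0 i)) andbF.
Qed.

End Main.

Lemma Vx_laurent_hexpr (F : fieldType) n (p : laurent n F) (a : 'I_n -> F) :
  (forall i, a i != 0) ->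
  heval (hlmonom (a : 'I_n -> hyperfield_of F)) (laurent_hexpr p) h0 <->
  \sum_(d <- dom p) coeff d p * \prod_(i < n) a i ^ d i = 0.
Proof.
move=> a0; rewrite (heval_field _ (uniq_dom p) (@finsupp_laurent_hexpr _ _ p)).
by under eq_bigr do rewrite laurent_hexprE (hlmonom_field _ a0).
Qed.

Theorem corollary4p7 (F : closedFieldType) (H : hyperfieldType)
    (f : hyperfield_of F -> H) (hf : relatively_algebraically_closed f)
    (n : nat) :
  (forall I : set {mpoly F[n]}, ideal I ->
     [set f \o a | a in VS (@poly_hexpr n F @` I)] =
     VS [set (pushforward f (poly_hexpr p) : hpoly n H) | p in I]) /\
  (forall J : set (laurent n F), ideal J ->
     [set f \o a | a in VxS (@laurent_hexpr n F @` J)] =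
     VxS [set (pushforward f (laurent_hexpr p) : hlaurent n H) | p in J]).
Proof.
have fhom : hyperfield_hom f by case: hf.
split=> [I Iid|J Jid]; apply/seteqP; split=> b.
- move=> [a Va <-] _ [p Ip <-].
  apply: (pushforward_zero fhom (hom_hmonom fhom a)).
  by apply: Va; exists p.
- move=> /(lift_point hf Iid)[a <- aI]; exists (a : 'I_n -> hyperfield_of F) => //.
  by move=> _ [p Ip <-]; apply/V_poly_hexpr/aI.
- move=> [a [a0 Va] <-]; have fa0 i : f (a i) != h0 by apply: (hom_neq0 fhom).
  split=> // _ [p Jp <-]; split=> //.
  apply: (pushforward_zero fhom (fun d => hom_hlmonom fhom d a0)).
  by have [|_] := Va (laurent_hexpr p); first by exists p.
- move=> /(lift_laurent_point hf Jid)[a [<- a0 aJ]].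
  exists (a : 'I_n -> hyperfield_of F) => //; split=> // _ [p Jp <-]; split=> //.
  by apply/Vx_laurent_hexpr => //; apply: aJ.
Qed.
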